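(* Let $G$ be a grid diagram with parameters $(n,p,q)$ representing a knot $K\subset L(p,q)$. Then: (i) There exists a sign assignment on $G$, and it can be described combinatorially: the function $\mathcal{S}_\rho$ built (as in the context) from a section $\rho$ of the Spin central extension $\widetilde{\mathfrak{S}}_n\to\mathfrak{S}_n$ is a sign assignment on $G$. (ii) For the fixed grid diagram $G$, the sign refined grid homology does not depend on the choice of sign assignment: if $\mathcal{S}_1,\mathcal{S}_2$ are two sign assignments on $G$, then $H_*(\mathrm{GC}^-(G;\mathbb{Z}),\partial_{\mathcal{S}_1})\cong H_*(\mathrm{GC}^-(G;\mathbb{Z}),\partial_{\mathcal{S}_2})$ as tri-graded $\mathbb{Z}[V_1,\dots,V_n]$-modules, and likewise $H_*(\widehat{\mathrm{GC}}(G;\mathbb{Z}),\partial_{\mathcal{S}_1})\cong H_*(\widehat{\mathrm{GC}}(G;\mathbb{Z}),\partial_{\mathcal{S}_2})$.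
   Context: **Grid diagrams.** Let $n\ge 1$ and let $p\ge 1$, $q$ be coprime integers with $0<q<p$, or $(p,q)=(1,0)$. Let $T=\mathbb{R}^2/\Lambda$, where $\Lambda$ is the lattice generated by $(pn,0)$ and $(qn,n)$ (equivalently, the rectangle $[0,pn]\times[0,n]$ with left and right sides identified, and $(s,n)\sim(s-qn \bmod pn,0)$); a fundamental domain is $[0,pn)\times[0,n)$. For $1\le l,j\le n$, $\alpha_l\subset T$ is the circle that is the image of the line $\{y=l-1\}$, and $\beta_j\subset T$ is the circle that is the image of the lines $\{x=c\}$, $c\in\mathbb{Z}$, $c\equiv j-1 \pmod n$. Each $\alpha_l$ meets each $\beta_j$ in $p$ points. The row (column) regions are the annuli between consecutive $\alpha$ (resp. $\beta$) circles. A grid diagram $G$ with parameters $(n,p,q)$ is this data with two sets of markings $\mathbb{X}=\{\mathbb{X}_1,\dots,\mathbb{X}_n\}$, $\mathbb{O}=\{\mathbb{O}_1,\dots,\mathbb{O}_n\}$, placed at centres of unit squares of $T\setminus(\alpha\cup\beta)$, such that each row and each column contains exactly one $\mathbb{X}$ and one $\mathbb{O}$, and each square contains at most one marking. Joining each $\mathbb{X}$ to the $\mathbb{O}$ in its row, and each $\mathbb{O}$ to the $\mathbb{X}$ in its column (vertical arcs over horizontal ones), gives a link in the lens space $L(p,q)$; $G$ represents a knot if this link has a single component. **Generators.** $S(G)$ is the set of $n$-tuples of points of $\alpha\cap\beta$ with exactly one point on each $\alpha_l$ and one on each $\beta_j$. Identify $S(G)$ with $\mathfrak{S}_n\times\mathbb{Z}_p^n$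 ($\mathbb{Z}_p=\mathbb{Z}/p\mathbb{Z}$): $x=(\sigma_x,(a_1,\dots,a_n))$, where the point of $x$ on $\alpha_l$ lies on $\beta_{\sigma_x(l)}$ and equals the image of $(a_l n+\sigma_x(l)-1,\;l-1)$, $0\le a_l\le p-1$. The $a_l$ are the $p$-coordinates of $x$. **Gradings.** For finite sets $A,B\subset\mathbb{R}^2$, $\mathcal{I}(A,B)$ is the number of pairs $((a_1,a_2),(b_1,b_2))\in A\times B$ with $a_1<b_1$ and $a_2<b_2$. For an $n$-tuple $x=\{(c_i,b_i)\}$ in $[0,pn)\times[0,n)$ set $\widetilde{x}=\{(c_i+nqk \bmod np,\;b_i+nk)\;:\;1\le i\le n,\,0\le k\le p-1\}$. Define $d(1,0,0)=0$ and $d(p,q,i)=\frac{pq-(2i+1-p-q)^2}{4pq}+d(q,r,j)$, where $r,j$ are the reductions of $p,i$ modulo $q$ (the last argument is taken modulo $p$, in $\{0,\dots,p-1\}$). Then $$M(x)=\tfrac1p\left[\mathcal{I}(\widetilde x,\widetilde x)-\mathcal{I}(\widetilde x,\widetilde{\mathbb{O}})-\mathcal{I}(\widetilde{\mathbb{O}},\widetilde x)+\mathcal{I}(\widetilde{\mathbb{O}},\widetilde{\mathbb{O}})\right]+d(p,q,q-1)+1,$$ $$A(x)=\tfrac1{2p}\left[\mathcal{I}(\widetilde{\mathbb{O}},\widetilde{\mathbb{O}})-\mathcal{I}(\widetilde{\mathbb{X}},\widetilde{\mathbb{X}})+2\mathcal{I}(\widetilde{\mathbb{X}},\widetilde x)-2\mathcal{I}(\widetilde{\mathbb{O}},\widetilde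 x)\right]+\tfrac{1-n}2,$$ $$S(x)=q-1+\sum_{i=1}^n(a_i-a_i^{\mathbb{O}})\in\mathbb{Z}_p,$$ where $(a_1^{\mathbb{O}},\dots,a_n^{\mathbb{O}})$ are the $p$-coordinates of the generator consisting of the lower left corners of the squares containing the $\mathbb{O}$ markings. The tri-grading is $(M,A,S)\in(\mathbb{Q},\mathbb{Q},\mathbb{Z}_p)$, and each variable $V_i$ changes it by $(-2,-1,0)$. **Rectangles.** For $x,y\in S(G)$, $\mathrm{Rect}(x,y)$ is the set of rectangles $r=[a,a+w]\times[b,b+h]\subset\mathbb{R}^2$ with $a,b\in\mathbb{Z}$ and integers $0<w,h<pn$, up to translation by $\Lambda$ (viewed as immersed rectangles in $T$), such that the lower left and upper right corners project to two distinct points of $x$, the lower right and upper left corners project to two distinct points of $y$, and $x$ and $y$ agree in all other points. $\mathrm{Rect}(G)=\bigcup_{x,y}\mathrm{Rect}(x,y)$. $r\in \mathrm{Rect}(x,y)$ is empty, $r\in\mathrm{Rect}^\circ(x,y)$, if no interior point of $r$ projects to a point of $x$. $O_i(r)$ is the number of points of $r$ projecting to $\mathbb{O}_i$, and $r\cap\mathbb{X}=\emptyset$ means no point of $r$ projects to an $\mathbb{X}$ marking. **Concatenation.** For $r_1\in \mathrm{Rect}(x,y)$, $r_2\in \mathrm{Rect}(y,z)$, the concatenation $r_1*r_2$ is the polygon from $x$ to $z$, immersed in $T$, obtained by gluing $r_1$ and $r_2$ along the overlapping portions of the edges emanating from each point of $y$ that is a corner of both (it is the formal union of $r_1$ and $r_2$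 if they share no such corner). $r_1*r_2=r_3*r_4$ means that the two pairs are decompositions of the same immersed polygon from $x$ to $z$. $r_1*r_2$ is a horizontal annulus if $r_1,r_2$ have lifts $[a,a+w]\times[b,b+h]$ and $[a+w,a+pn]\times[b,b+h]$, and a vertical annulus if they have lifts $[a,a+w]\times[b,b+h]$ and $[a,a+w]\times[b+h,b+pn]$. **Sign assignments.** A sign assignment on $G$ is a function $\mathcal{S}:\mathrm{Rect}(G)\to\{\pm1\}$ such that: (1) if $r_1*r_2=r_3*r_4$ with $(r_1,r_2)\ne(r_3,r_4)$, then $\mathcal{S}(r_1)\mathcal{S}(r_2)=-\mathcal{S}(r_3)\mathcal{S}(r_4)$; (2) if $r_1*r_2$ is a horizontal annulus, then $\mathcal{S}(r_1)\mathcal{S}(r_2)=1$; (3) if $r_1*r_2$ is a vertical annulus, then $\mathcal{S}(r_1)\mathcal{S}(r_2)=-1$. **Spin central extension and $\mathcal{S}_\rho$.** $\widetilde{\mathfrak{S}}_n$ is the group generated by $z$ and $\widetilde\tau_{i,j}$ ($1\le i\ne j\le n$) with relations $z^2=1$; $z\widetilde\tau_{i,j}=\widetilde\tau_{i,j}z$; $\widetilde\tau_{i,j}^2=z$; $\widetilde\tau_{i,j}=z\widetilde\tau_{j,i}$; $\widetilde\tau_{i,j}\widetilde\tau_{k,l}=z\widetilde\tau_{k,l}\widetilde\tau_{i,j}$ for distinct $i,j,k,l$; $\widetilde\tau_{i,j}\widetilde\tau_{j,k}\widetilde\tau_{i,j}=\widetilde\tau_{j,k}\widetilde\tau_{i,j}\widetilde\tau_{j,k}=\widetilde\tau_{i,k}$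 for distinct $i,j,k$. The homomorphism $\pi:\widetilde{\mathfrak{S}}_n\to\mathfrak{S}_n$ sends $z\mapsto1$ and $\widetilde\tau_{i,j}$ to the transposition $\tau_{i,j}$; products in $\mathfrak{S}_n$ are read left to right ($\sigma\tau$ means first $\sigma$, then $\tau$). A section is a map of sets $\rho:\mathfrak{S}_n\to\widetilde{\mathfrak{S}}_n$ with $\pi\circ\rho=\mathrm{Id}$; extend it to $\mathfrak{S}_n\times\mathbb{Z}_p^n\to\widetilde{\mathfrak{S}}_n\times\mathbb{Z}_p^n$ by the identity on $\mathbb{Z}_p^n$. For $r\in\mathrm{Rect}(x,y)$ let $\varphi(r)=(\widetilde\tau_{i,j},\,(a^y_1-a^x_1,\dots,a^y_n-a^x_n))\in\widetilde{\mathfrak{S}}_n\times\mathbb{Z}_p^n$, where the points of $x$ and $y$ on the bottom edge of $r$ lie on $\beta_i$ and $\beta_j$ respectively, and $a^x,a^y$ are the $p$-coordinates of $x,y$. With the product group structure on $\widetilde{\mathfrak{S}}_n\times\mathbb{Z}_p^n$ and $z=(z,0)$, set $\mathcal{S}_\rho(r)=1$ if $\rho(x)\varphi(r)=\rho(y)$ and $\mathcal{S}_\rho(r)=-1$ if $\rho(x)\varphi(r)=z\rho(y)$. **Sign refined complexes.** $\mathrm{GC}^-(G;\mathbb{Z})$ is the free $\mathbb{Z}[V_1,\dots,V_n]$-module on $S(G)$, and $\widehat{\mathrm{GC}}(G;\mathbb{Z})$ is the free module on $S(G)$ over $\mathbb{Z}[V_1,\dots,V_n]/(V_1)$. For a sign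 assignment $\mathcal{S}$, the differential on both is $$\partial_{\mathcal{S}}(x)=\sum_{y\in S(G)}\ \sum_{r\in\mathrm{Rect}^\circ(x,y),\ r\cap\mathbb{X}=\emptyset}\mathcal{S}(r)\Big(\prod_{i=1}^nV_i^{O_i(r)}\Big)y,$$ extended linearly. The sign refined grid homology is the homology of these complexes.
   Formalization: The differential counts only those empty rectangles (disjoint from the X markings) whose interior embeds in T; with all empty immersed rectangles it need not respect the tri-grading, e.g. for some grid with (n,p,q)=(2,3,2). *)

(* Defs.v *)
From HB Require Import structures.
From mathcomp Require Import all_boot all_order all_fingroup all_algebra.
From mathcomp Require Import generic_quotient ring_quotient boolp mpoly.

Set Implicit Arguments.
Unset Strict Implicit.
Unset Printing Implicit Defensive.

Import Order.TTheory GRing.Theory Num.Theory.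
Local Open Scope quotient_scope.
Local Open Scope ring_scope.

Section PresentedGroup.
Variable X : choiceType.

(* [(g, false)] stands for the generator g, [(g, true)] for its inverse. *)
Definition word := seq (X * bool).

Variable R : word -> word -> Prop.

Inductive word_eq : word -> word -> Prop :=
| word_eq_refl u : word_eq u u
| word_eq_sym u v : word_eq u v -> word_eq v u
| word_eq_trans u v w : word_eq u v -> word_eq v w -> word_eq u w
| word_eq_cat u u' v v' :
    word_eq u u' -> word_eq v v' -> word_eq (u ++ v) (u' ++ v')
| word_eq_cancel g b : word_eq [:: (g, b); (g, ~~ b)] [::]
| word_eq_rel u v : R u v -> word_eq u v.

Definition word_eqb (u v : word) : bool := `[< word_eq u v >].

Lemma word_eqb_equiv : equiv_class_of word_eqb.
Proof.
split=> [u|u v|v u w]; first exact/asboolP/word_eq_refl.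
  by apply/asboolP/asboolP; apply: word_eq_sym.
by move=> /asboolP uv /asboolP vw; apply/asboolP; apply: word_eq_trans uv vw.
Qed.

Canonical word_eqb_equivRel := EquivRelPack word_eqb_equiv.
Canonical word_eqb_encModRel := defaultEncModRel word_eqb.

Definition presented := {eq_quot word_eqb}.
HB.instance Definition _ : EqQuotient word word_eqb presented :=
  EqQuotient.on presented.
HB.instance Definition _ := Choice.on presented.

Definition presented_of (u : word) : presented := \pi_presented u.

Lemma presented_ofP u v : presented_of u = presented_of v <-> word_eq u v.
Proof. by split=> [/eqmodP/asboolP //|uv]; apply/eqmodP/asboolP. Qed.

Lemma presented_repr (a : presented) : presented_of (repr a) = a.
Proof. exact: reprK. Qed.

Definition word_inv (u : word) : word := rev [seq (l.1, ~~ l.2) | l <- u].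

Definition presented_one : presented := presented_of [::].
Definition presented_mul (a b : presented) : presented :=
  presented_of (repr a ++ repr b).
Definition presented_inv (a : presented) : presented :=
  presented_of (word_inv (repr a)).

Lemma presented_mulE u v :
  presented_mul (presented_of u) (presented_of v) = presented_of (u ++ v).
Proof.
by apply/presented_ofP/word_eq_cat; apply/presented_ofP; rewrite presented_repr.
Qed.

Lemma word_inv_cat u v : word_inv (u ++ v) = word_inv v ++ word_inv u.
Proof. by rewrite /word_inv map_cat rev_cat. Qed.

Lemma word_invK : involutive word_inv.
Proof.
move=> u; rewrite /word_inv map_rev revK -map_comp map_id_in // => -[g b] _ /=.
by rewrite negbK.
Qed.

Lemma word_eq_invl u : word_eq (word_inv u ++ u) [::].
Proof.
elim: u => [|[g b] u IHu]; first exact: word_eq_refl.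
rewrite -cat1s word_inv_cat -catA [word_inv [:: _] ++ _]catA.
apply: word_eq_trans IHu; apply: word_eq_cat; first exact: word_eq_refl.
apply: (word_eq_cat (u' := [::])); last exact: word_eq_refl.
by have := word_eq_cancel g (~~ b); rewrite negbK.
Qed.

Lemma presented_mulA : associative presented_mul.
Proof.
move=> a b c; rewrite -[a]presented_repr -[b]presented_repr -[c]presented_repr.
by rewrite !presented_mulE catA.
Qed.

Lemma presented_mul1 : left_id presented_one presented_mul.
Proof. by move=> a; rewrite -[a]presented_repr presented_mulE. Qed.

Lemma presented_mulr1 : right_id presented_one presented_mul.
Proof. by move=> a; rewrite -[a]presented_repr presented_mulE cats0. Qed.

Lemma presented_mulV : left_inverse presented_one presented_inv presented_mul.
Proof.
move=> a; rewrite -{2}[a]presented_repr /presented_inv presented_mulE.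
exact/presented_ofP/word_eq_invl.
Qed.

Lemma presented_mulrV : right_inverse presented_one presented_inv presented_mul.
Proof.
move=> a; rewrite -{1}[a]presented_repr /presented_inv presented_mulE.
by rewrite -{1}[repr a]word_invK; apply/presented_ofP/word_eq_invl.
Qed.

HB.instance Definition _ := isGroup.Build presented presented_mulA
  presented_mul1 presented_mulr1 presented_mulV presented_mulrV.

Section Lift.
Variables (H : groupType) (f : X -> H).

Definition word_eval (u : word) : H :=
  foldr (fun l a => (if l.2 then (f l.1)^-1 else f l.1) * a)%g 1%g u.

Lemma word_eval_cat u v : word_eval (u ++ v) = (word_eval u * word_eval v)%g.
Proof. by elim: u => [|l u IHu] /=; rewrite ?mul1g // IHu mulgA. Qed.

Lemma word_eval_eq :
  (forall u v, R u v -> word_eval u = word_eval v) ->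
  forall u v, word_eq u v -> word_eval u = word_eval v.
Proof.
move=> fR u v; elim=> {u v} // [u v w _ -> _ -> //|u u' v v' _ Eu _ Ev|g b].
  by rewrite !word_eval_cat Eu Ev.
by case: b => /=; rewrite mulg1 ?mulgV ?mulVg.
Qed.

End Lift.

End PresentedGroup.

Section Spin.
Variable n : nat.

Definition distinct_pair := {ij : 'I_n * 'I_n | ij.1 != ij.2}.

(* [None] is the generator z, [Some (i, j)] is the generator tau~_{i,j}. *)
Definition spin_generator := option distinct_pair.

Definition word_z : word spin_generator := [:: (None, false)].

Definition word_tau (i j : 'I_n) (ij : i != j) : word spin_generator :=
  [:: (Some (Sub (i, j) ij : distinct_pair), false)].

Inductive spin_rel : word spin_generator -> word spin_generator -> Prop :=
| spin_rel_zz : spin_rel (word_z ++ word_z) [::]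
| spin_rel_central (i j : 'I_n) (ij : i != j) :
    spin_rel (word_z ++ word_tau ij) (word_tau ij ++ word_z)
| spin_rel_square (i j : 'I_n) (ij : i != j) :
    spin_rel (word_tau ij ++ word_tau ij) word_z
| spin_rel_swap (i j : 'I_n) (ij : i != j) (ji : j != i) :
    spin_rel (word_tau ij) (word_z ++ word_tau ji)
| spin_rel_far (i j k l : 'I_n) (ij : i != j) (kl : k != l) :
    uniq [:: i; j; k; l] ->
    spin_rel (word_tau ij ++ word_tau kl)
             (word_z ++ word_tau kl ++ word_tau ij)
| spin_rel_braid (i j k : 'I_n) (ij : i != j) (jk : j != k) :
    uniq [:: i; j; k] ->
    spin_rel (word_tau ij ++ word_tau jk ++ word_tau ij)
             (word_tau jk ++ word_tau ij ++ word_tau jk)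
| spin_rel_conj (i j k : 'I_n) (ij : i != j) (jk : j != k) (ik : i != k) :
    uniq [:: i; j; k] ->
    spin_rel (word_tau jk ++ word_tau ij ++ word_tau jk) (word_tau ik).

Definition spin := presented spin_rel.
HB.instance Definition _ := Group.on spin.

Definition spin_z : spin := presented_of spin_rel word_z.

(* The value at i = j is a junk value. *)
Definition spin_tau (i j : 'I_n) : spin :=
  if insub (i, j) is Some ij
  then presented_of spin_rel [:: (Some (ij : distinct_pair), false)] else 1%g.

Definition spin_generator_perm (g : spin_generator) : 'S_n :=
  if g is Some ij then tperm (val ij).1 (val ij).2 else 1%g.

Definition spin_proj (a : spin) : 'S_n := word_eval spin_generator_perm (repr a).

Lemma spin_rel_perm u v : spin_rel u v ->
  word_eval spin_generator_perm u = word_eval spin_generator_perm v.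
Proof.
have tJ (a b c : 'I_n) : uniq [:: a; b; c] ->
    (tperm b c * (tperm a b * tperm b c) = tperm a c)%g.
  rewrite /= !inE negb_or !andbT => /andP[/andP[ab ac] bc].
  rewrite -{1}[tperm b c]tpermV; have := tpermJ a b (tperm b c).
  by rewrite /conjg tpermL tpermD 1?eq_sym // => ->.
case=> //= {u v}.
- by rewrite !mulg1.
- by move=> *; rewrite !mulg1 ?mul1g.
- by move=> *; rewrite !mulg1 tperm2.
- by move=> *; rewrite !mulg1 mul1g tpermC.
- move=> i j k l _ _; rewrite !inE !negb_or !andbT.
  case/and3P=> /and3P[ij ik il] /andP[jk jl] kl; rewrite !mulg1 mul1g.
  rewrite (conjgC (tperm i j)); congr (_ * _)%g; rewrite tpermJ.
  by rewrite !tpermD // eq_sym.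
- move=> i j k _ _ u3; rewrite !mulg1 tJ //.
  rewrite (tpermC i j) (tpermC j k) (tpermC i k) tJ //.
  by move: u3; rewrite -rev_uniq.
- by move=> i j k _ _ _ u3; rewrite !mulg1 tJ.
Qed.

Lemma spin_proj_of u :
  spin_proj (presented_of spin_rel u) = word_eval spin_generator_perm u.
Proof.
apply: (word_eval_eq spin_rel_perm); apply/presented_ofP.
exact: presented_repr.
Qed.

Lemma spin_projM (a b : spin) : spin_proj (a * b)%g = (spin_proj a * spin_proj b)%g.
Proof. by rewrite spin_proj_of word_eval_cat. Qed.

Lemma spin_proj_z : spin_proj spin_z = 1%g.
Proof. by rewrite spin_proj_of /= mulg1. Qed.

Lemma spin_proj_tau (i j : 'I_n) : i != j -> spin_proj (spin_tau i j) = tperm i j.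
Proof.
by move=> ij; rewrite /spin_tau insubT spin_proj_of /= mulg1.
Qed.

(* mathcomp's product of permutations is read from left to right. *)
Definition spin_section (rho : 'S_n -> spin) : Prop :=
  forall s, spin_proj (rho s) = s.

End Spin.

Section Homology.
Variables (K : comNzRingType) (M : lmodType K) (d : {linear M -> M}).

Definition is_cycle : {pred M} := [pred m | d m == 0].

Lemma is_cycle_submod : submod_closed is_cycle.
Proof.
split=> [|a u v]; rewrite !inE ?linear0 //.
by move=> /eqP du /eqP dv; rewrite linearP /= du dv scaler0 addr0.
Qed.

HB.instance Definition _ := GRing.isSubmodClosed.Build K M is_cycle is_cycle_submod.

Record cycles := Cycle { cycle_val :> M; _ : cycle_val \in is_cycle }.
HB.instance Definition _ := [isSub for cycle_val].
HB.instance Definition _ := [Choice of cycles by <:].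
HB.instance Definition _ := [SubChoice_isSubLmodule of cycles by <:].

Definition is_boundary : {pred cycles} :=
  fun c => `[< exists m : M, cycle_val c = d m >].

Lemma is_boundary_zmod : zmod_closed is_boundary.
Proof.
split=> [|u v]; first by apply/asboolP; exists 0; rewrite linear0.
move=> /asboolP[a ua] /asboolP[b vb]; apply/asboolP; exists (a - b).
by rewrite linearB /= -ua -vb.
Qed.

HB.instance Definition _ :=
  GRing.isZmodClosed.Build cycles is_boundary is_boundary_zmod.

Definition homology := Quotient.quot is_boundary.
HB.instance Definition _ := GRing.Zmodule.on homology.

Definition homology_class (c : cycles) : homology := \pi_homology c.

Lemma homology_classP (u v : cycles) : homology_class u = homology_class v <->
  exists m : M, cycle_val u - cycle_val v = d m.
Proof.
split=> [/eqmodP|uv]; first by rewrite /= Quotient.equivE => /asboolP.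
by apply/eqmodP; rewrite /= Quotient.equivE; apply/asboolP.
Qed.

Definition homology_scale (a : K) (h : homology) : homology :=
  homology_class (a *: repr h).

Lemma homology_classZ a u :
  homology_class (a *: u) = homology_scale a (homology_class u).
Proof.
have [m E] : exists m : M, cycle_val u - cycle_val (repr (homology_class u)) = d m.
  by apply/homology_classP; rewrite /homology_class reprK.
by apply/homology_classP; exists (a *: m); rewrite [d _]linearZ /= -E scalerBr.
Qed.

Lemma homology_classD u v :
  homology_class (u + v) = homology_class u + homology_class v.
Proof. exact: raddfD. Qed.

Lemma homology_class_repr h : homology_class (repr h) = h.
Proof. exact: reprK. Qed.

Lemma homology_scaleA a b h :
  homology_scale a (homology_scale b h) = homology_scale (a * b) h.
Proof. by rewrite -[h]homology_class_repr -!homology_classZ scalerA. Qed.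

Lemma homology_scale1 : left_id 1 homology_scale.
Proof. by move=> h; rewrite -[h]homology_class_repr -homology_classZ scale1r. Qed.

Lemma homology_scaleDr : right_distributive homology_scale +%R.
Proof.
move=> a g h; rewrite -[g]homology_class_repr -[h]homology_class_repr.
by rewrite -homology_classD -!homology_classZ scalerDr homology_classD.
Qed.

Lemma homology_scaleDl h : {morph homology_scale^~ h : a b / a + b}.
Proof.
move=> a b; rewrite -[h]homology_class_repr -!homology_classZ scalerDl.
exact: homology_classD.
Qed.

HB.instance Definition _ := GRing.Zmodule_isLmodule.Build K homology
  homology_scaleA homology_scale1 homology_scaleDr homology_scaleDl.

(* The part of the homology represented by cycles satisfying P; with P the
   predicate "homogeneous of a given degree" this is a graded piece. *)
Definition homology_piece (P : M -> Prop) (h : homology) : Prop :=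
  exists2 c : cycles, P (cycle_val c) & homology_class c = h.

End Homology.

Definition graded_homology_iso (K : comNzRingType) (M : lmodType K)
    (D : Type) (P : D -> M -> Prop) (d1 d2 : {linear M -> M}) : Prop :=
  exists2 f : {linear homology d1 -> homology d2}, bijective f &
    forall deg h, homology_piece (P deg) h <-> homology_piece (P deg) (f h).

Section Torus.
Variables n p q : nat.

(* Lambda is generated by (pn, 0) and (qn, n). *)
Definition in_lattice (v : int * int) : bool :=
  (n %| v.2)%Z && ((p * n)%N %| v.1 - q%:Z * v.2)%Z.

Lemma in_latticeP v : reflect
  (exists k m : int,
     v = (k * (p * n)%N%:Z + m * (q * n)%N%:Z, m * n%:Z)) (in_lattice v).
Proof.
rewrite /in_lattice; case: v => v1 v2 /=; apply: (iffP andP) => /=.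
  case=> /dvdzP[m ->] /dvdzP[k E]; exists k, m; congr pair.
  by rewrite -E [(q * n)%N%:Z]PoszM mulrCA subrK.
case=> k [m [-> ->]]; split; first exact: dvdz_mull.
by rewrite [(q * n)%N%:Z]PoszM mulrCA addrK; apply: dvdz_mull.
Qed.

Definition same_point (u v : int * int) : bool := in_lattice (u - v).

End Torus.

Definition lens_parameters (p q : nat) : bool :=
  coprime p q && ((0 < q < p)%N || (p == 1)%N && (q == 0)%N).

(* The parameters of the grid are (n, p, q) with n = n'.+1 and p = p'.+1, so
   that 'I_p'.+1 carries the group structure of Z/p. The square [a, a+1] x
   [b, b+1] is encoded by (a, b), and rows, columns and circles are numbered
   from 0. *)
Definition square (n' p' : nat) := ('I_(p'.+1 * n'.+1) * 'I_n'.+1)%type.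

Definition square_row n' p' (s : square n' p') : 'I_n'.+1 := s.2.
Definition square_column n' p' (s : square n' p') : 'I_n'.+1 := inZp s.1.

Record grid (n' p' q : nat) := Grid {
  grid_X : 'I_n'.+1 -> square n' p';
  grid_O : 'I_n'.+1 -> square n' p';
  grid_X_row : bijective (fun i => square_row (grid_X i));
  grid_X_column : bijective (fun i => square_column (grid_X i));
  grid_O_row : bijective (fun i => square_row (grid_O i));
  grid_O_column : bijective (fun i => square_column (grid_O i));
  grid_X_O_disjoint : forall i k, grid_X i != grid_O k }.

Section Knot.
Variables (n' p' q : nat) (G : grid n' p' q).

(* Two markings of different kinds are joined by an arc of the link. *)
Definition linked : rel ('I_n'.+1 + 'I_n'.+1) := fun u v =>
  let arc i k := (square_row (grid_X G i) == square_row (grid_O G k))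
    || (square_column (grid_X G i) == square_column (grid_O G k)) in
  match u, v with
  | inl i, inr k => arc i k
  | inr k, inl i => arc i k
  | _, _ => false
  end.

Definition represents_knot : Prop := n_comp linked predT = 1%N.

End Knot.

(* The generator (s, a) has its point on alpha_l at (a l * n + s l, l). *)
Notation generator n' p' := ('S_n'.+1 * {ffun 'I_n'.+1 -> 'I_p'.+1})%type.

Section Rectangles.
Variables n' p' q : nat.
Local Notation n := n'.+1.
Local Notation p := p'.+1.
Local Notation generator := (generator n' p').
Local Notation "u =T v" := (same_point n p q u v) (at level 70).

Definition gen_point (x : generator) (l : 'I_n) : nat * nat :=
  (x.2 l * n + x.1 l, nat_of_ord l)%N.

Definition lattice_point (u : nat * nat) : int * int := (u.1%:Z, u.2%:Z).

(* A rectangle [a, a + w] x [b, b + h] up to translation by Lambda is encoded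
   by ((a, b), (w, h)), the representative with (a, b) in the fundamental
   domain [0, pn) x [0, n). *)
Definition rectangle := (square n' p' * ('I_(p * n) * 'I_(p * n)))%type.
HB.instance Definition _ := Finite.on rectangle.

Implicit Types (r : rectangle) (x y z : generator).

Definition rect_width r : nat := r.2.1.
Definition rect_height r : nat := r.2.2.
Definition rect_bottom r : 'I_n := r.1.2.

Definition rect_point r (i j : nat) : int * int :=
  lattice_point (r.1.1 + i, r.1.2 + j)%N.

Definition lower_left r := rect_point r 0 0.
Definition lower_right r := rect_point r (rect_width r) 0.
Definition upper_left r := rect_point r 0 (rect_height r).
Definition upper_right r := rect_point r (rect_width r) (rect_height r).

(* The lower (upper) corners lie on the same alpha circle, hence project to
   the points of x and y with the same index. *)
Definition is_rect x y r : bool :=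
  let P g l := lattice_point (gen_point g l) in
  [&& (0 < rect_width r)%N, (0 < rect_height r)%N &
   [exists i, exists j,
     [&& i != j,
         lower_left r =T P x i, upper_right r =T P x j,
         lower_right r =T P y i, upper_left r =T P y j &
         [forall l, (l != i) && (l != j) ==> (P x l == P y l)]]]].

Definition Rect x y := {r : rectangle | is_rect x y r}.
HB.instance Definition _ x y := Finite.on (Rect x y).

Definition rect_empty x r : bool :=
  [forall i : 'I_(rect_width r), forall j : 'I_(rect_height r), forall l,
     (0 < i)%N && (0 < j)%N ==>
       ~~ (rect_point r i j =T lattice_point (gen_point x l))].

(* The interior of r embeds in T: its unit squares have distinct images. *)
Definition rect_embedded r : bool :=
  [forall c : 'I_(rect_width r) * 'I_(rect_height r),
   forall d : 'I_(rect_width r) * 'I_(rect_height r),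
     (rect_point r c.1 c.2 =T rect_point r d.1 d.2) ==> (c == d)].

(* The rectangles counted by the differential are the empty ones whose interior
   embeds in T.  An immersed rectangle may overlap itself near its y-corners
   and still be empty; counting such rectangles would make the differential
   inhomogeneous for some grids with (n, p, q) = (2, 3, 2), and not square-zero
   for some with (3, 3, 2). *)
Definition rect_counted x r : bool := rect_empty x r && rect_embedded r.

Definition rect_multiplicity r (s : square n' p') : nat :=
  \sum_(i < rect_width r) \sum_(j < rect_height r)
    (rect_point r i j =T lattice_point (nat_of_ord s.1, nat_of_ord s.2)).

(* r1 * r2 as a surface tiled by unit squares: the tiles of r1 and r2, the
   projection of the tiles to T and the right and upper neighbours of a tile.
   A corner of both r1 and r2 at a point of y is one of lower_right r1 and
   upper_left r1, and one of lower_left r2 and upper_right r2; in each of the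
   four cases r1 and r2 lie on opposite sides of a vertical or horizontal
   segment issued from the common corner, along which they are glued. *)
Definition tile r1 r2 :=
  (('I_(rect_width r1) * 'I_(rect_height r1)) +
   ('I_(rect_width r2) * 'I_(rect_height r2)))%type.

Definition tile_point r1 r2 (c : tile r1 r2) : int * int :=
  match c with
  | inl (i, j) => rect_point r1 i j
  | inr (i, j) => rect_point r2 i j
  end.

Definition right_neighbour r1 r2 : rel (tile r1 r2) := fun c d =>
  match c, d with
  | inl (i, j), inl (i', j') => (i' == i.+1 :> nat) && (j' == j :> nat)
  | inr (i, j), inr (i', j') => (i' == i.+1 :> nat) && (j' == j :> nat)
  | inl (i, j), inr (i', j') =>
      [&& lower_right r1 =T lower_left r2,
          i.+1 == rect_width r1, i' == 0 :> nat & j' == j :> nat]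
  | inr (i, j), inl (i', j') =>
      [&& upper_right r2 =T upper_left r1,
          i.+1 == rect_width r2, i' == 0 :> nat
        & (rect_height r2 - j == rect_height r1 - j')%N]
  end.

Definition upper_neighbour r1 r2 : rel (tile r1 r2) := fun c d =>
  match c, d with
  | inl (i, j), inl (i', j') => (i' == i :> nat) && (j' == j.+1 :> nat)
  | inr (i, j), inr (i', j') => (i' == i :> nat) && (j' == j.+1 :> nat)
  | inl (i, j), inr (i', j') =>
      [&& upper_left r1 =T lower_left r2,
          j.+1 == rect_height r1, j' == 0 :> nat & i' == i :> nat]
  | inr (i, j), inl (i', j') =>
      [&& upper_right r2 =T lower_right r1,
          j.+1 == rect_height r2, j' == 0 :> nat
        & (rect_width r2 - i == rect_width r1 - i')%N]
  end.

Definition same_polygon r1 r2 r3 r4 : Prop :=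
  exists f : tile r1 r2 -> tile r3 r4,
    [/\ bijective f,
        forall c, tile_point (f c) =T tile_point c,
        forall c d, right_neighbour (f c) (f d) = right_neighbour c d
      & forall c d, upper_neighbour (f c) (f d) = upper_neighbour c d].

Definition horizontal_annulus r1 r2 : bool :=
  [&& lower_right r1 =T lower_left r2,
      (rect_width r1 + rect_width r2 == p * n)%N
    & rect_height r1 == rect_height r2].

Definition vertical_annulus r1 r2 : bool :=
  [&& upper_left r1 =T lower_left r2,
      (rect_height r1 + rect_height r2 == p * n)%N
    & rect_width r1 == rect_width r2].

(* Rect(G) is the disjoint union of the sets Rect(x, y). *)
Definition sign_function := forall x y, Rect x y -> int.

Record sign_assignment (S : sign_function) : Prop := SignAssignment {
  sign_assignment_pm1 : forall x y (r : Rect x y), S x y r = 1 \/ S x y r = -1;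
  sign_assignment_polygon : forall x y y' z
    (r1 : Rect x y) (r2 : Rect y z) (r3 : Rect x y') (r4 : Rect y' z),
    same_polygon (val r1) (val r2) (val r3) (val r4) ->
    (val r1, val r2) != (val r3, val r4) ->
    S x y r1 * S y z r2 = - (S x y' r3 * S y' z r4);
  sign_assignment_horizontal : forall x y z (r1 : Rect x y) (r2 : Rect y z),
    horizontal_annulus (val r1) (val r2) -> S x y r1 * S y z r2 = 1;
  sign_assignment_vertical : forall x y z (r1 : Rect x y) (r2 : Rect y z),
    vertical_annulus (val r1) (val r2) -> S x y r1 * S y z r2 = -1 }.

Definition spinZ := (spin n * {ffun 'I_n -> 'I_p})%type.

Definition spinZ_mul (u v : spinZ) : spinZ := ((u.1 * v.1)%g, u.2 + v.2).

Definition spinZ_z : spinZ := (spin_z n, 0).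

Definition rect_phi x y (r : Rect x y) : spinZ :=
  let b := rect_bottom (val r) in (spin_tau (x.1 b) (y.1 b), y.2 - x.2).

(* The last value 0 is never taken when rho is a section. *)
Definition sign_rho (rho : 'S_n -> spin n) : sign_function := fun x y (r : Rect x y) =>
  let ext g : spinZ := (rho g.1, g.2) in
  if spinZ_mul (ext x) (rect_phi r) == ext y then 1
  else if spinZ_mul (ext x) (rect_phi r) == spinZ_mul spinZ_z (ext y) then -1
  else 0.

End Rectangles.

(* The fuel p.+1 suffices since p decreases in each recursive call. *)
Fixpoint lens_d_rec (fuel p q i : nat) : rat :=
  if fuel is f.+1 then
    if q == 0%N then 0 else
      ((p * q)%:R - ((2 * i + 1)%:R - p%:R - q%:R) ^+ 2) / (4 * p * q)%:R
      + lens_d_rec f q (p %% q) (i %% q)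
  else 0.

Definition lens_d (p q i : nat) : rat := lens_d_rec p.+1 p q (i %% p).

Lemma lens_d10 i : lens_d 1 0 i = 0. Proof. by []. Qed.

Lemma lens_dE p q i : (0 < q < p)%N -> (i < p)%N -> lens_d p q i =
  ((p * q)%:R - ((2 * i + 1)%:R - p%:R - q%:R) ^+ 2) / (4 * p * q)%:R
  + lens_d q (p %% q) (i %% q).
Proof.
move=> /andP[q0 qp] ip; rewrite /lens_d [LHS]/= modn_small // gtn_eqF //.
congr (_ + _); rewrite modn_mod.
have fuelE f1 f2 a b c : (b < a)%N -> (a < f1)%N -> (a < f2)%N ->
    lens_d_rec f1 a b c = lens_d_rec f2 a b c.
  elim: f1 f2 a b c => [|f1 IH] [|f2] a b c //= ba; rewrite !ltnS => af1 af2.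
  case: (posnP b) => // b0; congr (_ + _).
  by apply: IH; rewrite ?ltn_mod // (leq_trans ba).
by apply: fuelE; rewrite ?ltn_mod.
Qed.

Definition planar_pairs (A B : seq (rat * rat)) : nat :=
  \sum_(a <- A) \sum_(b <- B) ((a.1 < b.1) && (a.2 < b.2))%R.

Section Gradings.
Variables (n' p' q : nat) (G : grid n' p' q).
Local Notation n := n'.+1.
Local Notation p := p'.+1.
Local Notation generator := (generator n' p').
Implicit Type x : generator.

(* The points are given by their integral lower left parts and a common
   offset, 0 for generators and 1/2 for the centres of marked squares; the
   reduction modulo np commutes with adding the offset. *)
Definition tilde (offset : rat) (s : seq (nat * nat)) : seq (rat * rat) :=
  [seq (((c.1 + n * q * k) %% (n * p))%:R + offset, (c.2 + n * k)%:R + offset)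
    | c <- s, k <- iota 0 p].

Definition tilde_gen x := tilde 0 [seq gen_point x l | l <- enum 'I_n].

Definition tilde_marks (m : 'I_n -> square n' p') :=
  tilde (1 / 2%:R) [seq (nat_of_ord (m i).1, nat_of_ord (m i).2) | i <- enum 'I_n].

Local Notation tX := (tilde_marks (grid_X G)).
Local Notation tO := (tilde_marks (grid_O G)).
Local Notation II A B := ((planar_pairs A B)%:R : rat).

Definition maslov x : rat :=
  (II (tilde_gen x) (tilde_gen x) - II (tilde_gen x) tO
    - II tO (tilde_gen x) + II tO tO) / p%:R
  + lens_d p q ((q + p - 1) %% p) + 1.

Definition alexander x : rat :=
  (II tO tO - II tX tX + 2%:R * II tX (tilde_gen x) - 2%:R * II tO (tilde_gen x))
    / (2 * p)%:R
  + (1 - n%:R) / 2%:R.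

(* The sum over the rows is indexed by the O-marking contained in the row; the
   lower left corner (c, l) of its square has p-coordinate c %/ n. *)
Definition spinc_grading x : 'I_p :=
  inZp q - inZp 1 +
  \sum_i (x.2 (square_row (grid_O G i)) - inZp ((grid_O G i).1 %/ n)).

End Gradings.

Section Complex.
Variables (n' p' q : nat) (G : grid n' p' q).
Local Notation n := n'.+1.
Local Notation p := p'.+1.
Local Notation generator := (generator n' p').

(* The ground ring K is a quotient ev : Z[V_1, ..., V_n] -> K. *)
Variables (K : comNzRingType) (ev : {rmorphism {mpoly int[n]} -> K}).

Local Notation chain := {ffun generator -> K^o}.

Definition grid_coef (S : sign_function n' p' q) (x y : generator) :
    {mpoly int[n]} :=
  \sum_(r : Rect q x y | rect_counted q x (val r) &&
         [forall i, rect_multiplicity q (val r) (grid_X G i) == 0%N])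
    (S x y r)%:~R * \prod_i 'X_i ^+ rect_multiplicity q (val r) (grid_O G i).

Definition grid_differential (S : sign_function n' p' q) (c : chain) : chain :=
  [ffun y => \sum_x c x * ev (grid_coef S x y)].

Lemma grid_differential_linear S : linear (grid_differential S).
Proof.
move=> a u v; apply/ffunP => y; rewrite !ffunE scaler_sumr -big_split /=.
by apply: eq_bigr => x _; rewrite !ffunE mulrDl scalerAl.
Qed.

HB.instance Definition _ S := GRing.isLinear.Build K chain chain _
  (grid_differential S) (grid_differential_linear S).

Definition homogeneous_scalar (e : nat) (a : K) : Prop :=
  exists2 P : {mpoly int[n]}, P \is e.-homog & a = ev P.

Definition homogeneous_chain (deg : rat * rat * 'I_p) (c : chain) : Prop :=
  forall x, c x <> 0 -> exists2 e : nat, homogeneous_scalar e (c x) &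
    deg = (maslov G x - (2 * e)%:R, alexander G x - e%:R, spinc_grading G x).

Definition grid_homology_iso (S1 S2 : sign_function n' p' q) : Prop :=
  graded_homology_iso homogeneous_chain
    (grid_differential S1) (grid_differential S2).

End Complex.

Section HatRing.
Variable n' : nat.

Definition ideal_V1 : {pred {mpoly int[n'.+1]}} :=
  fun P => `[< exists Q : {mpoly int[n'.+1]}, P = Q * 'X_ord0 >].

Lemma ideal_V1_closed : idealr_closed ideal_V1.
Proof.
split=> [||a u v].
- by apply/asboolP; exists 0; rewrite mul0r.
- apply/asboolP => -[Q /(congr1 (meval (fun=> 0)))].
  by rewrite mevalM mevalXU mulr0 rmorph1 => /eqP; rewrite oner_eq0.
- move=> /asboolP[P ->] /asboolP[Q ->]; apply/asboolP; exists (a * P + Q).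
  by rewrite mulrDl mulrA.
Qed.

HB.instance Definition _ :=
  isIdealr.Build {mpoly int[n'.+1]} ideal_V1 ideal_V1_closed.

Definition hat_ring : comNzRingType := {ideal_quot ideal_V1}.

Definition hat_ev : {rmorphism {mpoly int[n'.+1]} -> hat_ring} :=
  \pi_({ideal_quot ideal_V1}).

End HatRing.

Definition GCminus_homology_iso n' p' q (G : grid n' p' q)
    (S1 S2 : sign_function n' p' q) : Prop :=
  grid_homology_iso G (idfun : {rmorphism {mpoly int[n'.+1]} -> {mpoly int[n'.+1]}})
    S1 S2.

Definition GChat_homology_iso n' p' q (G : grid n' p' q)
    (S1 S2 : sign_function n' p' q) : Prop :=
  grid_homology_iso G (hat_ev n') S1 S2.

(* Main.v *)
From HB Require Import structures.
Require Import Defs.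
From mathcomp Require Import all_boot all_fingroup all_order all_algebra.
From mathcomp Require Import boolp generic_quotient mpoly zify ring.

Set Implicit Arguments.
Unset Strict Implicit.
Unset Printing Implicit Defensive.

                                                                              
                                                                             
                                                                                
                                                                             
                                                         

                                                                                
                                                                           
                                                                              
                                                                                
                                                                             
                                                                          
                                                                           
                                                                                 
                                                                                
                                                                                 
                                                                         
                                              

                                              

(** Existence. Comparing [rho x] times a lifted transposition with [rho y] defines a sign once the
    kernel of the Spin projection is exactly {1, z}. It is no larger, because killing z leaves the
    transposition presentation of the symmetric group, in which a word with trivial permutation is
    trivial ([eval_in_trivial], [spin_kernel]); and z is not 1, because it acts as -1 on the spinors
    of a Clifford algebra ([spin_z_neq1]). The sign of a pair of rectangles is then read off from
    the product of two lifted transpositions. The annulus axioms become tau_ij tau_ji = 1 and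
    tau_ij^2 = z. The polygon axiom becomes the claim that two different decompositions of one
    polygon have lifted products differing by z ([decomposition_sign]). The product permutation and
    the boundary of the polygon leave few possibilities: two disjoint transpositions in either
    order, the factorisations of a 3-cycle, or two rectangles on the same two rows, where the
    lengths of rows and columns of tiles decide.

    Independence. The ratio of two sign assignments depends only on the ends x, y of a rectangle
    ([ratio_const]) and satisfies a cocycle condition on polygons ([edge_ratio_polygon]). If it has
    the form f x (+) f y on the rectangles that the differential counts, then rescaling each
    generator x by (-1)^(f x) carries one differential to the other and keeps the gradings
    ([gauge_homology_iso]). So a potential f has to be found.

    For n >= 3, rectangles act on generators as the reflections of the group G(p,p,n), the
    semidirect product of a translation group (Z/p)^(n-1) with S_n. The ratio defines a double cover
    of the set of generators to which the reflections lift. Disjoint pairs of rectangles and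
    L-shaped polygons show that the lifts satisfy the commutation and conjugation relations
    ([edge_far], [edge_triangle]). With at least three rows these relations bring every word to a
    normal form ([reflection_normal_form]), so a word that fixes a generator acts trivially on the
    cover ([word_fix]); the cover is trivial, and choosing a sheet gives f.

    For n = 2 there is no third row to work with. Generators then lie on cycles under sliding one
    point to the right and the other to the left. A spiral polygon reduces an embedded rectangle to
    slides of width one ([edge_embedded]), and an embedded rectangle of height 1 shows that the
    ratio sums to zero around each cycle ([edge_cycle]), so a potential exists again. For n = 1
    there are no rectangles. *)

(** * A Clifford model in which z is not trivial *)

Section CliffordModel.
Import GRing.Theory.
Local Open Scope ring_scope.
Variable n : nat.

Definition flip (i : 'I_n) (A : {set 'I_n}) : {set 'I_n} :=
  [set k | (k \in A) (+) (k == i)].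

(** Koszul sign of Clifford multiplication in the basis of subsets. Counting [i] itself as well
    makes the square of [clifford i] equal to -1 rather than 1. *)
Definition koszul (i : 'I_n) (A : {set 'I_n}) : bool :=
  \big[addb/false]_(k < n | (k <= i)%N) (k \in A).

Lemma koszul_flip i j A : koszul i (flip j A) = koszul i A (+) (j <= i)%N.
Proof.
rewrite /koszul; under eq_bigr do rewrite inE.
rewrite big_split /=; congr (_ (+) _).
rewrite big_mkcond (bigD1 j) //= eqxx big1 ?addbF; first by case: ifP.
by move=> k /negPf ->; rewrite if_same.
Qed.

Lemma flipC i j A : flip i (flip j A) = flip j (flip i A).
Proof. by apply/setP=> k; rewrite !inE addbAC. Qed.

Lemma flipK i : involutive (flip i).
Proof. by move=> A; apply/setP=> k; rewrite !inE -addbA addbb addbF. Qed.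

(** The field with seven elements contains a square root of 1/2, namely 2, and its finiteness lets
    invertible operators live in a permutation group. *)
Definition spinor := {ffun {set 'I_n} -> 'F_7}.

Definition clifford (i : 'I_n) (v : spinor) : spinor :=
  [ffun A => (-1) ^+ koszul i A * v (flip i A)].

Lemma cliffordB i u v : clifford i (u - v) = clifford i u - clifford i v.
Proof. by apply/ffunP=> A; rewrite !ffunE mulrBr. Qed.

Lemma clifford_sq i v : clifford i (clifford i v) = - v.
Proof.
apply/ffunP=> A; rewrite !ffunE flipK koszul_flip leqnn addbT mulrA -signr_addb.
by rewrite addbN addbb mulN1r.
Qed.

Lemma clifford_anti i j v : i != j ->
  clifford i (clifford j v) = - clifford j (clifford i v).
Proof.
move=> ij; apply/ffunP=> A; rewrite !ffunE flipC !mulrA -!signr_addb.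
rewrite !koszul_flip -mulNr -signrN; congr ((-1) ^+ nat_of_bool _ * _).
have: (i <= j)%N = ~~ (j <= i)%N.
  by rewrite -ltnNge ltn_neqAle -(inj_eq val_inj) /= in ij *; rewrite ij.
by move=> ->; case: (koszul i A); case: (koszul j A); case: (j <= i)%N.
Qed.

                                                                                   
(** Clifford multiplication by the unit root (e_i - e_j) / sqrt 2, since 2 squares to 1/2 modulo
    7. *)
Definition root_op (i j : 'I_n) (v : spinor) : spinor :=
  (clifford i v - clifford j v) *+ 2.

Lemma spinor7 (v : spinor) : v *+ 7 = 0.
Proof.
by apply/ffunP=> A; rewrite ffunMnE ffunE -mulr_natr (_ : 7%:R = 0) ?mulr0 //; apply/eqP.
Qed.

Lemma clifford_mul2 i v : clifford i (v *+ 2) = clifford i v *+ 2.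
Proof. by apply/ffunP=> A; rewrite !(ffunE, ffunMnE); ring. Qed.

Lemma root_opN i j v : root_op i j (- v) = - root_op i j v.
Proof.
by apply/ffunP=> A; rewrite !(ffunE, ffunMnE); ring.
Qed.

Lemma root_opB i j u v : root_op i j (u - v) = root_op i j u - root_op i j v.
Proof. by apply/ffunP=> A; rewrite !(ffunE, ffunMnE); ring. Qed.

Lemma spinor8 (v : spinor) : v *+ 8 = v.
Proof. by rewrite mulrSr spinor7 add0r. Qed.

Lemma root_op_mul i j k l v : root_op i j (root_op k l v) =
  (clifford i (clifford k v) - clifford i (clifford l v)
    - clifford j (clifford k v) + clifford j (clifford l v)) *+ 4.
Proof.
rewrite /root_op !clifford_mul2 !cliffordB; apply/ffunP=> A; rewrite !(ffunE, ffunMnE); ring.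
Qed.

Lemma root_op_sq i j v : i != j -> root_op i j (root_op i j v) = - v.
Proof.
move=> ij; rewrite root_op_mul !clifford_sq (clifford_anti _ ij) opprK.
by rewrite -[RHS]spinor8; apply/ffunP=> A; rewrite !(ffunE, ffunMnE); ring.
Qed.

Lemma root_op_anti i j k l v : uniq [:: i; j; k; l] ->
  root_op i j (root_op k l v) = - root_op k l (root_op i j v).
Proof.
rewrite /= !inE !negb_or !andbT => /and3P[/and3P[ij ik il] /andP[jk jl] kl].
rewrite !root_op_mul (clifford_anti _ ik) (clifford_anti _ il) (clifford_anti _ jk).
by rewrite (clifford_anti _ jl); apply/ffunP=> A; rewrite !(ffunE, ffunMnE); ring.
Qed.

(** The two roots meet at 120 degrees, so their unit Clifford multiplications have anticommutator 1
    (namely 8 modulo 7). *)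
Lemma root_op_adj i j k v : uniq [:: i; j; k] ->
  root_op j k (root_op i j v) = v - root_op i j (root_op j k v).
Proof.
rewrite /= !inE !negb_or !andbT => /andP[/andP[ij ik] jk].
rewrite !root_op_mul !clifford_sq (clifford_anti _ ij) (clifford_anti _ jk).
rewrite (clifford_anti _ ik) -[X in _ = X - _]spinor8.
by apply/ffunP=> A; rewrite !(ffunE, ffunMnE); ring.
Qed.

Lemma root_opD i j k v : root_op i j v + root_op j k v = root_op i k v.
Proof. by apply/ffunP=> A; rewrite !(ffunE, ffunMnE); ring. Qed.

Lemma root_op_inj i j : i != j -> injective (root_op i j).
Proof.
move=> ij; apply: (can_inj (g := fun v => - root_op i j v)) => v.
by rewrite root_op_sq // opprK.
Qed.

Lemma root_op_braid i j k v : uniq [:: i; j; k] ->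
  root_op i j (root_op j k (root_op i j v)) = root_op i k v.
Proof.
move=> u3; have ij : i != j by move: u3; rewrite /= !inE negb_or; case: eqP.
by rewrite root_op_adj // root_opB root_op_sq // opprK root_opD.
Qed.

Lemma root_op_conj i j k v : uniq [:: i; j; k] ->
  root_op j k (root_op i j (root_op j k v)) = root_op i k v.
Proof.
move=> u3; have jk : j != k by move: u3; rewrite /= !inE => /andP[_ /andP[]].
by rewrite root_op_adj // root_op_sq // root_opN opprK addrC root_opD.
Qed.

Definition spin_model (g : spin_generator n) : {perm spinor} :=
  if g is Some ij then perm (root_op_inj (svalP ij))
  else perm (@oppr_inj spinor : injective (fun v : spinor => - v)).

Lemma spin_modelP u v : spin_rel u v ->
  word_eval spin_model u = word_eval spin_model v.
Proof.
case=> //= {u v} => [|i j ij|i j ij|i j ij ji|i j k l ij kl u4|i j k ij jk u3|i j k ij jk ik u3];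
  apply/permP=> v; rewrite !permM ?perm1 !permE /= ?permE ?perm1 /= ?permE /=.
- by rewrite opprK.
- by rewrite root_opN.
- by rewrite root_op_sq.
- by apply/ffunP=> A; rewrite !(ffunE, ffunMnE); ring.
- by rewrite (root_op_anti _ u4) !root_opN opprK.
- by rewrite root_op_braid // root_op_conj.
- by rewrite root_op_conj.
Qed.

(** In the spinor model z acts as -1, which moves the constant spinor 1 modulo 7. *)
Lemma spin_z_neq1 : spin_z n != 1%g.
Proof.
apply/eqP=> /presented_ofP /(word_eval_eq spin_modelP) /=.
move/permP=> /(_ [ffun=> 1]); rewrite mulg1 permE perm1.
by move/ffunP=> /(_ set0); rewrite !ffunE => /eqP.
Qed.

End CliffordModel.

                                                   

(** * The transposition presentation of the symmetric group *)

Section SymmetricPresentation.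
Local Open Scope group_scope.
Variables (n : nat) (H : groupType) (T : 'I_n -> 'I_n -> H).
Hypothesis T_sq : forall i j, i != j -> T i j * T i j = 1.
Hypothesis T_sym : forall i j, i != j -> T i j = T j i.
Hypothesis T_far : forall i j k l, uniq [:: i; j; k; l] ->
  T i j * T k l = T k l * T i j.
Hypothesis T_conj : forall i j k, uniq [:: i; j; k] ->
  T i j * (T j k * T i j) = T i k.

Definition transposition_word := seq ('I_n * 'I_n).
Implicit Type w : transposition_word.

Definition below m w :=
  all (fun l : 'I_n * 'I_n => [&& l.1 != l.2, l.1 < m & l.2 < m]) w.

Definition eval_in w : H := foldr (fun l a => T l.1 l.2 * a) 1 w.
Definition eval_perm w : 'S_n := foldr (fun l a => tperm l.1 l.2 * a) 1 w.

Lemma eval_in_rcons w l : eval_in (rcons w l) = eval_in w * T l.1 l.2.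
Proof. by elim: w => [|k w IH] /=; rewrite ?mulg1 ?mul1g // IH mulgA. Qed.

Lemma eval_perm_rcons w l : eval_perm (rcons w l) = eval_perm w * tperm l.1 l.2.
Proof. by elim: w => [|k w IH] /=; rewrite ?mulg1 ?mul1g // IH mulgA. Qed.

Lemma below_fix m (k : 'I_n) w : below m w -> m <= k -> eval_perm w k = k.
Proof.
move=> wm mk; elim: w wm => [|[i j] w IH] /=; first by rewrite perm1.
case/andP=> /and3P[_ im jm] /IH {}IH; rewrite permM tpermD //.
  by rewrite neq_ltn (leq_trans im mk).
by rewrite neq_ltn (leq_trans jm mk).
Qed.

(** Moves a letter (i, k) to the right past (i, j), at the price of renaming it (j, k). *)
Lemma T_swap i j k : uniq [:: i; j; k] -> T i k * T i j = T i j * T j k.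
Proof.
move=> u3; have ij : i != j by move: u3; rewrite /= !inE negb_or; case: eqP.
rewrite -(T_conj u3) !mulgA -[RHS]mulg1 -!mulgA; congr (_ * (_ * _)).
exact: T_sq.
Qed.

(** Coset decomposition of the symmetric group on m + 1 points over that on m points: letters
    containing the top index [k] are pushed to the right and merged until at most one is left. The
    rewriting is carried out in [H] and in the permutations at once. *)
Lemma peel_top m (k : 'I_n) w : k = m :> nat -> below m.+1 w ->
  exists w', below m w' /\
    ((eval_in w = eval_in w' /\ eval_perm w = eval_perm w') \/
     exists2 j : 'I_n, j < m &
       eval_in w = eval_in w' * T j k /\ eval_perm w = eval_perm w' * tperm j k).
Proof.
move=> km; elim/last_ind: w => [|w [a b] IH]; first by exists [::]; split=> //; left.
rewrite /below all_rcons /= => /andP[/and3P[ab]].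
rewrite !ltnS => am bm /IH[w' [w'm Hw']].
rewrite eval_in_rcons eval_perm_rcons /=.
have lt_m (c : 'I_n) : c <= m -> c != k -> c < m by rewrite ltn_neqAle -km => -> ck; rewrite andbT.
have below1 (c d : 'I_n) : c < m -> d < m -> c != d -> below m (rcons w' (c, d)).
  by move=> cm dm cd; rewrite /below all_rcons /= cd cm dm.
                                                                            
(* The letter (a, b) is symmetric and its entries differ, so [a] may be taken different from the top
   index. *)
wlog ak : a b ab am bm / a != k => [hw|].
  have [ak|ak] := eqVneq a k; last exact: hw.
  have ba : b != a by rewrite eq_sym.
  have bk : b != k by rewrite -ak.
  have [w1 [w1m Hw1]] := hw b a ba bm am bk.
  by exists w1; split=> //; rewrite T_sym // tpermC.
have {}am := lt_m _ am ak.
have [bk|bk] := eqVneq b k; last first.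
  have {}bm := lt_m _ bm bk.
  case: Hw' => [[-> ->]|[j jm [-> ->]]].
    by exists (rcons w' (a, b)); split; [exact: below1|left; rewrite eval_in_rcons eval_perm_rcons].
  have jk : j != k by rewrite -(inj_eq val_inj) /= km neq_ltn jm.
  have [ja|ja] := eqVneq j a.
    subst j; exists (rcons w' (a, b)); split; first exact: below1.
    right; exists b => //; rewrite eval_in_rcons eval_perm_rcons /= -!mulgA.
    split; congr (_ * _); first by rewrite T_swap // /= !inE negb_or ab ak bk.
    by rewrite conjgC tpermJ tpermL (tpermD ak bk).
  have [jb|jb] := eqVneq j b.
    subst j; exists (rcons w' (a, b)); split; first exact: below1.
    right; exists a => //; rewrite eval_in_rcons eval_perm_rcons /= -!mulgA.
    split; congr (_ * _); first by rewrite (T_sym ab) T_swap // /= !inE negb_or eq_sym ab ak bk.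
    by rewrite conjgC tpermJ tpermR (tpermD ak bk).
  exists (rcons w' (a, b)); split; first exact: below1.
  right; exists j => //; rewrite eval_in_rcons eval_perm_rcons /= -!mulgA.
  split; congr (_ * _); first by apply: T_far; rewrite /= !inE !negb_or jk ja jb ab eq_sym ak eq_sym bk.
  by rewrite conjgC tpermJ !tpermD // eq_sym.
(* The new letter is (a, k). It cancels a pending (a, k), and a pending (j, k) followed by (a, k)
   becomes (a, j) followed by (j, k). *)
subst b => {bm}; case: Hw' => [[-> ->]|[j jm [-> ->]]].
  by exists w'; split=> //; right; exists a.
have [ja|ja] := eqVneq j a.
  by subst j; exists w'; split=> //; left; rewrite -!mulgA T_sq // tperm2 !mulg1.
have jk : j != k by rewrite -(inj_eq val_inj) /= km neq_ltn jm.
exists (rcons w' (a, j)); split; first by apply: below1; rewrite // eq_sym.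
right; exists j => //; rewrite eval_in_rcons eval_perm_rcons /= -!mulgA.
split; congr (_ * _).
  rewrite -(T_swap (i := a) (j := j)) ?(T_sym ak) ?(T_sym jk).
    by rewrite T_swap //= !inE negb_or !(eq_sym k) ak jk eq_sym ja.
  by rewrite /= !inE negb_or eq_sym ja ak jk.
by rewrite [RHS]conjgC tpermJ tpermL tpermD // eq_sym.
Qed.

(** Induction on [m]: a letter (j, k) surviving the peeling would move the top point [k], which the
    rest of the word fixes. *)
Lemma eval_below m w : below m w -> eval_perm w = 1 -> eval_in w = 1.
Proof.
elim: m w => [|m IH] w; first by case: w => [|[i j] w] //; rewrite /below /= ?ltn0 andbF.
case: (ltnP m n) => [mn|nm]; last first.
  move=> wm; apply: IH; apply: sub_all wm => -[i j] /= /and3P[-> _ _].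
  by rewrite !(leq_trans (ltn_ord _)).
move=> /(peel_top (k := Ordinal mn) erefl)[w' [w'm [[-> ->]|[j jm [_ ->]]]]].
  exact: IH.
move/permP/(_ (Ordinal mn)); rewrite permM perm1 (below_fix w'm) // tpermR.
by move=> jE; rewrite jE ltnn in jm.
Qed.

Lemma eval_in_trivial w : all (fun l : 'I_n * 'I_n => l.1 != l.2) w ->
  eval_perm w = 1 -> eval_in w = 1.
Proof.
move=> wn; apply: (@eval_below n).
by apply: sub_all wn => -[i j] /= ->; rewrite !ltn_ord.
Qed.

End SymmetricPresentation.

(** * The kernel of the Spin projection is {1, z} *)

Section SpinKernel.
Local Open Scope group_scope.
Variable n : nat.
Local Notation spin := (spin n).
Local Notation gen := (spin_generator n).

Lemma presented_of_cat (X : choiceType) (R : word X -> word X -> Prop) u v :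
  presented_of R (u ++ v) = presented_of R u * presented_of R v.
Proof. by rewrite -presented_mulE. Qed.

Lemma presented_letterV (X : choiceType) (R : word X -> word X -> Prop) (g : X) :
  presented_of R [:: (g, true)] = (presented_of R [:: (g, false)])^-1.
Proof.
apply: (mulIg (presented_of R [:: (g, false)])); rewrite mulVg -presented_of_cat.
by apply/presented_ofP; apply: (word_eq_cancel _ g true).
Qed.

Lemma presented_rel (X : choiceType) (R : word X -> word X -> Prop) u v :
  R u v -> presented_of R u = presented_of R v.
Proof. by move=> uv; apply/presented_ofP; apply: word_eq_rel. Qed.

Local Notation z := (spin_z n).
Local Notation cls := (presented_of (@spin_rel n)).

Lemma spin_z_sq : z * z = 1.
Proof. by rewrite -presented_of_cat; apply: presented_rel; apply: spin_rel_zz. Qed.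

Lemma spin_z_central (a : spin) : z * a = a * z.
Proof.
rewrite -[a]presented_repr; elim: (repr a) => [|l u IH]; first by rewrite mulg1 mul1g.
rewrite -cat1s presented_of_cat !mulgA -[RHS]mulgA -IH mulgA; congr (_ * _).
have com g : z * cls [:: (g, false)] = cls [:: (g, false)] * z.
  case: g => [[[i j] ij]|//]; have := presented_rel (spin_rel_central ij).
  by rewrite !presented_of_cat.
case: l => g [|]; last exact: com.
by rewrite presented_letterV; apply: (mulgI (cls [:: (g, false)])); rewrite !mulgA -com mulgK mulgV mul1g.
Qed.

(** The Spin presentation with z killed. *)
Definition spin0_rel (u v : word gen) : Prop :=
  spin_rel u v \/ u = word_z n /\ v = [::].

(** Since z is central and squares to 1, killing it identifies words only up to a factor z. *)
Lemma spin0_eq u v : word_eq spin0_rel u v -> cls u = cls v \/ cls u = z * cls v.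
Proof.
elim=> {u v} [u|u v _ []->|u v w _ [] -> _ [] ->|u u' v v' _ [] Eu _ [] Ev|g b|u v [uv|[-> ->]]].
- by left.
- by left.
- by right; rewrite mulgA spin_z_sq mul1g.
- by left.
- by right.
- by right.
- by left; rewrite mulgA spin_z_sq mul1g.
- by left; rewrite !presented_of_cat Eu Ev.
- by right; rewrite !presented_of_cat Eu Ev !mulgA spin_z_central.
- by right; rewrite !presented_of_cat Eu Ev mulgA.
- left; rewrite !presented_of_cat Eu Ev spin_z_central mulgA.
  by rewrite -(mulgA (cls u')) spin_z_sq mulg1.
- by left; apply/presented_ofP; apply: word_eq_cancel.
- by left; apply: presented_rel.
- by right; rewrite mulg1.
Qed.

Local Notation cls0 := (presented_of spin0_rel).

Definition spin0_tau (i j : 'I_n) : presented spin0_rel :=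
  if insub (i, j) is Some ij
  then cls0 [:: (Some (ij : distinct_pair n), false)] else 1.

Lemma spin0_tauE i j (ij : i != j) : spin0_tau i j = cls0 (word_tau ij).
Proof. by rewrite /spin0_tau insubT. Qed.

Lemma spin0_z : cls0 (word_z n) = 1.
Proof. by apply: presented_rel; right. Qed.

Lemma spin0_relE u v : spin_rel u v -> cls0 u = cls0 v.
Proof. by move=> uv; apply: presented_rel; left. Qed.

Lemma spin0_sq i j : i != j -> spin0_tau i j * spin0_tau i j = 1.
Proof.
move=> ij; rewrite (spin0_tauE ij) -presented_of_cat.
by rewrite (spin0_relE (spin_rel_square ij)) spin0_z.
Qed.

Lemma spin0_sym i j : i != j -> spin0_tau i j = spin0_tau j i.
Proof.
move=> ij; have ji : j != i by rewrite eq_sym.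
rewrite (spin0_tauE ij) (spin0_tauE ji) (spin0_relE (spin_rel_swap ij ji)).
by rewrite presented_of_cat spin0_z mul1g.
Qed.

Lemma spin0_far i j k l : uniq [:: i; j; k; l] ->
  spin0_tau i j * spin0_tau k l = spin0_tau k l * spin0_tau i j.
Proof.
move=> u4; have [ij kl] : i != j /\ k != l.
  by move: u4; rewrite /= !inE !negb_or => /and4P[/and3P[-> _ _] _ -> _].
rewrite (spin0_tauE ij) (spin0_tauE kl) -presented_of_cat.
by rewrite (spin0_relE (spin_rel_far ij kl u4)) presented_of_cat spin0_z mul1g presented_of_cat.
Qed.

Lemma uniq3P (T : eqType) (i j k : T) :
  reflect [/\ i != j, i != k & j != k] (uniq [:: i; j; k]).
Proof.
rewrite /= !inE negb_or andbT -andbA; exact: and3P.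
Qed.

Lemma spin0_conj i j k : uniq [:: i; j; k] ->
  spin0_tau i j * (spin0_tau j k * spin0_tau i j) = spin0_tau i k.
Proof.
move=> u3; have /uniq3P[ij ik jk] := u3.
rewrite (spin0_tauE ij) (spin0_tauE jk) (spin0_tauE ik) -!presented_of_cat.
by rewrite (spin0_relE (spin_rel_braid ij jk u3)) (spin0_relE (spin_rel_conj ij jk ik u3)).
Qed.

(** Letters z are dropped and inverses forgotten: once z is killed, each lifted transposition is its
    own inverse. *)
Definition transpositions (u : word gen) : transposition_word n :=
  pmap (fun l : gen * bool => omap val l.1) u.

Lemma cls0_eval u : cls0 u = eval_in spin0_tau (transpositions u).
Proof.
elim: u => [//|[[ij|] b] u IH]; rewrite -cat1s presented_of_cat IH /=.
  have E : cls0 [:: (Some ij, false)] = spin0_tau (val ij).1 (val ij).2.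
    by case: ij => -[i j] ij; rewrite (spin0_tauE ij).
  congr (_ * _); case: b; rewrite ?presented_letterV E //.
  by apply: (mulgI (spin0_tau (val ij).1 (val ij).2)); rewrite mulgV spin0_sq // (svalP ij).
by case: b; rewrite ?presented_letterV spin0_z ?invg1 mul1g.
Qed.

Lemma transpositions_perm u :
  eval_perm (transpositions u) = word_eval (@spin_generator_perm n) u.
Proof.
by elim: u => [//|[[ij|] b] u IH] /=; rewrite IH ?tpermV ?invg1 ?if_same ?mul1g.
Qed.

Lemma transpositions_distinct u :
  all (fun l : 'I_n * 'I_n => l.1 != l.2) (transpositions u).
Proof. by elim: u => [//|[[ij|] b] u IH] //=; rewrite IH (svalP ij). Qed.

(** A word with trivial permutation becomes trivial when z is killed, by the presentation of the
    symmetric group, hence is 1 or z itself. *)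
Lemma spin_kernel (a : spin) : spin_proj a = 1 -> a = 1 \/ a = z.
Proof.
rewrite -[a]presented_repr spin_proj_of -transpositions_perm => /eval_in_trivial E.
have [|E1|E1] := @spin0_eq (repr a) [::]; last 2 first.
- by left.
- by right; rewrite E1 mulg1.
apply/presented_ofP; rewrite cls0_eval E //; last exact: transpositions_distinct.
- exact: spin0_sq.
- exact: spin0_sym.
- exact: spin0_far.
- exact: spin0_conj.
Qed.

Lemma spin_section_exists : exists rho : 'S_n -> spin, spin_section rho.
Proof.
suff : forall s : 'S_n, exists a : spin, spin_proj a = s.
  by move/choice => [rho rhoP]; exists rho.
move=> s; have [ts -> tsP] := prod_tpermP s.
elim: ts tsP => [_|[i j] ts IH /= /andP[ij /IH[a aE]]].
  by exists 1; rewrite big_nil spin_proj_of.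
by exists (spin_tau i j * a); rewrite spin_projM spin_proj_tau // aE big_cons.
Qed.

End SpinKernel.

(** * Identities between lifted transpositions *)

Section SpinIdentities.
Local Open Scope group_scope.
Variable n : nat.
Local Notation z := (spin_z n).
Local Notation tau := (@spin_tau n).

Lemma spin_tauE (i j : 'I_n) (ij : i != j) :
  tau i j = presented_of (@spin_rel n) (word_tau ij).
Proof. by rewrite /spin_tau insubT. Qed.

Lemma spin_tau_sq (i j : 'I_n) : i != j -> tau i j * tau i j = z.
Proof.
move=> ij; rewrite (spin_tauE ij) -presented_of_cat.
exact: presented_rel (spin_rel_square ij).
Qed.

Lemma spin_tau_sym (i j : 'I_n) : i != j -> tau i j = z * tau j i.
Proof.
move=> ij; have ji : j != i by rewrite eq_sym.
rewrite (spin_tauE ij) (spin_tauE ji) -presented_of_cat.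
exact: presented_rel (spin_rel_swap ij ji).
Qed.

Lemma spin_tau_inv (i j : 'I_n) : i != j -> tau i j * tau j i = 1.
Proof.
move=> ij; rewrite (spin_tau_sym ij) -mulgA spin_tau_sq ?spin_z_sq // eq_sym //.
Qed.

Lemma spin_tau_far (i j k l : 'I_n) : uniq [:: i; j; k; l] ->
  tau i j * tau k l = z * (tau k l * tau i j).
Proof.
move=> u4; have [ij kl] : i != j /\ k != l.
  by move: u4; rewrite /= !inE !negb_or => /and4P[/and3P[-> _ _] _ -> _].
rewrite (spin_tauE ij) (spin_tauE kl) -[LHS]presented_of_cat.
by rewrite (presented_rel (spin_rel_far ij kl u4)) !presented_of_cat.
Qed.

Lemma spin_tau_conj (i j k : 'I_n) : uniq [:: i; j; k] ->
  tau j k * tau i j * tau j k = tau i k.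
Proof.
move=> u3; have /uniq3P[ij ik jk] := u3.
rewrite (spin_tauE ij) (spin_tauE jk) (spin_tauE ik) -mulgA.
by rewrite -(presented_rel (spin_rel_conj ij jk ik u3)) !presented_of_cat.
Qed.

Lemma spin_tau_braid (i j k : 'I_n) : uniq [:: i; j; k] ->
  tau i j * tau j k * tau i j = tau i k.
Proof.
move=> u3; rewrite -(spin_tau_conj u3); have /uniq3P[ij ik jk] := u3.
have := presented_rel (spin_rel_braid ij jk u3); rewrite !presented_of_cat.
by rewrite (spin_tauE ij) (spin_tauE jk) -!mulgA.
Qed.

(** With [spin_tau_cycle2], this compares the lifts of the three factorisations of a 3-cycle; the
    factor z is the sign change between two cuts of an L-shaped polygon. *)
Lemma spin_tau_cycle (i j k : 'I_n) : uniq [:: i; j; k] ->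
  tau i j * tau i k = z * (tau j k * tau i j).
Proof.
move=> u3; have /uniq3P[ij _ _] := u3.
by rewrite -(spin_tau_braid u3) !mulgA spin_tau_sq.
Qed.

Lemma spin_tau_cycle2 (i j k : 'I_n) : uniq [:: i; j; k] ->
  tau i j * tau i k = z * (tau i k * tau k j).
Proof.
move=> u3; have /uniq3P[ij _ jk] := u3.
rewrite spin_tau_cycle // (spin_tau_sym (i := k)) 1?eq_sym //.
rewrite -(spin_tau_conj u3) (spin_z_central (tau j k)); congr (_ * _).
by rewrite mulgA -(mulgA _ (tau j k) (tau j k)) spin_tau_sq // -mulgA spin_z_sq mulg1.
Qed.
End SpinIdentities.

                                          

(** * Congruence modulo the lattice Lambda *)

Section Lattice.
Import GRing.Theory Num.Theory Order.TTheory.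
Local Open Scope ring_scope.
Variables n p q : nat.
Local Notation "u =T v" := (same_point n p q u v) (at level 70).

Lemma in_latticeB u v : in_lattice n p q u -> in_lattice n p q v ->
  in_lattice n p q (u - v).
Proof.
move=> /andP[u1 u2] /andP[v1 v2]; apply/andP; split; first exact: rpredB.
rewrite (_ : _ - _ = (u.1 - q%:Z * u.2) - (v.1 - q%:Z * v.2)) /=; last by ring.
exact: rpredB.
Qed.

Lemma same_refl u : u =T u.
Proof. by rewrite /same_point subrr /in_lattice /= !mulr0 subr0 !dvdz0. Qed.

Lemma same_sym u v : u =T v -> v =T u.
Proof.
move=> uv; rewrite /same_point -opprB -[- _]add0r.
by apply: in_latticeB uv; have := same_refl 0; rewrite /same_point subr0.
Qed.

Lemma same_trans u v w : u =T v -> v =T w -> u =T w.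
Proof.
move=> uv /same_sym wv; rewrite /same_point.
have -> : u - w = (u - v) - (w - v) by rewrite opprB addrA subrK.
exact: in_latticeB.
Qed.

Lemma same_shift w u v : (u + w =T v + w) = (u =T v).
Proof. by rewrite /same_point opprD addrACA subrr addr0. Qed.

Lemma same_eq u v : u = v -> u =T v.
Proof. by move->; apply: same_refl. Qed.

Lemma same_diff u v u' v' : u - v = u' - v' -> (u =T v) = (u' =T v').
Proof. by rewrite /same_point => ->. Qed.

Lemma same_row u v : u =T v -> (n %| u.2 - v.2)%Z.
Proof. by case/andP. Qed.

Lemma same_column u v : u =T v -> (n %| u.1 - v.1)%Z.
Proof.
case/andP=> /= n2 np1; rewrite -[u.1 - v.1](subrK (q%:Z * (u.2 - v.2))).
by rewrite rpredD ?dvdz_mull //; apply: dvdz_trans np1; rewrite PoszM dvdz_mull.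
Qed.
End Lattice.

Section LatticeCombinations.
Import GRing.Theory.
Local Open Scope ring_scope.
Variables n p q : nat.
Local Notation "u =T v" := (same_point n p q u v) (at level 70).

(** This family adds up known congruences, so that every computation with corners is left to [ring]
    or [lia]. *)
Lemma same_of1 u v w w' : u =T v -> w - w' = u - v -> w =T w'.
Proof. by move=> uv /same_diff ->. Qed.

Lemma same_of2 u v u' v' w w' : u =T v -> u' =T v' ->
  w - w' = (u - v) + (u' - v') -> w =T w'.
Proof.
move=> uv uv' E; rewrite (@same_diff _ _ _ _ _ (u - v + (u' - v')) 0) ?subr0 //.
apply: (same_trans (v := u - v)).
  by rewrite addrC -{2}[u - v]add0r same_shift /same_point subr0.
by rewrite /same_point subr0.
Qed.

Lemma same_of3 u v u' v' u2 v2 w w' : u =T v -> u' =T v' -> u2 =T v2 ->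
  w - w' = (u - v) + (u' - v') + (u2 - v2) -> w =T w'.
Proof.
move=> uv uv' uv2 E; apply: (@same_of2 (u - v + (u' - v')) 0 u2 v2) => //.
  by apply: same_of2 uv uv' _; rewrite subr0.
by rewrite subr0.
Qed.

Lemma same_of4 u v u' v' u2 v2 u3 v3 w w' :
  u =T v -> u' =T v' -> u2 =T v2 -> u3 =T v3 ->
  w - w' = (u - v) + (u' - v') + (u2 - v2) + (u3 - v3) -> w =T w'.
Proof.
move=> E1 E2 E3 E4 E; apply: (@same_of2 (u - v + (u' - v') + (u2 - v2)) 0 u3 v3) => //.
  by apply: same_of3 E1 E2 E3 _; rewrite subr0.
by rewrite subr0.
Qed.

Lemma horizontal_period : ((p * n)%N%:Z, 0) =T 0.
Proof. by rewrite /same_point subr0 /in_lattice /= mulr0 subr0 ?dvdz0 dvdzz. Qed.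

(** The vector (0, pn) is p (qn, n) - q (pn, 0). *)
Lemma vertical_period : (0, (p * n)%N%:Z) =T 0.
Proof.
rewrite /same_point subr0 /in_lattice /= sub0r PoszM dvdz_mull //=.
by rewrite -mulNr mulrC dvdz_mulr.
Qed.
End LatticeCombinations.

(** * Rectangles described by rows and positions *)

Section RectangleData.
Import GRing.Theory Num.Theory Order.TTheory.
Local Open Scope ring_scope.
Variables n' p' q : nat.
Local Notation n := n'.+1.
Local Notation p := p'.+1.
Local Notation generator := (generator n' p').
Local Notation rectangle := (rectangle n' p').
Local Notation "u =T v" := (same_point n p q u v) (at level 70).
Implicit Types (r : rectangle) (x y z : generator) (i j l : 'I_n).

Definition position x l : nat := (x.2 l * n + x.1 l)%N.
Local Notation point x l := (lattice_point (gen_point x l)).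

Lemma pointE x l : point x l = ((position x l)%:Z, (l : nat)%:Z).
Proof. by []. Qed.

Lemma position_lt x l : (position x l < p * n)%N.
Proof.
rewrite /position; have := ltn_ord (x.1 l); have := ltn_ord (x.2 l).
move: (nat_of_ord (x.1 l)) (nat_of_ord (x.2 l)) => s a; nia.
Qed.

Lemma position_mod x l : (position x l %% n = x.1 l)%N.
Proof. by rewrite /position modnMDl modn_small. Qed.

Lemma dvdz_small (d : nat) (a b : nat) : (a < d)%N -> (b < d)%N ->
  (d %| a%:Z - b%:Z)%Z -> a = b.
Proof.
by move=> ad bd; rewrite -eqz_mod_dvd !modz_nat eqz_nat !modn_small // => /eqP.
Qed.

Lemma same_row_point u v : u =T v -> u.2 = v.2 -> ((p * n)%N %| u.1 - v.1)%Z.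
Proof. by case/andP=> _ /= + E; rewrite E subrr mulr0 subr0. Qed.

Lemma position_inj x y l : position x l = position y l ->
  x.1 l = y.1 l /\ x.2 l = y.2 l.
Proof.
move=> E; have Es : x.1 l = y.1 l by apply/val_inj; rewrite /= -!position_mod E.
split=> //; apply/val_inj => /=; move: E; rewrite /position Es => /addIn.
by move=> /eqP; rewrite eqn_mul2r => /eqP.
Qed.

Lemma generator_eq x y : (forall l, position x l = position y l) -> x = y.
Proof.
move=> E; rewrite [x]surjective_pairing [y]surjective_pairing; congr pair.
  by apply/permP=> l; have [] := position_inj (E l).
by apply/ffunP=> l; have [] := position_inj (E l).
Qed.

Lemma same_point_position x y l : point x l =T point y l -> position x l = position y l.
Proof.
by move/same_row_point => /(_ erefl); apply: dvdz_small; apply: position_lt.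
Qed.

(** Unpacks [is_rect] with the row [i] of the lower corners and the row [j] of the upper ones
    exposed. The lower left corner is in the fundamental domain, so it is known on the nose; the
    other corners are known only modulo Lambda. *)
Record rect_at x y r i j : Prop := RectAt {
  at_neq : i != j;
  at_width : (0 < rect_width r)%N;
  at_height : (0 < rect_height r)%N;
  at_left : r.1.1 = position x i :> nat;
  at_bottom : r.1.2 = i;
  at_ur : upper_right r =T point x j;
  at_lr : lower_right r =T point y i;
  at_ul : upper_left r =T point y j;
  at_other : forall l, l != i -> l != j -> position x l = position y l }.

Lemma is_rectP x y r : reflect (exists i j, rect_at x y r i j) (is_rect q x y r).
Proof.
apply: (iffP and3P) => [[w0 h0 /existsP[i /existsP[j]]]|[i [j []]]].
  case/and5P=> ij ll ur lr /andP[ul /forallP oth]; exists i, j.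
  have bi : r.1.2 = i.
    apply/val_inj => /=; apply: (@dvdz_small n); rewrite ?ltn_ord //.
    by have := same_row ll; rewrite /= addn0.
  have li : r.1.1 = position x i :> nat.
    apply: (@dvdz_small (p * n)); rewrite ?ltn_ord ?position_lt //.
    have := same_row_point ll; rewrite /= !addn0 bi; exact.
  split=> // l li' lj; have := oth l; rewrite li' lj /=.
  by case/eqP=> E; move: E; rewrite /lattice_point /= => -[].
move=> ij w0 h0 li bi ur lr ul oth; split=> //; apply/existsP; exists i.
apply/existsP; exists j; rewrite ij ur lr ul /=; apply/andP; split.
  by apply: same_eq; rewrite /lower_left /rect_point !addn0 li bi.
apply/forallP=> l; apply/implyP=> /andP[li' lj].
by apply/eqP; rewrite !pointE oth.
Qed.

Lemma same_point_column u (g : generator) k : u =T point g k -> (u.1 %% n)%Z = (g.1 k : nat)%:Z.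
Proof.
by move=> /same_column /=; rewrite -eqz_mod_dvd => /eqP ->; rewrite modz_nat position_mod.
Qed.

Section OneRectangle.
Variables (x y : generator) (r : rectangle) (i j : 'I_n).
Hypothesis xyr : rect_at x y r i j.

Lemma rect_pointE a b :
  rect_point r a b = ((position x i)%:Z + a%:Z, (i : nat)%:Z + b%:Z).
Proof. by rewrite /rect_point /lattice_point /= (at_left xyr) (at_bottom xyr). Qed.

Let w : int := rect_width r.
Let h : int := rect_height r.

Lemma at_urE : ((position x i)%:Z + w, (i : nat)%:Z + h) =T point x j.
Proof. by have := at_ur xyr; rewrite /upper_right rect_pointE. Qed.

Lemma at_lrE : ((position x i)%:Z + w, (i : nat)%:Z) =T point y i.
Proof. by have := at_lr xyr; rewrite /lower_right rect_pointE addr0. Qed.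

Lemma at_ulE : ((position x i)%:Z, (i : nat)%:Z + h) =T point y j.
Proof. by have := at_ul xyr; rewrite /upper_left rect_pointE addr0. Qed.

Lemma rect_at_column : y.1 i = x.1 j /\ y.1 j = x.1 i.
Proof.
split; apply/val_inj/eqP; rewrite -eqz_nat /=.
  by rewrite -(same_point_column (at_ur xyr)) -(same_point_column (at_lr xyr)).
by rewrite -(same_point_column (at_ul xyr)) /= addn0 (at_left xyr) modz_nat position_mod.
Qed.

Lemma rect_at_perm : y.1 = (tperm i j * x.1)%g.
Proof.
have [yi yj] := rect_at_column; apply/permP=> l; rewrite permM.
have [->|li] := eqVneq l i; first by rewrite tpermL yi.
have [->|lj] := eqVneq l j; first by rewrite tpermR yj.
by rewrite tpermD 1?eq_sym //; have [-> _] := position_inj (at_other xyr li lj).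
Qed.

Lemma rect_at_neq_column : x.1 i != x.1 j.
Proof. by rewrite (inj_eq perm_inj) (at_neq xyr). Qed.

Lemma rect_at_phi (R : Rect q x y) : val R = r ->
  rect_phi R = (spin_tau (x.1 i) (x.1 j), y.2 - x.2).
Proof.
rewrite /rect_phi /rect_bottom => ->; rewrite (at_bottom xyr).
by have [-> _] := rect_at_column.
Qed.
End OneRectangle.

Hypothesis Hpq : coprime p q.

(** The difference of the two sizes is a lattice vector. If it is horizontal its length is a
    multiple of pn, and if it is vertical too, because p is coprime to q; widths and heights are
    smaller than pn. *)
Lemma rect_at_det x y y' r r' i j : rect_at x y r i j -> rect_at x y' r' i j ->
  (rect_width r == rect_width r') || (rect_height r == rect_height r') ->
  r = r' /\ y = y'.
Proof.
move=> xyr xyr' wh.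
have ur : ((rect_width r)%:Z - (rect_width r')%:Z, (rect_height r)%:Z - (rect_height r')%:Z) =T 0.
  by apply: same_of2 (at_urE xyr) (same_sym (at_urE xyr')) _; congr pair; rewrite /=; ring.
have [Ew Eh] : rect_width r = rect_width r' /\ rect_height r = rect_height r'.
  case/orP: wh => /eqP E; split=> //.
    apply: (@dvdz_small (p * n)); rewrite ?ltn_ord //.
    move/andP: ur => /= [/dvdzP[t ht]]; rewrite E subrr !subr0 in ht *; rewrite ht.
    rewrite sub0r dvdzE abszN -dvdzE mulrA PoszM dvdz_mul2r // Gauss_dvdzr //.
    by move=> pt; rewrite dvdz_mul2r.
  apply: (@dvdz_small (p * n)); rewrite ?ltn_ord //.
  by have := same_row_point ur; rewrite /= subr0; apply; rewrite E subrr.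
have Er : r = r'.
  case: r r' xyr xyr' Ew Eh {ur wh} => -[a b] [w h] [[a' b'] [w' h']] xyr xyr' /= Ew Eh.
  congr ((_, _), (_, _)); try exact/val_inj.
    by apply/val_inj; rewrite [LHS](at_left xyr) [RHS](at_left xyr').
  by rewrite [LHS](at_bottom xyr) [RHS](at_bottom xyr').
split=> //; subst r'; apply: generator_eq => l.
have [->|li] := eqVneq l i.
  by apply: same_point_position; apply: same_trans (same_sym (at_lr xyr)) (at_lr xyr').
have [->|lj] := eqVneq l j.
  by apply: same_point_position; apply: same_trans (same_sym (at_ul xyr)) (at_ul xyr').
by rewrite -(at_other xyr) // -(at_other xyr').
Qed.
End RectangleData.

                                                        

(** * The boundary of a polygon as an invariant *)

Section PolygonBoundary.
Import GRing.Theory Num.Theory Order.TTheory.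
Local Open Scope ring_scope.
Variables n' p' q : nat.
Local Notation n := n'.+1.
Local Notation p := p'.+1.
Local Notation generator := (generator n' p').
Local Notation rectangle := (rectangle n' p').
Local Notation "u =T v" := (same_point n p q u v) (at level 70).
Implicit Types (r : rectangle) (x y z : generator) (i j l c : 'I_n).

                                                                             
                                                                        
                                                      
(** Indicator of the circle with index [l]. From it, [boundary_h l] counts +1 for the bottom edge of
    a unit square on alpha_l and -1 for its top edge, and [boundary_v c] does so for left and right
    edges on beta_c. Interior edges cancel in the sum over tiles. *)
Definition residue (a : int) (l : nat) : int := ((a %% n)%Z == l%:Z :> int)%:R.
Definition boundary_h l (u : int * int) : int := residue u.2 l - residue (u.2 + 1) l.
Definition boundary_v c (u : int * int) : int := residue u.1 c - residue (u.1 + 1) c.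

Lemma boundary_h_same l u v : u =T v -> boundary_h l u = boundary_h l v.
Proof.
move=> /same_row; rewrite -eqz_mod_dvd => /eqP E; rewrite /boundary_h /residue E.
by rewrite -modzDml E modzDml.
Qed.

Lemma boundary_v_same c u v : u =T v -> boundary_v c u = boundary_v c v.
Proof.
move=> /same_column; rewrite -eqz_mod_dvd => /eqP E; rewrite /boundary_v /residue E.
by rewrite -modzDml E modzDml.
Qed.

Lemma sum_tile (phi : int * int -> int) r1 r2 :
  \sum_(t : tile r1 r2) phi (tile_point t) =
  \sum_(a < rect_width r1) \sum_(b < rect_height r1) phi (rect_point r1 a b)
  + \sum_(a < rect_width r2) \sum_(b < rect_height r2) phi (rect_point r2 a b).
Proof.
rewrite big_sumType /=; congr (_ + _); rewrite pair_bigA /=;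
  by apply: eq_bigr => -[a b] _.
Qed.

Lemma same_polygon_sum (phi : int * int -> int) r1 r2 r3 r4 :
  (forall u v, u =T v -> phi u = phi v) -> same_polygon q r1 r2 r3 r4 ->
  \sum_(t : tile r1 r2) phi (tile_point t) = \sum_(t : tile r3 r4) phi (tile_point t).
Proof.
move=> phiT [f [bf fT _ _]]; rewrite [RHS](reindex f) /=; last exact: onW_bij.
by apply: eq_bigr => t _; rewrite (phiT _ _ (fT t)).
Qed.

Lemma residue_telescope (a : int) (m l : nat) :
  \sum_(b < m) (residue (a + (b : nat)%:Z) l - residue (a + (b : nat)%:Z + 1) l) =
  residue a l - residue (a + m%:Z) l.
Proof.
elim: m => [|m IH]; first by rewrite big_ord0 addr0 subrr.
rewrite big_ord_recr IH /= addrA subrK; congr (_ - residue _ _).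
by rewrite -addrA -addn1 PoszD.
Qed.

Section OneRectangle.
Variables (x y : generator) (r : rectangle) (i j : 'I_n).
Hypothesis xyr : rect_at q x y r i j.

(** Each column of unit squares telescopes to its bottom edge minus its top edge. *)
Lemma sum_boundary_h l :
  \sum_(a < rect_width r) \sum_(b < rect_height r) boundary_h l (rect_point r a b) =
  (rect_width r)%:Z * ((i == l)%:R - (j == l)%:R).
Proof.
have E (a : 'I_(rect_width r)) : \sum_(b < rect_height r)
    boundary_h l (rect_point r a b) = (i == l)%:R - (j == l)%:R.
  under eq_bigr do rewrite (rect_pointE xyr) /boundary_h /=.
  rewrite residue_telescope /residue modz_nat modn_small // eqz_nat.
  have := same_row (at_urE xyr); rewrite -eqz_mod_dvd /= => /eqP ->.
  by rewrite modz_nat modn_small // eqz_nat.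
by rewrite (eq_bigr _ (fun t _ => E t)) sumr_const card_ord -[LHS]mulr_natl natz.
Qed.

Lemma sum_boundary_v c :
  \sum_(a < rect_width r) \sum_(b < rect_height r) boundary_v c (rect_point r a b) =
  (rect_height r)%:Z * ((x.1 i == c)%:R - (x.1 j == c)%:R).
Proof.
rewrite exchange_big /=.
have E (b : 'I_(rect_height r)) : \sum_(a < rect_width r)
    boundary_v c (rect_point r a b) = (x.1 i == c)%:R - (x.1 j == c)%:R.
  under eq_bigr do rewrite (rect_pointE xyr) /boundary_v /=.
  rewrite residue_telescope /residue modz_nat position_mod eqz_nat.
  by have /= -> := same_point_column (at_urE xyr); rewrite eqz_nat.
by rewrite (eq_bigr _ (fun t _ => E t)) sumr_const card_ord -[LHS]mulr_natl natz.
Qed.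
End OneRectangle.

                                                                               
                                                        
(** Lets the two rows be named in either order: reversing them negates the signed width [d] and the
    signed height [e], and the boundary formulas stay the same. *)
Definition oriented_at x y r i j (d e : int) : Prop :=
  [/\ rect_at q x y r i j, d = rect_width r & e = rect_height r] \/
  [/\ rect_at q x y r j i, d = - (rect_width r)%:Z & e = - (rect_height r)%:Z].

Lemma oriented_sym x y r i j d e :
  oriented_at x y r i j d e -> oriented_at x y r j i (- d) (- e).
Proof. by case=> -[xyr -> ->]; [right|left]; split; rewrite ?opprK. Qed.

Section Oriented.
Variables (x y : generator) (r : rectangle) (i j : 'I_n) (d e : int).
Hypothesis xyr : oriented_at x y r i j d e.

Lemma oriented_neq : i != j.
Proof. by case: xyr => -[] /at_neq; rewrite 1?eq_sym. Qed.

Lemma oriented_perm : y.1 = (tperm i j * x.1)%g.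
Proof. by case: xyr => -[] /rect_at_perm ->; rewrite // tpermC. Qed.

Lemma oriented_neq0 : d != 0 /\ e != 0.
Proof.
by case: xyr => -[A -> ->]; have := at_width A; have := at_height A; split; lia.
Qed.

Lemma oriented_sign : (d < 0) = (e < 0).
Proof.
by case: xyr => -[A -> ->]; have := at_width A; have := at_height A; lia.
Qed.

Lemma oriented_h l :
  \sum_(a < rect_width r) \sum_(b < rect_height r) boundary_h l (rect_point r a b) =
  d * ((i == l)%:R - (j == l)%:R).
Proof.
by case: xyr => -[A -> _]; rewrite (sum_boundary_h A) // mulNr -mulrN opprB.
Qed.

Lemma oriented_v c :
  \sum_(a < rect_width r) \sum_(b < rect_height r) boundary_v c (rect_point r a b) =
  e * ((x.1 i == c)%:R - (x.1 j == c)%:R).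
Proof.
by case: xyr => -[A _ ->]; rewrite (sum_boundary_v A) // mulNr -mulrN opprB.
Qed.
End Oriented.

(** The bijection of tiles respects projections to T, so both decompositions have the same total
    boundary on every alpha circle and every beta circle. *)
Lemma same_polygon_boundary x y z r1 r2 i j k l d1 e1 d2 e2
    y' r3 r4 i' j' k' l' d3 e3 d4 e4 :
  oriented_at x y r1 i j d1 e1 -> oriented_at y z r2 k l d2 e2 ->
  oriented_at x y' r3 i' j' d3 e3 -> oriented_at y' z r4 k' l' d4 e4 ->
  same_polygon q r1 r2 r3 r4 ->
  (forall m, d1 * ((i == m)%:R - (j == m)%:R) + d2 * ((k == m)%:R - (l == m)%:R) =
     d3 * ((i' == m)%:R - (j' == m)%:R) + d4 * ((k' == m)%:R - (l' == m)%:R)) /\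
  (forall c, e1 * ((x.1 i == c)%:R - (x.1 j == c)%:R) +
      e2 * ((y.1 k == c)%:R - (y.1 l == c)%:R) =
     e3 * ((x.1 i' == c)%:R - (x.1 j' == c)%:R) +
      e4 * ((y'.1 k' == c)%:R - (y'.1 l' == c)%:R)).
Proof.
move=> o1 o2 o3 o4 P; split=> m.
  have := same_polygon_sum (@boundary_h_same m) P; rewrite !sum_tile.
  by rewrite (oriented_h o1) (oriented_h o2) (oriented_h o3) (oriented_h o4).
have := same_polygon_sum (@boundary_v_same m) P; rewrite !sum_tile.
by rewrite (oriented_v o1) (oriented_v o2) (oriented_v o3) (oriented_v o4).
Qed.

Hypothesis Hpq : coprime p q.

Lemma oriented_det x y y' r r' i j d e e' :
  oriented_at x y r i j d e -> oriented_at x y' r' i j d e' -> r = r' /\ y = y'.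
Proof.
case=> -[A Ed Ee] [] [A' Ed' Ee'].
- by apply: (rect_at_det Hpq A A'); apply/orP; left; apply/eqP; lia.
- by have := at_width A; have := at_width A'; lia.
- by have := at_width A; have := at_width A'; lia.
- by apply: (rect_at_det Hpq A A'); apply/orP; left; apply/eqP; lia.
Qed.
End PolygonBoundary.

(** * Factorisations into two transpositions *)

Section TranspositionProducts.
Local Open Scope group_scope.
Variable T : finType.
Implicit Types a b c d i j k l : T.

Definition same_pair i j a b := (i == a) && (j == b) || (i == b) && (j == a).

Lemma same_pairP i j a b :
  reflect (i = a /\ j = b \/ i = b /\ j = a) (same_pair i j a b).
Proof.
apply: (iffP orP) => [[] /andP[/eqP-> /eqP->]|[] [-> ->]]; rewrite ?eqxx; auto.
Qed.

Lemma tperm_same_pair i j a b : i != j -> tperm i j = tperm a b -> same_pair i j a b.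
Proof.
move=> ij E; have := congr1 (fun s : {perm T} => s i) E; rewrite /= tpermL /same_pair.
case: tpermP => [->|->|_ _ ji]; rewrite ?eqxx; [by move->; rewrite eqxx|by move->; rewrite eqxx orbT|].
by rewrite ji eqxx in ij.
Qed.

(** If [i] were fixed, both transpositions would be the same and the product trivial, although it
    moves [a]. *)
Lemma tperm_mul_moves i j k l a b : i != j -> a != b ->
  (tperm k l * tperm i j) a = b -> (tperm k l * tperm i j) i != i.
Proof.
move=> ij ab; rewrite !permM => E; apply/eqP=> /(canRL (tpermK _ _)).
rewrite tpermL => Eij; move: E; suff -> : tperm k l = tperm i j.
  by rewrite tpermK => E; rewrite E eqxx in ab.
move: Eij; case: tpermP => [-> ->|-> ->|_ _ E]; rewrite // 1?tpermC //.
by rewrite E eqxx in ij.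
Qed.

(** The factor [tperm i j] moves only points moved by the 3-cycle, so it is one of the three
    transpositions of a, b, c, and it determines the other factor. *)
Lemma tperm_factor3 a b c i j k l : uniq [:: a; b; c] -> i != j -> k != l ->
  tperm b c * tperm a b = tperm k l * tperm i j ->
  [\/ same_pair i j a b /\ same_pair k l b c,
      same_pair i j b c /\ same_pair k l a c
    | same_pair i j a c /\ same_pair k l a b].
Proof.
move=> /uniq3P[ab ac bc] ij kl E.
have [ba ca cb] : [/\ b != a, c != a & c != b] by split; rewrite eq_sym.
have Ea : (tperm k l * tperm i j) a = b by rewrite -E permM (tpermD ba) // tpermL.
have in3 t : (tperm k l * tperm i j) t != t -> [\/ t = a, t = b | t = c].
  rewrite -E permM; have [->|tb] := eqVneq t b; first by constructor 2.
  have [->|ta] := eqVneq t a; first by constructor 1.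
  have [->|tc] := eqVneq t c; first by constructor 3.
  by rewrite !tpermD ?eqxx // eq_sym.
have /in3 i3 := tperm_mul_moves ij ab Ea.
have /in3 j3 : (tperm k l * tperm i j) j != j.
  by move: Ea; rewrite (tpermC i j); apply: tperm_mul_moves; rewrite // eq_sym.
have M3 u v w : u != w -> v != w -> tperm v w * tperm u v = tperm u v * tperm u w.
  by move=> uw vw; rewrite conjgC tpermJ tpermR tpermD.
have pairE u v : same_pair i j u v -> tperm i j = tperm u v.
  by case/same_pairP=> -[-> ->]; rewrite // tpermC.
have fin u v w t : same_pair i j u v -> tperm b c * tperm a b = tperm w t * tperm u v ->
    same_pair i j u v /\ same_pair k l w t.
  move=> ijuv; rewrite E (pairE _ _ ijuv) => /mulIg kl'; split=> //.
  exact: tperm_same_pair.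
have Fab ijab := fin a b b c ijab erefl.
have Fbc : same_pair i j b c -> same_pair i j b c /\ same_pair k l a c.
  by move=> ijbc; apply: fin ijbc _; rewrite (tpermC a c) [RHS]M3 // (tpermC b a).
have Fac : same_pair i j a c -> same_pair i j a c /\ same_pair k l a b.
  by move=> ijac; apply: fin ijac _; apply: M3.
have /orP[/Fab ?|nab] := orbN (same_pair i j a b); first by constructor 1.
have /orP[/Fbc ?|nbc] := orbN (same_pair i j b c); first by constructor 2.
have /orP[/Fac ?|nac] := orbN (same_pair i j a c); first by constructor 3.
move: nab nbc nac ij; rewrite /same_pair.
by case: i3 => ->; case: j3 => ->; rewrite !eqxx ?orbT.
Qed.

(** A product of two disjoint transpositions exchanges [i] and [j], so {i, j} is one of its two
    orbits of size two. *)
Lemma tperm_factor4 a b c d i j k l : uniq [:: a; b; c; d] -> i != j -> k != l ->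
  tperm c d * tperm a b = tperm k l * tperm i j ->
  same_pair i j a b /\ same_pair k l c d \/ same_pair i j c d /\ same_pair k l a b.
Proof.
rewrite /= !inE !negb_or !andbT => /and3P[/and3P[ab ac ad] /andP[bc bd] cd] ij kl E.
have C : tperm c d * tperm a b = tperm a b * tperm c d.
  by rewrite conjgC tpermJ !tpermD.
have [da db ca cb] : [/\ d != a, d != b, c != a & c != b] by split; rewrite eq_sym.
set s := tperm k l * tperm i j in E *.
have Ea : s a = b by rewrite -E permM (tpermD ca da) tpermL.
have Eb : s b = a by rewrite -E permM (tpermD cb db) tpermR.
have Ec : s c = d by rewrite -E permM tpermL (tpermD ad bd).
have Ed : s d = c by rewrite -E permM tpermR (tpermD ac bc).
have ss t : s (s t) = t.
  by rewrite -permM -E {2}C -mulgA (mulgA (tperm a b)) tperm2 mul1g tperm2 perm1.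
have si : s i != i := tperm_mul_moves ij ab Ea.
(* Otherwise [tperm k l] moves both [i] and [j], hence equals [tperm i j], and the product is
   trivial. *)
have sij : s i = j.
  have sC : s = tperm i j * tperm k l.
    have ss1 : s * s = 1 by apply/permP=> t; rewrite permM ss perm1.
    apply: (mulgI s); rewrite ss1 {1}/s -mulgA (mulgA (tperm i j)) tperm2 mul1g.
    by rewrite tperm2.
  have [ti|ti] := eqVneq (tperm k l i) i; first by rewrite /s permM ti tpermL.
  have [tj|tj] := eqVneq (tperm k l j) j; first by rewrite sC permM tpermL tj.
  have moved t : tperm k l t != t -> t = k \/ t = l.
    by case: tpermP => [->|->|_ _]; [auto|auto|rewrite eqxx].
  move: si; suff -> : s = 1 by rewrite perm1 eqxx.
  rewrite /s; case: (moved _ ti) (moved _ tj) ij => -> [] ->; rewrite ?eqxx // => _.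
    by rewrite tperm2.
  by rewrite (tpermC l) tperm2.
have in4 : [\/ i = a, i = b, i = c | i = d].
  have [ia|ia] := eqVneq i a; first by constructor 1.
  have [ib|ib] := eqVneq i b; first by constructor 2.
  have [ic|ic] := eqVneq i c; first by constructor 3.
  have [id|id] := eqVneq i d; first by constructor 4.
  have cdi : tperm c d i = i by rewrite tpermD // eq_sym.
  have abi : tperm a b i = i by rewrite tpermD // eq_sym.
  by move: si; rewrite -E permM cdi abi eqxx.
have pairE u v : same_pair i j u v -> tperm i j = tperm u v.
  by case/same_pairP=> -[-> ->]; rewrite // tpermC.
have [ijab|ijcd] : same_pair i j a b \/ same_pair i j c d.
  by rewrite /same_pair -sij; case: in4 => ->; rewrite ?Ea ?Eb ?Ec ?Ed !eqxx ?orbT; auto.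
- left; split=> //; apply: tperm_same_pair => //.
  by apply: (mulIg (tperm i j)); rewrite -/s -E (pairE _ _ ijab).
right; split=> //; apply: tperm_same_pair => //.
by apply: (mulIg (tperm i j)); rewrite -/s -E (pairE _ _ ijcd) C.
Qed.
End TranspositionProducts.

(** * Lengths of rows and columns of tiles *)

Section Chains.
Variables (A B : Type) (upA : rel A) (upB : rel B).
Variables (rkA htA : A -> nat) (rkB htB : B -> nat) (f : A -> B).

(** Models tiles stacked in columns: [rk] is the place of a tile in its column, [ht] the length of
    the column, and neighbours exist except at the two ends. *)
Definition graded_chains (C : Type) (up : rel C) (rk ht : C -> nat) :=
  [/\ forall c, rk c < ht c,
      forall c d, up c d -> rk d = (rk c).+1 /\ ht d = ht c,
      forall c, 0 < rk c -> exists d, up d c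
    & forall c, (rk c).+1 < ht c -> exists d, up c d].

Hypothesis gA : graded_chains upA rkA htA.
Hypothesis gB : graded_chains upB rkB htB.
Hypothesis fbij : bijective f.
Hypothesis fup : forall c d, upB (f c) (f d) = upA c d.

(** The rank is the number of steps down to the end of the column, which a bijection respecting
    neighbours preserves. In [chain_height] the same is done upwards. *)
Lemma chain_rank c : rkB (f c) = rkA c.
Proof.
have [g fK gK] := fbij; have [_ A1 A2 _] := gA; have [_ B1 B2 _] := gB.
move: {2}(rkA c) (erefl (rkA c)) => m; elim: m c => [|m IH] c Ec; rewrite Ec.
  case: (posnP (rkB (f c))) => // /B2[d]; rewrite -{1}[d]gK fup => /A1[].
  by rewrite Ec.
have [d dc] : exists d, upA d c by apply: A2; rewrite Ec.
have Ed : rkA d = m by have [] := A1 _ _ dc; rewrite Ec => -[].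
by have := dc; rewrite -fup => /B1[-> _]; rewrite IH // Ed.
Qed.

Lemma chain_height c : htB (f c) = htA c.
Proof.
have [g fK gK] := fbij; have [A0 A1 _ A3] := gA; have [B0 B1 _ B3] := gB.
move: {2}(htA c - (rkA c).+1) (erefl (htA c - (rkA c).+1)) => m.
elim: m c => [|m IH] c Ec.
  have EA : htA c = (rkA c).+1 by have := A0 c; lia.
  case: (ltnP (rkB (f c)).+1 (htB (f c))) => [/B3[d]|]; last first.
    by have := B0 (f c); rewrite EA chain_rank; lia.
  rewrite -{1}[d]gK fup => /A1[E1 E2]; have := A0 (g d); lia.
have [d cd] : exists d, upA c d by apply: A3; lia.
have [E1 E2] := A1 _ _ cd; have := cd; rewrite -fup => /B1[_ <-].
by rewrite -E2; apply: IH; lia.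
Qed.
End Chains.

(** * The function built from a section is a sign assignment *)

Section SpinSign.
Local Open Scope group_scope.
Variable n : nat.
Local Notation z := (spin_z n).

Definition spin_sign (b : bool) : spin n := if b then z else 1.

Lemma spin_signM a b : spin_sign a * spin_sign b = spin_sign (a (+) b).
Proof. by case: a; case: b; rewrite /= ?mulg1 ?mul1g ?spin_z_sq. Qed.

Lemma spin_sign_central a (u : spin n) : spin_sign a * u = u * spin_sign a.
Proof. by case: a; rewrite /= ?mulg1 ?mul1g ?spin_z_central. Qed.

Lemma spin_sign_inj : injective spin_sign.
Proof.
by case=> -[] //= E; have := spin_z_neq1 n; rewrite E eqxx.
Qed.

Lemma spin_sign_mul a b (u v : spin n) :
  (spin_sign a * u) * (spin_sign b * v) = spin_sign (a (+) b) * (u * v).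
Proof.
by rewrite -spin_signM -!mulgA (mulgA u) -(spin_sign_central b u) -!mulgA.
Qed.
End SpinSign.

Section SignRho.
Import GRing.Theory Num.Theory Order.TTheory.
Local Open Scope ring_scope.
Variables n' p' q : nat.
Local Notation n := n'.+1.
Local Notation p := p'.+1.
Local Notation generator := (generator n' p').
Local Notation rectangle := (rectangle n' p').
Local Notation "u =T v" := (same_point n p q u v) (at level 70).
Local Notation point x l := (lattice_point (gen_point x l)).
Local Notation rect_at := (@rect_at n' p' q).
Local Notation oriented_at := (@oriented_at n' p' q).
Local Notation tau := (@spin_tau n).
Local Notation zs := (@spin_sign n).
Implicit Types (r : rectangle) (x y z : generator) (i j k l : 'I_n).

(** The Spin component of [rect_phi]; the component in Z/p matches by construction and carries no
    sign. *)
Definition rect_tau x y r : spin n := tau (x.1 r.1.2) (y.1 r.1.2).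

Lemma rect_tauE x y r i j d e : oriented_at x y r i j d e ->
  rect_tau x y r = (zs (d < 0) * tau (x.1 i) (x.1 j))%g.
Proof.
case=> -[A -> _]; rewrite /rect_tau (at_bottom A); have [-> _] := rect_at_column A.
  by rewrite ltNge /= mul1g.
have := at_width A; rewrite oppr_lt0 ltz_nat => -> /=.
by apply: spin_tau_sym; apply: rect_at_neq_column A.
Qed.

Lemma oriented_pair x y r i j a b d e : oriented_at x y r i j d e ->
  same_pair i j a b -> exists d' e', oriented_at x y r a b d' e'.
Proof.
move=> o /same_pairP[] [Ei Ej]; subst; first by exists d, e.
by exists (- d), (- e); apply: oriented_sym.
Qed.

Lemma oriented_exists x y r : is_rect q x y r ->
  exists i j d e, oriented_at x y r i j d e.
Proof.
by case/is_rectP=> i [j A]; exists i, j, (rect_width r : int), (rect_height r : int); left.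
Qed.

Hypothesis Hpq : coprime p q.

Section TileChains.
Variables (r1 r2 : rectangle).

Definition tile_row (t : tile r1 r2) : nat :=
  match t with inl (_, b) => b | inr (_, b) => b end.
Definition tile_column (t : tile r1 r2) : nat :=
  match t with inl (a, _) => a | inr (a, _) => a end.
Definition tile_height (t : tile r1 r2) : nat :=
  match t with inl _ => rect_height r1 | inr _ => rect_height r2 end.
Definition tile_width (t : tile r1 r2) : nat :=
  match t with inl _ => rect_width r1 | inr _ => rect_width r2 end.

(** If neither possible horizontal gluing segment is present, the columns of the polygon are those
    of the two rectangles. For rows, see [right_chains]. *)
Lemma upper_chains :
  ~~ (upper_left r1 =T lower_left r2) -> ~~ (upper_right r2 =T lower_right r1) ->
  graded_chains (@upper_neighbour n' p' q r1 r2) tile_row tile_height.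
Proof.
move=> /negPf N1 /negPf N2; split.
- by move=> [] [a b] /=.
- by move=> [] [a b] [] [a' b'] /=; rewrite ?N1 ?N2 //= => /andP[_ /eqP->].
- move=> [] [a b] /= b0.
    have lt : (b.-1 < rect_height r1)%N by apply: leq_ltn_trans (leq_pred _) _.
    by exists (inl (a, Ordinal lt)); rewrite /= prednK ?eqxx.
  have lt : (b.-1 < rect_height r2)%N by apply: leq_ltn_trans (leq_pred _) _.
  by exists (inr (a, Ordinal lt)); rewrite /= prednK ?eqxx.
- by move=> [] [a b] /= lt; [exists (inl (a, Ordinal lt))|exists (inr (a, Ordinal lt))]; rewrite /= !eqxx.
Qed.

Lemma right_chains :
  ~~ (lower_right r1 =T lower_left r2) -> ~~ (upper_right r2 =T upper_left r1) ->
  graded_chains (@right_neighbour n' p' q r1 r2) tile_column tile_width.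
Proof.
move=> /negPf N1 /negPf N2; split.
- by move=> [] [a b] /=.
- by move=> [] [a b] [] [a' b'] /=; rewrite ?N1 ?N2 //= => /andP[/eqP-> _].
- move=> [] [a b] /= a0.
    have lt : (a.-1 < rect_width r1)%N by apply: leq_ltn_trans (leq_pred _) _.
    by exists (inl (Ordinal lt, b)); rewrite /= eqxx prednK ?eqxx.
  have lt : (a.-1 < rect_width r2)%N by apply: leq_ltn_trans (leq_pred _) _.
  by exists (inr (Ordinal lt, b)); rewrite /= eqxx prednK ?eqxx.
- by move=> [] [a b] /= lt; [exists (inl (Ordinal lt, b))|exists (inr (Ordinal lt, b))]; rewrite /= !eqxx.
Qed.
End TileChains.

Lemma same_point_row x i y j : point x i =T point y j -> i = j.
Proof.
by move/same_row => /= E; apply/val_inj; apply: (@dvdz_small n); rewrite ?ltn_ord // -dvdzE.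
Qed.

Lemma corners_neq x i j (u v : int * int) :
  u =T point x i -> v =T point x j -> i != j -> ~~ (u =T v).
Proof.
move=> ui vj; apply: contra => uv; apply/eqP.
exact: same_point_row (same_trans (same_sym ui) (same_trans uv vj)).
Qed.

Lemma at_ll x y r i j : rect_at x y r i j -> lower_left r =T point x i.
Proof.
by move=> A; apply: same_eq; rewrite /lower_left (rect_pointE A) pointE !addr0.
Qed.

Lemma at_row x y r i j : rect_at x y r i j -> ((i + rect_height r) %% n = j)%N.
Proof.
move=> A; have := same_row (at_urE A); rewrite -eqz_mod_dvd /= => /eqP.
by rewrite !modz_nat => -[->]; rewrite modn_small.
Qed.

Section SamePolygonChains.
Variables (r1 r2 r3 r4 : rectangle).
Hypothesis P : same_polygon q r1 r2 r3 r4.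
Hypothesis pos : [/\ (0 < rect_width r1)%N, (0 < rect_height r1)%N,
  (0 < rect_width r2)%N & (0 < rect_height r2)%N].

Let tiles : exists (t1 : tile r1 r2) (t2 : tile r1 r2),
  [/\ tile_height t1 = rect_height r1, tile_height t2 = rect_height r2,
      tile_width t1 = rect_width r1 & tile_width t2 = rect_width r2].
Proof.
by case: pos => w1 h1 w2 h2; exists (inl (Ordinal w1, Ordinal h1)), (inr (Ordinal w2, Ordinal h2)).
Qed.

Let tile_heightP s1 s2 (t : tile s1 s2) :
  tile_height t = rect_height s1 \/ tile_height t = rect_height s2.
Proof. by case: t; auto. Qed.

Let tile_widthP s1 s2 (t : tile s1 s2) :
  tile_width t = rect_width s1 \/ tile_width t = rect_width s2.
Proof. by case: t; auto. Qed.

(** Column lengths are preserved, so both heights of the first pair occur in the second pair; the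
    equation between sums then leaves no room for an exchange of distinct heights. *)
Lemma same_polygon_heights :
  ~~ (upper_left r1 =T lower_left r2) -> ~~ (upper_right r2 =T lower_right r1) ->
  ~~ (upper_left r3 =T lower_left r4) -> ~~ (upper_right r4 =T lower_right r3) ->
  (rect_height r1 + rect_height r4 = rect_height r3 + rect_height r2)%N ->
  rect_height r1 = rect_height r3.
Proof.
move=> N1 N2 N3 N4; have [f [bf _ _ fu]] := P.
have [t1 [t2 [E1 E2 _ _]]] := tiles.
have H := chain_height (upper_chains N1 N2) (upper_chains N3 N4) bf fu.
have := H t1; have := H t2; rewrite E1 E2.
by case: (tile_heightP (f t1)) => ->; case: (tile_heightP (f t2)) => ->; lia.
Qed.

Lemma same_polygon_widths :
  ~~ (lower_right r1 =T lower_left r2) -> ~~ (upper_right r2 =T upper_left r1) ->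
  ~~ (lower_right r3 =T lower_left r4) -> ~~ (upper_right r4 =T upper_left r3) ->
  (rect_width r1 + rect_width r4 = rect_width r3 + rect_width r2)%N ->
  rect_width r1 = rect_width r3.
Proof.
move=> N1 N2 N3 N4; have [f [bf _ fr _]] := P.
have [t1 [t2 [_ _ E1 E2]]] := tiles.
have H := chain_height (right_chains N1 N2) (right_chains N3 N4) bf fr.
have := H t1; have := H t2; rewrite E1 E2.
by case: (tile_widthP (f t1)) => ->; case: (tile_widthP (f t2)) => ->; lia.
Qed.
End SamePolygonChains.

Section Decompositions.
Variables (x y z y' : generator) (r1 r2 r3 r4 : rectangle).
Hypothesis P : same_polygon q r1 r2 r3 r4.
Hypothesis ne : (r1, r2) != (r3, r4).
Local Notation T1 := (rect_tau x y r1).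
Local Notation T2 := (rect_tau y z r2).
Local Notation T3 := (rect_tau x y' r3).
Local Notation T4 := (rect_tau y' z r4).

Let same_first i j k l (d e e' m f f' : int) :
  oriented_at x y r1 i j d e -> oriented_at y z r2 k l m f ->
  oriented_at x y' r3 i j d e' -> oriented_at y' z r4 k l m f' -> False.
Proof.
move=> o1 o2 o3 o4; have [E1 Ey] := oriented_det Hpq o1 o3; rewrite -Ey in o4.
by have [E2 _] := oriented_det Hpq o2 o4; move: ne; rewrite E1 E2 eqxx.
Qed.

(** Disjoint pairs of rows: a different decomposition performs the two transpositions in the
    opposite order, and lifts of disjoint transpositions commute up to z. *)
Lemma decomposition4 i j k l d1 e1 d2 e2 i' j' k' l' d3 e3 d4 e4 :
  oriented_at x y r1 i j d1 e1 -> oriented_at y z r2 k l d2 e2 ->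
  oriented_at x y' r3 i' j' d3 e3 -> oriented_at y' z r4 k' l' d4 e4 ->
  uniq [:: i; j; k; l] -> (T1 * T2 = spin_z n * (T3 * T4))%g.
Proof.
move=> o1 o2 o3 o4 u4.
have E : (tperm k l * tperm i j = tperm k' l' * tperm i' j')%g.
  by apply: (mulIg x.1); rewrite -!mulgA -(oriented_perm o1) -(oriented_perm o3)
    -(oriented_perm o2) -(oriented_perm o4).
have := u4; rewrite /= !inE !negb_or !andbT => /and3P[/and3P[ij ik il] /andP[jk jl] kl].
have nE : ((i == k) = false) * ((j == i) = false) * ((k == i) = false) *
    ((l == i) = false) * ((j == k) = false) * ((l == k) = false).
  by rewrite !(eq_sym _ i) (eq_sym l) !(negPf ij, negPf ik, negPf il, negPf jk, negPf kl).
have [] := tperm_factor4 u4 (oriented_neq o3) (oriented_neq o4) E; case=> /(oriented_pair o3)[d [e {}o3]]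
  /(oriented_pair o4)[d' [e' {}o4]].
  have [Dh _] := same_polygon_boundary o1 o2 o3 o4 P.
  have := Dh i; have := Dh k; rewrite !eqxx !nE /=.
  rewrite !subr0 !mulr1 !mulr0 !addr0 !add0r => E2 E1; subst d d'.
  by case: (same_first o1 o2 o3 o4).
(* The order is reversed: the boundary matches the signed width of [r1] with that of [r4], and of
   [r2] with that of [r3]. *)
have [Dh _] := same_polygon_boundary o1 o2 o3 o4 P.
have := Dh i; have := Dh k; rewrite !eqxx !nE /=.
rewrite !subr0 !mulr1 !mulr0 !addr0 !add0r => E2 E1; subst d d'.
rewrite (rect_tauE o1) (rect_tauE o2) (rect_tauE o3) (rect_tauE o4) !spin_sign_mul.
have yE m : m != i -> m != j -> y.1 m = x.1 m.
  by move=> mi mj; rewrite (oriented_perm o1) permM tpermD // eq_sym.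
have y'E m : m != k -> m != l -> y'.1 m = x.1 m.
  by move=> mk ml; rewrite (oriented_perm o3) permM tpermD // eq_sym.
rewrite !yE 1?eq_sym // !y'E // spin_tau_far; last first.
  by rewrite -[[:: _; _; _; _]]/(map x.1 [:: i; j; k; l]) map_inj_uniq //; apply: perm_inj.
by rewrite addbC !mulgA spin_z_central.
Qed.

(** The product is a 3-cycle. One of its factorisations gives back the same rectangles; each of the
    other two contributes a factor z, while the boundary shows that the orientations agree. *)
Lemma decomposition3 i j k d1 e1 d2 e2 i' j' k' l' d3 e3 d4 e4 :
  oriented_at x y r1 i j d1 e1 -> oriented_at y z r2 j k d2 e2 ->
  oriented_at x y' r3 i' j' d3 e3 -> oriented_at y' z r4 k' l' d4 e4 ->
  i != k -> (T1 * T2 = spin_z n * (T3 * T4))%g.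
Proof.
move=> o1 o2 o3 o4 ik; have ij := oriented_neq o1; have jk := oriented_neq o2.
have u3 : uniq [:: i; j; k] by apply/uniq3P.
have E : (tperm j k * tperm i j = tperm k' l' * tperm i' j')%g.
  by apply: (mulIg x.1); rewrite -!mulgA -(oriented_perm o1) -(oriented_perm o3)
    -(oriented_perm o2) -(oriented_perm o4).
have nE : ((i == j) = false) * ((i == k) = false) * ((j == k) = false) *
    ((j == i) = false) * ((k == i) = false) * ((k == j) = false).
  by rewrite !(eq_sym _ i) (eq_sym k) !(negPf ij, negPf ik, negPf jk).
have yj : y.1 j = x.1 i by rewrite (oriented_perm o1) permM tpermR.
have yk : y.1 k = x.1 k by rewrite (oriented_perm o1) permM tpermD // eq_sym.
have xE (s t : 'I_n) : (x.1 s == x.1 t) = (s == t) by rewrite (inj_eq perm_inj).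
have ux : uniq [:: x.1 i; x.1 j; x.1 k].
  by rewrite -[[:: _; _; _]]/(map x.1 [:: i; j; k]) map_inj_uniq //; apply: perm_inj.
have [] := tperm_factor3 u3 (oriented_neq o3) (oriented_neq o4) E; case=> /(oriented_pair o3)[d [e {}o3]]
  /(oriented_pair o4)[d' [e' {}o4]];
  have [Dh Dv] := same_polygon_boundary o1 o2 o3 o4 P.
- have := Dh i; have := Dh k; rewrite !eqxx !nE /= => E2 E1.
  have Ed : d = d1 by lia.
  have Ed' : d' = d2 by lia.
  by subst d d'; case: (same_first o1 o2 o3 o4).
- have y'i : y'.1 i = x.1 i by rewrite (oriented_perm o3) permM tpermD // eq_sym.
  have y'k : y'.1 k = x.1 j by rewrite (oriented_perm o3) permM tpermR.
  have := Dh i; have := Dv (x.1 k); rewrite yj yk y'i y'k !xE !eqxx !nE /= => E2 E1.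
  have Ed' : d' = d1 by lia.
  have Ee : e = e2 by lia.
  rewrite (rect_tauE o1) (rect_tauE o2) (rect_tauE o3) (rect_tauE o4) !spin_sign_mul.
  (* One pair of rectangles is compared through widths and the other only through heights; a signed
     width and a signed height have the same sign. *)
  rewrite (oriented_sign o2) (oriented_sign o3) Ed' Ee yj yk y'i y'k.
  by rewrite spin_tau_cycle // addbC !mulgA spin_z_central.
have y'i : y'.1 i = x.1 k by rewrite (oriented_perm o3) permM tpermL.
have y'j : y'.1 j = x.1 j by rewrite (oriented_perm o3) permM tpermD // eq_sym.
have := Dh k; have := Dv (x.1 j); rewrite yj yk y'i y'j !xE !eqxx !nE /= => E2 E1.
have Ed : d = d2 by lia.
have Ee' : e' = e1 by lia.
rewrite (rect_tauE o1) (rect_tauE o2) (rect_tauE o3) (rect_tauE o4) !spin_sign_mul.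
rewrite (oriented_sign o1) (oriented_sign o4) Ed Ee' yj yk y'i y'j.
by rewrite spin_tau_cycle2 // addbC !mulgA spin_z_central.
Qed.

(** All rectangles have the same bottom row, so nothing is glued along horizontal segments, and the
    column lengths determine the decomposition. *)
Let pure_case i j :
  rect_at x y r1 i j -> rect_at y z r2 i j ->
  rect_at x y' r3 i j -> rect_at y' z r4 i j ->
  (rect_height r1 + rect_height r4 = rect_height r3 + rect_height r2)%N -> False.
Proof.
move=> a1 a2 a3 a4 E; have ij := at_neq a1; have ji : j != i by rewrite eq_sym.
have Eh : rect_height r1 = rect_height r3.
  apply: (same_polygon_heights P) E.
  - by split; [exact: at_width a1|exact: at_height a1|exact: at_width a2|exact: at_height a2].
  - exact: corners_neq (at_ul a1) (at_ll a2) ji.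
  - exact: corners_neq (at_ur a2) (at_lr a1) ji.
  - exact: corners_neq (at_ul a3) (at_ll a4) ji.
  - exact: corners_neq (at_ur a4) (at_lr a3) ji.
have [E1 Ey] : r1 = r3 /\ y = y' by apply: (rect_at_det Hpq a1 a3); rewrite Eh eqxx orbT.
rewrite -Ey in a4; have [E2 _] : r2 = r4 /\ z = z.
  by apply: (rect_at_det Hpq a2 a4); apply/orP; right; apply/eqP; lia.
by move: ne; rewrite E1 E2 eqxx.
Qed.

(** The second rectangle starts on the upper row, so nothing is glued along vertical segments, and
    the row lengths determine the decomposition. *)
Let mixed_case i j :
  rect_at x y r1 i j -> rect_at y z r2 j i ->
  rect_at x y' r3 i j -> rect_at y' z r4 j i ->
  (rect_width r1 + rect_width r4 = rect_width r3 + rect_width r2)%N -> False.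
Proof.
move=> a1 a2 a3 a4 E; have ij := at_neq a1; have ji : j != i by rewrite eq_sym.
have Eh : rect_width r1 = rect_width r3.
  apply: (same_polygon_widths P) E.
  - by split; [exact: at_width a1|exact: at_height a1|exact: at_width a2|exact: at_height a2].
  - exact: corners_neq (at_lr a1) (at_ll a2) ij.
  - exact: corners_neq (at_ur a2) (at_ul a1) ij.
  - exact: corners_neq (at_lr a3) (at_ll a4) ij.
  - exact: corners_neq (at_ur a4) (at_ul a3) ij.
have [E1 Ey] : r1 = r3 /\ y = y' by apply: (rect_at_det Hpq a1 a3); rewrite Eh eqxx.
rewrite -Ey in a4; have [E2 _] : r2 = r4 /\ z = z.
  by apply: (rect_at_det Hpq a2 a4); apply/orP; left; apply/eqP; lia.
by move: ne; rewrite E1 E2 eqxx.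
Qed.

(** The boundary forces [r3] and [r4] onto the same two rows, with d1 + d2 = d3 + d4 and e1 - e2 =
    e3 - e4. What remains is that the parity of the number of negative orientations changes. *)
Lemma decomposition2 i j d1 e1 d2 e2 i' j' k' l' d3 e3 d4 e4 :
  oriented_at x y r1 i j d1 e1 -> oriented_at y z r2 i j d2 e2 ->
  oriented_at x y' r3 i' j' d3 e3 -> oriented_at y' z r4 k' l' d4 e4 ->
  (T1 * T2 = spin_z n * (T3 * T4))%g.
Proof.
move=> o1 o2 o3 o4; have ij := oriented_neq o1; have i'j' := oriented_neq o3.
have xE (s t : 'I_n) : (x.1 s == x.1 t) = (s == t) by rewrite (inj_eq perm_inj).
have E : tperm k' l' = tperm i' j'.
  apply: (mulIg (tperm i' j')); rewrite tperm2; apply: (mulIg x.1).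
  rewrite -mulgA -(oriented_perm o3) -(oriented_perm o4) (oriented_perm o2).
  by rewrite (oriented_perm o1) mulgA tperm2.
have {E}/(oriented_pair o4)[d [e {}o4]] := tperm_same_pair (oriented_neq o4) E.
have yi : y.1 i = x.1 j by rewrite (oriented_perm o1) permM tpermL.
have yj : y.1 j = x.1 i by rewrite (oriented_perm o1) permM tpermR.
have y'i : y'.1 i' = x.1 j' by rewrite (oriented_perm o3) permM tpermL.
have y'j : y'.1 j' = x.1 i' by rewrite (oriented_perm o3) permM tpermR.
have [Dh Dv] := same_polygon_boundary o1 o2 o3 o4 P.
(* Otherwise the boundary vanishes on row [t] and on the column of [x] there, so d1 = - d2 and e1 =
   e2, against the equality of signs. *)
have mem t : t \in [:: i; j] -> t \in [:: i'; j'].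
  have := Dh t; have := Dv (x.1 t); rewrite yi yj y'i y'j !xE !inE => Et Eh tij.
  apply: contraT; rewrite negb_or !(eq_sym t) => /andP[/negPf t1 /negPf t2].
  have := oriented_neq0 o1; have := oriented_neq0 o2.
  have := oriented_sign o1; have := oriented_sign o2.
  move: Et Eh; rewrite !t1 !t2; case/orP: tij => /eqP ->; rewrite !eqxx 1?(eq_sym j) (negPf ij) /=; lia.
have ijp : same_pair i' j' i j.
  have := mem i; have := mem j; rewrite !inE !eqxx orbT /= => /(_ isT) jm /(_ isT) im.
  by move: ij; case/orP: im => /eqP Ei; case/orP: jm => /eqP Ej; rewrite /same_pair Ei Ej !eqxx ?orbT.
have {o3 o4 y'i y'j i'j' Dh Dv mem ijp} [d3' [e3' [d4' [e4' [o3 o4]]]]] : exists d3 e3 d4 e4,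
    oriented_at x y' r3 i j d3 e3 /\ oriented_at y' z r4 i j d4 e4.
  have [d3' [e3' {}o3]] := oriented_pair o3 ijp.
  have [d4' [e4' {}o4]] := oriented_pair o4 ijp.
  by exists d3', e3', d4', e4'.
have y'i : y'.1 i = x.1 j by rewrite (oriented_perm o3) permM tpermL.
have y'j : y'.1 j = x.1 i by rewrite (oriented_perm o3) permM tpermR.
have [Dh Dv] := same_polygon_boundary o1 o2 o3 o4 P.
have := Dh i; have := Dv (x.1 i); rewrite yi yj y'i y'j !xE !eqxx (eq_sym j) (negPf ij) /= => {}Dv {}Dh.
rewrite (rect_tauE o1) (rect_tauE o2) (rect_tauE o3) (rect_tauE o4) !spin_sign_mul.
rewrite yi yj y'i y'j -[spin_z n]/(zs true) (mulgA (zs true)) spin_signM.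
congr (zs _ * _)%g.
(* Of the orientation patterns with unchanged parity, the two equations rule out all but those where
   [r3] and [r4] are oriented like [r1] and [r2]. *)
move: Dh Dv; case: o1 => -[a1 -> ->]; case: o2 => -[a2 -> ->]; case: o3 => -[a3 -> ->]; case: o4 => -[a4 -> ->];
  have := (at_width a1, at_height a1, at_width a2, at_height a2);
  have := (at_width a3, at_height a3, at_width a4, at_height a4);
  move=> [[[P1 P2] P3] P4] [[[P5 P6] P7] P8] Dh Dv; try lia.
- by case: (pure_case a1 a2 a3 a4); lia.
- by case: (mixed_case a1 a2 a3 a4); lia.
- by case: (mixed_case a1 a2 a3 a4); lia.
- by case: (pure_case a1 a2 a3 a4); lia.
Qed.

Lemma decomposition_sign :
  is_rect q x y r1 -> is_rect q y z r2 -> is_rect q x y' r3 -> is_rect q y' z r4 ->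
  (T1 * T2 = spin_z n * (T3 * T4))%g.
Proof.
move=> /oriented_exists[i [j [d1 [e1 o1]]]] /oriented_exists[k [l [d2 [e2 o2]]]].
move=> /oriented_exists[i' [j' [d3 [e3 o3]]]] /oriented_exists[k' [l' [d4 [e4 o4]]]].
have [ik|ik] := eqVneq i k.
  subst k; have [jl|jl] := eqVneq j l; first by subst l; apply: decomposition2 o1 o2 o3 o4.
  exact: decomposition3 (oriented_sym o1) o2 o3 o4 jl.
have [il|il] := eqVneq i l.
  subst l; have [jk|jk] := eqVneq j k.
    by subst k; apply: decomposition2 o1 (oriented_sym o2) o3 o4.
  exact: decomposition3 (oriented_sym o1) (oriented_sym o2) o3 o4 jk.
have [jk|jk] := eqVneq j k; first by subst k; apply: decomposition3 o1 o2 o3 o4 il.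
have [jl|jl] := eqVneq j l.
  by subst l; apply: decomposition3 o1 (oriented_sym o2) o3 o4 ik.
have [ij kl] := (oriented_neq o1, oriented_neq o2).
by apply: decomposition4 o1 o2 o3 o4 _; rewrite /= !inE !negb_or ik il jk jl ij kl.
Qed.
End Decompositions.

Section Assignment.
Variable rho : 'S_n -> spin n.
Hypothesis rhoP : spin_section rho.
Local Notation S := (sign_rho (p' := p') (q := q) rho).

(** Both sides project to the permutation of [y], so by [spin_kernel] they differ by 1 or z, and
    [sign_rho] never takes its default value. *)
Lemma sign_rhoE x y (r : Rect q x y) : exists b : bool,
  S r = (-1) ^+ b /\ (rho x.1 * rect_tau x y (val r) = zs b * rho y.1)%g.
Proof.
have /is_rectP[i [j A]] := valP r.
set t := rect_tau x y (val r).
have tE : t = tau (x.1 i) (x.1 j).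
  by rewrite /t /rect_tau (at_bottom A); have [-> _] := rect_at_column A.
have pt : spin_proj (rho x.1 * t * (rho y.1)^-1)%g = 1%g.
  have pV (a : spin n) : spin_proj a^-1%g = ((spin_proj a)^-1)%g.
    by apply: (mulgI (spin_proj a)); rewrite -spin_projM !mulgV spin_proj_of.
  rewrite !spin_projM pV !rhoP tE spin_proj_tau ?(rect_at_neq_column A) //.
  by rewrite (rect_at_perm A) invMg tpermV -tpermJ conjgE !mulgA mulgV mul1g mulgK tperm2.
have Eb : exists b : bool, (rho x.1 * t = zs b * rho y.1)%g.
  by case: (spin_kernel pt) => E; [exists false|exists true]; rewrite /= -E mulgKV.
have [b Eb1] := Eb; exists b; split=> //.
have Eadd : x.2 + (y.2 - x.2) = y.2 by rewrite addrC subrK.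
rewrite /sign_rho (rect_at_phi A) // /spinZ_mul /= -tE Eb1 Eadd add0r.
case: b Eb1 => Eb1 /=; last by rewrite mul1g eqxx.
(* When the two sides differ by z, the first test in [sign_rho] has to fail, which needs z different
   from 1. *)
rewrite eqxx; case: eqP => // -[] /(congr1 (fun u => u * (rho y.1)^-1)%g).
by rewrite mulgK mulgV => /eqP; rewrite (negPf (spin_z_neq1 n)).
Qed.

Lemma sign_rho_pair x y z (r1 : Rect q x y) (r2 : Rect q y z) : exists b : bool,
  S r1 * S r2 = (-1) ^+ b /\
  (rho x.1 * (rect_tau x y (val r1) * rect_tau y z (val r2)) = zs b * rho z.1)%g.
Proof.
have [b1 [-> E1]] := sign_rhoE r1; have [b2 [-> E2]] := sign_rhoE r2.
exists (b1 (+) b2); split; first by rewrite signr_addb.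
by rewrite mulgA E1 -mulgA E2 mulgA spin_signM.
Qed.

(** In a horizontal annulus the second rectangle has the same rows with the columns exchanged,
    whence tau_ij tau_ji = 1. In a vertical one the rows are exchanged too, and the same lift is
    squared to z. *)
Lemma sign_rho_assignment : sign_assignment S.
Proof.
split.
- by move=> x y r; have [b [-> _]] := sign_rhoE r; case: b; auto.
- move=> x y y' z r1 r2 r3 r4 P ne.
  have [b [-> E]] := sign_rho_pair r1 r2; have [c [-> E']] := sign_rho_pair r3 r4.
  have := decomposition_sign P ne (valP r1) (valP r2) (valP r3) (valP r4) => D.
  move: E; rewrite D mulgA -spin_z_central -[spin_z n]/(zs true) -mulgA E' mulgA.
  by rewrite spin_signM => /mulIg/spin_sign_inj <-; rewrite signrN.
- move=> x y z r1 r2 /and3P[ll w h].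
  have /is_rectP[i [j A]] := valP r1; have /is_rectP[k [l B]] := valP r2.
  have ki : k = i.
    by apply: same_point_row (same_trans (same_sym (at_ll B)) (same_trans (same_sym ll) (at_lr A))).
  have lj : l = j by apply: val_inj; rewrite /= -(at_row A) -(at_row B) ki (eqP h).
  subst k l; have [b [-> E]] := sign_rho_pair r1 r2.
  have [ij ji] := (at_neq A, at_neq B); have [yi yj] := rect_at_column A.
  move: E; rewrite (rect_tauE (or_introl (And3 A erefl erefl))).
  rewrite (rect_tauE (or_introl (And3 B erefl erefl))) yi yj !mul1g spin_tau_inv ?(inj_eq perm_inj) //.
  rewrite (rect_at_perm B) (rect_at_perm A) !mulgA tperm2 mul1g mulg1.
  by rewrite -{1}[rho _]mul1g => /mulIg; case: b => // /esym/eqP; rewrite (negPf (spin_z_neq1 n)).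
move=> x y z r1 r2 /and3P[ll h w].
have /is_rectP[i [j A]] := valP r1; have /is_rectP[k [l B]] := valP r2.
have kj : k = j.
  by apply: same_point_row (same_trans (same_sym (at_ll B)) (same_trans (same_sym ll) (at_ul A))).
have li : l = i.
  apply: val_inj; rewrite /= -(at_row B) kj -(at_row A) modnDml -addnA (eqP h).
  by rewrite addnC modnMDl modn_small.
subst k l; have [b [-> E]] := sign_rho_pair r1 r2.
have [ij ji] := (at_neq A, at_neq B); have [yi yj] := rect_at_column A.
move: E; rewrite (rect_tauE (or_introl (And3 A erefl erefl))).
rewrite (rect_tauE (or_introl (And3 B erefl erefl))) yi yj !mul1g spin_tau_sq ?(inj_eq perm_inj) //.
rewrite (rect_at_perm B) (rect_at_perm A) !mulgA (tpermC j i) tperm2 mul1g.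
by rewrite -spin_z_central => /mulIg; case: b => // /eqP; rewrite (negPf (spin_z_neq1 n)).
Qed.
End Assignment.
End SignRho.

                                                                 

(** * From a potential to an isomorphism of homology *)

Section InvolutionOnHomology.
Import GRing.Theory.
Local Open Scope ring_scope.
Variables (K : comNzRingType) (M : lmodType K) (d1 d2 : {linear M -> M}).
Variable phi : {linear M -> M}.
Hypothesis phi_d : forall m, phi (d1 m) = d2 (phi m).

Lemma push_cycle_subproof (c : cycles d1) : phi (cycle_val c) \in is_cycle d2.
Proof.
have /eqP c0 : d1 (cycle_val c) == 0 := valP c.
by rewrite inE /= -phi_d c0 linear0.
Qed.

Definition push_cycle (c : cycles d1) : cycles d2 := Cycle (push_cycle_subproof c).

Definition push_homology (h : homology d1) : homology d2 :=
  homology_class (push_cycle (repr h)).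

Lemma push_homology_class c : push_homology (homology_class c) = homology_class (push_cycle c).
Proof.
have [m E] : exists m : M, cycle_val (repr (homology_class c)) - cycle_val c = d1 m.
  by apply/homology_classP; rewrite homology_class_repr.
by apply/homology_classP; exists (phi m); rewrite /= -linearB E phi_d.
Qed.

Lemma push_homology_linear : linear push_homology.
Proof.
move=> a u v; rewrite -[u]homology_class_repr -[v]homology_class_repr.
have scaleE (d : {linear M -> M}) (b : K) (c : cycles d) :
    b *: homology_class c = homology_class (b *: c) by rewrite homology_classZ.
rewrite scaleE -homology_classD !push_homology_class scaleE -homology_classD.
by congr homology_class; apply/val_inj; rewrite /= linearP.
Qed.

HB.instance Definition _ := GRing.isLinear.Build K (homology d1) (homology d2) _
  push_homology push_homology_linear.

End InvolutionOnHomology.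

(** An involution carrying [d1] to [d2] also carries [d2] to [d1], so the two induced maps on
    homology are mutually inverse. *)
Lemma graded_iso_of_involution (K : comNzRingType) (M : lmodType K) (D : Type)
    (P : D -> M -> Prop) (d1 d2 phi : {linear M -> M}) :
  (forall m, phi (d1 m) = d2 (phi m)) -> involutive phi ->
  (forall deg m, P deg m -> P deg (phi m)) -> graded_homology_iso P d1 d2.
Proof.
move=> phi_d phiK Pphi.
have phi_d' m : phi (d2 m) = d1 (phi m) by rewrite -{1}[m]phiK -phi_d phiK.
have K12 : cancel (push_homology phi_d) (push_homology phi_d').
  move=> h; rewrite -[h]homology_class_repr !push_homology_class.
  by congr homology_class; apply/val_inj; rewrite /= phiK.
have K21 : cancel (push_homology phi_d') (push_homology phi_d).
  move=> h; rewrite -[h]homology_class_repr !push_homology_class.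
  by congr homology_class; apply/val_inj; rewrite /= phiK.
exists (push_homology phi_d : {linear _ -> _}); first by exists (push_homology phi_d').
move=> deg h; split=> -[c Pc cE].
  exists (push_cycle phi_d c); first exact: Pphi.
  by rewrite -push_homology_class cE.
exists (push_cycle phi_d' c); first exact: Pphi.
by rewrite -push_homology_class cE; apply: K12.
Qed.

Section Gauge.
Import GRing.Theory.
Local Open Scope ring_scope.
Variables (n' p' q : nat) (G : grid n' p' q).
Local Notation n := n'.+1.
Local Notation p := p'.+1.
Local Notation generator := (generator n' p').
Variables S1 S2 : sign_function n' p' q.
Variable f : generator -> bool.
Hypothesis gauge : forall x y (r : Rect q x y), rect_counted q x (val r) ->
  S2 r = (-1) ^+ (f x (+) f y) * S1 r.

Section Coefficients.
Variables (K : comNzRingType) (ev : {rmorphism {mpoly int[n]} -> K}).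
Local Notation chain := {ffun generator -> K^o}.

Definition gauge_map (c : chain) : chain := [ffun x => (-1) ^+ f x * c x].

Lemma gauge_map_linear : linear gauge_map.
Proof.
by move=> a u v; apply/ffunP=> x; rewrite !ffunE mulrDr; congr (_ + _); rewrite /GRing.scale /= mulrCA.
Qed.

HB.instance Definition _ := GRing.isLinear.Build K chain chain _ gauge_map gauge_map_linear.

Lemma gauge_coef x y : grid_coef G S2 x y = (-1) ^+ (f x (+) f y) * grid_coef G S1 x y.
Proof.
rewrite /grid_coef mulr_sumr; apply: eq_bigr => r /andP[rc _].
by rewrite (gauge rc) rmorphM /= rmorphXn rmorphN1 mulrA.
Qed.

Lemma gauge_differential c :
  gauge_map (grid_differential G ev S1 c) = grid_differential G ev S2 (gauge_map c).
Proof.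
apply/ffunP=> y; rewrite !ffunE mulr_sumr; apply: eq_bigr => x _.
rewrite !ffunE gauge_coef rmorphM /= rmorphXn rmorphN1 signr_addb.
by case: (f x); case: (f y); rewrite /= ?expr1 ?expr0; ring.
Qed.

(** Rescaling generators by signs conjugates one differential into the other and leaves degrees
    alone; only counted rectangles enter the differentials. *)
Lemma gauge_homology_iso : grid_homology_iso G ev S1 S2.
Proof.
apply: (@graded_iso_of_involution _ _ _ _ _ _ (gauge_map : {linear chain -> chain})).
- exact: gauge_differential.
- by move=> c; apply/ffunP=> x; rewrite !ffunE mulrA -signr_addb addbb mul1r.
move=> deg c Pc x; rewrite ffunE => cx.
have [|e [Q Qh cE] ->] := Pc x; first by move=> c0; apply: cx; rewrite c0 mulr0.
exists e => //; exists ((-1) ^+ f x * Q); last by rewrite cE rmorphM /= rmorphXn rmorphN1.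
by case: (f x); rewrite /= ?expr1 ?expr0 ?mulN1r ?mul1r // rpredN.
Qed.
End Coefficients.
End Gauge.

                                          

(** * Identifying polygons by tile coordinates *)

Section TileMaps.
Import GRing.Theory Num.Theory Order.TTheory.
Local Open Scope ring_scope.
Variables n' p' q : nat.
Local Notation n := n'.+1.
Local Notation p := p'.+1.
Local Notation rectangle := (rectangle n' p').
Local Notation "u =T v" := (same_point n p q u v) (at level 70).
Implicit Types (r : rectangle).

(** A tile with plain natural coordinates and a flag for the rectangle: maps of tiles can then be
    written without carrying bounds and checked by [lia]. *)
Definition raw_tile := (bool * (nat * nat))%type.

Definition tile_rect r1 r2 (s : bool) : rectangle := if s then r2 else r1.

Definition raw_valid r1 r2 (c : raw_tile) : bool :=
  (c.2.1 < rect_width (tile_rect r1 r2 c.1))%N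
  && (c.2.2 < rect_height (tile_rect r1 r2 c.1))%N.

Definition to_raw r1 r2 (t : tile r1 r2) : raw_tile :=
  match t with
  | inl (a, b) => (false, (nat_of_ord a, nat_of_ord b))
  | inr (a, b) => (true, (nat_of_ord a, nat_of_ord b))
  end.

Lemma to_raw_valid r1 r2 (t : tile r1 r2) : raw_valid r1 r2 (to_raw t).
Proof. by case: t => [] [a b]; rewrite /raw_valid /= !ltn_ord. Qed.

Lemma to_raw_inj r1 r2 : injective (@to_raw r1 r2).
Proof.
by move=> [] [a b] [] [a' b'] //= -[/val_inj -> /val_inj ->].
Qed.

Lemma raw_valid_exists r1 r2 c : raw_valid r1 r2 c -> exists t : tile r1 r2, to_raw t = c.
Proof.
case: c => -[] [a b] /andP[/= a1 b1]; first by exists (inr (Ordinal a1, Ordinal b1)).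
by exists (inl (Ordinal a1, Ordinal b1)).
Qed.

Lemma tile_point_raw r1 r2 (t : tile r1 r2) :
  tile_point t = rect_point (tile_rect r1 r2 (to_raw t).1) (to_raw t).2.1 (to_raw t).2.2.
Proof. by case: t => [] [a b]. Qed.

                                                                              
                    
(** The gluing conditions are replaced by booleans; once they are decided, being neighbours is pure
    arithmetic. *)
Definition raw_right r1 r2 (g1 g2 : bool) (c d : raw_tile) : bool :=
  let: (s, (a, b)) := c in let: (s', (a', b')) := d in
  match s, s' with
  | false, false | true, true => (a' == a.+1) && (b' == b)
  | false, true => [&& g1, a.+1 == rect_width r1, a' == 0%N & b' == b]
  | true, false => [&& g2, a.+1 == rect_width r2, a' == 0%N
                     & (rect_height r2 - b == rect_height r1 - b')%N]
  end.

Definition raw_upper r1 r2 (g1 g2 : bool) (c d : raw_tile) : bool :=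
  let: (s, (a, b)) := c in let: (s', (a', b')) := d in
  match s, s' with
  | false, false | true, true => (a' == a) && (b' == b.+1)
  | false, true => [&& g1, b.+1 == rect_height r1, b' == 0%N & a' == a]
  | true, false => [&& g2, b.+1 == rect_height r2, b' == 0%N
                     & (rect_width r2 - a == rect_width r1 - a')%N]
  end.

Lemma right_raw r1 r2 (t u : tile r1 r2) : right_neighbour q t u =
  raw_right r1 r2 (lower_right r1 =T lower_left r2) (upper_right r2 =T upper_left r1)
    (to_raw t) (to_raw u).
Proof. by case: t => [] [a b]; case: u => [] [a' b']. Qed.

Lemma upper_raw r1 r2 (t u : tile r1 r2) : upper_neighbour q t u =
  raw_upper r1 r2 (upper_left r1 =T lower_left r2) (upper_right r2 =T lower_right r1)
    (to_raw t) (to_raw u).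
Proof. by case: t => [] [a b]; case: u => [] [a' b']. Qed.

Lemma same_polygon_build r1 r2 r3 r4 (F F' : raw_tile -> raw_tile) :
  (forall c, raw_valid r1 r2 c -> raw_valid r3 r4 (F c) /\ F' (F c) = c) ->
  (forall c, raw_valid r3 r4 c -> raw_valid r1 r2 (F' c) /\ F (F' c) = c) ->
  (forall c, raw_valid r1 r2 c ->
    rect_point (tile_rect r3 r4 (F c).1) (F c).2.1 (F c).2.2
      =T rect_point (tile_rect r1 r2 c.1) c.2.1 c.2.2) ->
  (forall c d, raw_valid r1 r2 c -> raw_valid r1 r2 d ->
    raw_right r3 r4 (lower_right r3 =T lower_left r4) (upper_right r4 =T upper_left r3) (F c) (F d) =
    raw_right r1 r2 (lower_right r1 =T lower_left r2) (upper_right r2 =T upper_left r1) c d) ->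
  (forall c d, raw_valid r1 r2 c -> raw_valid r1 r2 d ->
    raw_upper r3 r4 (upper_left r3 =T lower_left r4) (upper_right r4 =T lower_right r3) (F c) (F d) =
    raw_upper r1 r2 (upper_left r1 =T lower_left r2) (upper_right r2 =T lower_right r1) c d) ->
  same_polygon q r1 r2 r3 r4.
Proof.
move=> FP F'P Fpt Fr Fu.
have [f fE] : exists f : tile r1 r2 -> tile r3 r4, forall t, to_raw (f t) = F (to_raw t).
  suff /choice[f] : forall t : tile r1 r2, exists t' : tile r3 r4, to_raw t' = F (to_raw t) by exists f.
  by move=> t; apply: raw_valid_exists; have [] := FP _ (to_raw_valid t).
have [g gE] : exists g : tile r3 r4 -> tile r1 r2, forall t, to_raw (g t) = F' (to_raw t).
  suff /choice[g] : forall t : tile r3 r4, exists t' : tile r1 r2, to_raw t' = F' (to_raw t) by exists g.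
  by move=> t; apply: raw_valid_exists; have [] := F'P _ (to_raw_valid t).
exists f; split.
- exists g => t; apply: to_raw_inj; rewrite ?fE ?gE ?fE.
    by have [_ ->] := FP _ (to_raw_valid t).
  by have [_ ->] := F'P _ (to_raw_valid t).
- by move=> t; rewrite !tile_point_raw fE; apply: Fpt; apply: to_raw_valid.
- by move=> t u; rewrite !right_raw !fE; apply: Fr; apply: to_raw_valid.
- by move=> t u; rewrite !upper_raw !fE; apply: Fu; apply: to_raw_valid.
Qed.
End TileMaps.

(** * Construction of rectangles and of complements in annuli *)

Section BuildRectangles.
Import GRing.Theory Num.Theory Order.TTheory.
Local Open Scope ring_scope.
Variables n' p' q : nat.
Local Notation n := n'.+1.
Local Notation p := p'.+1.
Local Notation generator := (generator n' p').
Local Notation rectangle := (rectangle n' p').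
Local Notation point x l := (lattice_point (gen_point x l)).
Local Notation rect_at := (@rect_at n' p' q).
Local Notation "u =T v" := (same_point n p q u v) (at level 70).
Implicit Types (r : rectangle) (x y z : generator) (i j k l : 'I_n).

Lemma rect_at_build x y i j (w h : nat) :
  i != j -> (0 < w < p * n)%N -> (0 < h < p * n)%N ->
  ((position x i)%:Z + w%:Z, (i : nat)%:Z + h%:Z) =T point x j ->
  ((position x i)%:Z + w%:Z, (i : nat)%:Z) =T point y i ->
  ((position x i)%:Z, (i : nat)%:Z + h%:Z) =T point y j ->
  (forall l, l != i -> l != j -> position x l = position y l) ->
  exists r, [/\ rect_at x y r i j, rect_width r = w & rect_height r = h].
Proof.
move=> ij /andP[w0 wp] /andP[h0 hp] ur lr ul oth.
exists ((Ordinal (position_lt x i), i), (Ordinal wp, Ordinal hp)); split=> //.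
by split; rewrite // /lower_right /upper_left /rect_point /lattice_point /= ?addn0.
Qed.

Lemma rect_at_is x y r i j : rect_at x y r i j -> is_rect q x y r.
Proof. by move=> A; apply/is_rectP; exists i, j. Qed.

Lemma rect_at_uniq x y r r' i j : coprime p q ->
  rect_at x y r i j -> rect_at x y r' i j -> r = r'.
Proof.
move=> Hpq A A'; suff W : rect_width r = rect_width r'.
  by have [] := rect_at_det Hpq A A'; rewrite ?W ?eqxx.
apply: (@dvdz_small (p * n)); rewrite ?ltn_ord //.
have E : ((rect_width r)%:Z - (rect_width r')%:Z, 0) =T 0.
  by apply: same_of2 (at_lrE A) (same_sym (at_lrE A')) _; congr pair; rewrite /=; ring.
by have := same_row_point E erefl; rewrite /= subr0.
Qed.

(** The rest of the horizontal annulus swept out by [r] leads back from [y] to [x] on the same rows.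
    For [vertical_complement] the two rows are exchanged. *)
Lemma horizontal_complement x y r i j : rect_at x y r i j ->
  exists r', rect_at y x r' i j /\ horizontal_annulus q r r'.
Proof.
move=> A; have wlt : (rect_width r < p * n)%N := ltn_ord _.
have period := horizontal_period n p q.
have [|||||||r' [A' w' h']] := @rect_at_build y x i j (p * n - rect_width r) (rect_height r).
- exact: at_neq A.
- by rewrite subn_gt0 wlt /= ltn_subrL (at_width A).
- by rewrite (at_height A) ltn_ord.
- apply: same_of3 (same_sym (at_lrE A)) (at_ulE A) period _.
  rewrite !pointE -subzn ?(ltnW wlt) //; congr pair; rewrite /=; ring.
- apply: same_of2 (same_sym (at_lrE A)) period _.
  by rewrite !pointE -subzn ?(ltnW wlt) //; congr pair; rewrite /=; ring.
- apply: same_of2 (same_sym (at_lrE A)) (at_urE A) _.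
  by rewrite !pointE; congr pair; rewrite /=; ring.
- by move=> l li lj; rewrite (at_other A).
exists r'; split=> //; rewrite /horizontal_annulus w' h' subnKC ?(ltnW wlt) // !eqxx !andbT.
exact: same_trans (at_lr A) (same_sym (at_ll A')).
Qed.

Lemma vertical_complement x y r i j : rect_at x y r i j ->
  exists r', rect_at y x r' j i /\ vertical_annulus q r r'.
Proof.
move=> A; have hlt : (rect_height r < p * n)%N := ltn_ord _.
have period := vertical_period n p q.
have [|||||||r' [A' w' h']] := @rect_at_build y x j i (rect_width r) (p * n - rect_height r).
- by rewrite eq_sym (at_neq A).
- by rewrite (at_width A) ltn_ord.
- by rewrite subn_gt0 hlt /= ltn_subrL (at_height A).
- apply: same_of3 (same_sym (at_ulE A)) (at_lrE A) period _.
  by rewrite !pointE -subzn ?(ltnW hlt) //; congr pair; rewrite /=; ring.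
- apply: same_of2 (same_sym (at_ulE A)) (at_urE A) _.
  by rewrite !pointE; congr pair; rewrite /=; ring.
- apply: same_of2 (same_sym (at_ulE A)) period _.
  by rewrite !pointE -subzn ?(ltnW hlt) //; congr pair; rewrite /=; ring.
- by move=> l lj li; rewrite (at_other A).
exists r'; split=> //; rewrite /vertical_annulus w' h' subnKC ?(ltnW hlt) // !eqxx !andbT.
exact: same_trans (at_ul A) (same_sym (at_ll A')).
Qed.
End BuildRectangles.

(** * The ratio of two sign assignments *)

Section Ratio.
Import GRing.Theory Num.Theory Order.TTheory.
Local Open Scope ring_scope.
Variables n' p' q : nat.
Local Notation n := n'.+1.
Local Notation p := p'.+1.
Local Notation generator := (generator n' p').
Local Notation rectangle := (rectangle n' p').
Local Notation point x l := (lattice_point (gen_point x l)).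
Local Notation rect_at := (@rect_at n' p' q).
Local Notation "u =T v" := (same_point n p q u v) (at level 70).
Implicit Types (r : rectangle) (x y z : generator) (i j k l : 'I_n).
Hypothesis Hpq : coprime p q.
Variables S1 S2 : sign_function n' p' q.
Hypotheses (H1 : sign_assignment S1) (H2 : sign_assignment S2).

(** Defined on raw rectangles, with junk value [false] outside [Rect x y]. *)
Definition ratio x y r : bool :=
  if insub r is Some R then S1 (R : Rect q x y) != S2 (R : Rect q x y) else false.

Lemma ratio_val x y (R : Rect q x y) : ratio x y (val R) = (S1 R != S2 R).
Proof. by rewrite /ratio valK. Qed.

Lemma ratio_sign x y (R : Rect q x y) : S2 R = (-1) ^+ ratio x y (val R) * S1 R.
Proof.
rewrite ratio_val; case: (sign_assignment_pm1 H1 R) => ->;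
by case: (sign_assignment_pm1 H2 R) => ->; rewrite ?eqxx ?expr1 ?expr0.
Qed.

Lemma ratio_annulus x y z (R : Rect q x y) (R' : Rect q y z) :
  S1 R * S1 R' = S2 R * S2 R' -> ratio x y (val R) = ratio y z (val R').
Proof.
rewrite !ratio_val; case: (sign_assignment_pm1 H1 R) => ->; case: (sign_assignment_pm1 H2 R) => ->;
by case: (sign_assignment_pm1 H1 R') => ->; case: (sign_assignment_pm1 H2 R') => ->.
Qed.

Lemma ratio_horizontal x y z r r' : is_rect q x y r -> is_rect q y z r' ->
  horizontal_annulus q r r' -> ratio x y r = ratio y z r'.
Proof.
move=> xyr yzr' an; apply: (@ratio_annulus x y z (Sub r xyr) (Sub r' yzr')).
by rewrite (sign_assignment_horizontal H1) ?(sign_assignment_horizontal H2) // !SubK.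
Qed.

Lemma ratio_vertical x y z r r' : is_rect q x y r -> is_rect q y z r' ->
  vertical_annulus q r r' -> ratio x y r = ratio y z r'.
Proof.
move=> xyr yzr' an; apply: (@ratio_annulus x y z (Sub r xyr) (Sub r' yzr')).
by rewrite (sign_assignment_vertical H1) ?(sign_assignment_vertical H2) // !SubK.
Qed.

(** Both assignments have the same product on an annulus, so the ratio does not change under
    complements. A horizontal complement followed by a vertical one is again a rectangle from [x] to
    [y], with rows exchanged. *)
Lemma ratio_swap x y r r' i j : rect_at x y r i j -> rect_at x y r' j i ->
  ratio x y r = ratio x y r'.
Proof.
move=> A A'; have [h [B an]] := horizontal_complement A.
rewrite (ratio_horizontal (rect_at_is A) (rect_at_is B) an).
have [v [C an']] := vertical_complement B.
by rewrite (ratio_vertical (rect_at_is B) (rect_at_is C) an') (rect_at_uniq Hpq C A').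
Qed.

(** The permutations of [x] and [y] determine the pair of rows, so at most two rectangles join [x]
    to [y], one for each choice of bottom row. *)
Lemma ratio_const x y r r' : is_rect q x y r -> is_rect q x y r' ->
  ratio x y r = ratio x y r'.
Proof.
move=> /is_rectP[i [j A]] /is_rectP[k [l A']].
have /tperm_same_pair : tperm k l = tperm i j.
  by apply: (mulIg x.1); rewrite -(rect_at_perm A) -(rect_at_perm A').
move=> /(_ (at_neq A'))/same_pairP[] [Ek El]; subst k l.
  by rewrite (rect_at_uniq Hpq A A').
exact: ratio_swap A A'.
Qed.

Definition edge_ratio x y : bool := [exists r, is_rect q x y r && ratio x y r].

Lemma edge_ratioE x y r : is_rect q x y r -> ratio x y r = edge_ratio x y.
Proof.
move=> xyr; apply/idP/existsP => [rr|[r' /andP[xyr' rr']]]; first by exists r; rewrite xyr.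
by rewrite (ratio_const xyr xyr').
Qed.

Lemma edge_ratio_sym x y : edge_ratio x y = edge_ratio y x.
Proof.
suff le u v : edge_ratio u v -> edge_ratio v u by apply/idP/idP; apply: le.
case/existsP=> r /andP[uvr]; have /is_rectP[i [j A]] := uvr.
have [h [B an]] := horizontal_complement A.
by rewrite (ratio_horizontal uvr (rect_at_is B) an) (edge_ratioE (rect_at_is B)).
Qed.

Lemma edge_ratio_sign x y (R : Rect q x y) : S2 R = (-1) ^+ edge_ratio x y * S1 R.
Proof. by rewrite ratio_sign (edge_ratioE (valP R)). Qed.

(** The minus signs of the polygon axiom cancel in the ratio, leaving a cocycle condition. *)
Lemma edge_ratio_polygon x y z y' r1 r2 r3 r4 :
  is_rect q x y r1 -> is_rect q y z r2 -> is_rect q x y' r3 -> is_rect q y' z r4 ->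
  same_polygon q r1 r2 r3 r4 -> (r1, r2) != (r3, r4) ->
  edge_ratio x y (+) edge_ratio y z = edge_ratio x y' (+) edge_ratio y' z.
Proof.
move=> A1 A2 A3 A4 P ne.
rewrite -(edge_ratioE A1) -(edge_ratioE A2) -(edge_ratioE A3) -(edge_ratioE A4).
have E1 := @sign_assignment_polygon _ _ _ _ H1 _ _ _ _ (Sub r1 A1) (Sub r2 A2) (Sub r3 A3) (Sub r4 A4).
have E2 := @sign_assignment_polygon _ _ _ _ H2 _ _ _ _ (Sub r1 A1) (Sub r2 A2) (Sub r3 A3) (Sub r4 A4).
move: E1 E2; rewrite !SubK => /(_ P ne) E1 /(_ P ne).
rewrite !ratio_sign !SubK.
case: (sign_assignment_pm1 H1 (Sub r1 A1 : Rect q x y)) E1 => ->;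
case: (sign_assignment_pm1 H1 (Sub r2 A2 : Rect q y z)) => ->;
case: (sign_assignment_pm1 H1 (Sub r3 A3 : Rect q x y')) => ->;
case: (sign_assignment_pm1 H1 (Sub r4 A4 : Rect q y' z)) => -> //= _;
by case: (ratio x y r1); case: (ratio y z r2); case: (ratio x y' r3); case: (ratio y' z r4).
Qed.
End Ratio.

(** * Reflections acting on generators *)

Section Action.
Import GRing.Theory Num.Theory Order.TTheory.
Local Open Scope ring_scope.
Variables n' p' q : nat.
Local Notation n := n'.+1.
Local Notation p := p'.+1.
Local Notation generator := (generator n' p').
Local Notation rectangle := (rectangle n' p').
Local Notation point x l := (lattice_point (gen_point x l)).
Local Notation rect_at := (@rect_at n' p' q).
Local Notation "u =T v" := (same_point n p q u v) (at level 70).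
Implicit Types (r : rectangle) (x y z : generator) (i j k l : 'I_n) (a b : 'I_p).

                                                                 
(** The reflections of the complex reflection group G(p,p,n), twisted by [a] in Z/p. Every rectangle
    on the rows [i], [j] acts in this way ([rect_at_reflect]). *)
Definition reflect_gen i j a x : generator :=
  ((tperm i j * x.1)%g,
   [ffun l => if l == i then x.2 j + a else if l == j then x.2 i - a else x.2 l]).

Lemma neq_both (T : eqType) (u v : T) : u != v -> ((u == v) = false) * ((v == u) = false).
Proof. by move=> /negPf uv; rewrite (eq_sym v) uv. Qed.

Lemma reflect_genC i j a x : i != j -> reflect_gen i j a x = reflect_gen j i (- a) x.
Proof.
move=> ij; congr pair; first by rewrite tpermC.
apply/ffunP=> l; rewrite !ffunE opprK; case: eqVneq => [->|//].
by rewrite (negPf ij).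
Qed.

Lemma reflect_genK i j a x : i != j -> reflect_gen i j a (reflect_gen i j a x) = x.
Proof.
move=> ij; rewrite [RHS]surjective_pairing; congr pair.
  by rewrite mulgA tperm2 mul1g.
apply/ffunP=> l; rewrite !ffunE !eqxx (eq_sym j) (negPf ij).
by case: eqVneq => [->|li]; [rewrite subrK|case: eqVneq => [->|//]; rewrite addrK].
Qed.

Lemma reflect_gen_far i j k l a b x : uniq [:: i; j; k; l] ->
  reflect_gen k l b (reflect_gen i j a x) = reflect_gen i j a (reflect_gen k l b x).
Proof.
rewrite /= !inE !negb_or !andbT => /and3P[/and3P[ij ik il] /andP[jk jl] kl].
congr pair; first by rewrite !mulgA [(tperm k l * _)%g]conjgC tpermJ !tpermD // eq_sym.
have nE := (neq_both ik, neq_both il, neq_both jk, neq_both jl).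
apply/ffunP=> m; rewrite !ffunE !nE.
case: (eqVneq m i) => [->|mi]; first by rewrite !nE.
by case: (eqVneq m j) => [->|mj]; first by rewrite !nE.
Qed.

Lemma reflect_gen_conj i j k a b x : uniq [:: i; j; k] ->
  reflect_gen i j a (reflect_gen j k b (reflect_gen i j a x)) = reflect_gen i k (a + b) x.
Proof.
move=> /uniq3P[ij ik jk]; congr pair.
  rewrite !mulgA; congr (_ * _)%g.
  by rewrite -mulgA [(tperm j k * _)%g]conjgC mulgA tperm2 mul1g tpermJ tpermR tpermD.
have nE := (neq_both ij, neq_both ik, neq_both jk).
apply/ffunP=> m; rewrite !ffunE !eqxx !nE.
case: (eqVneq m i) => [_|mi]; first by rewrite addrAC addrA.
case: (eqVneq m j) => [mj|mj]; first by rewrite mj !nE addrK.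
by case: (eqVneq m k) => [_|mk]; rewrite // opprD addrA.
Qed.

Lemma position_reflect i j a x :
  ((p * n)%N %| (position (reflect_gen i j a x) i)%:Z - ((position x j)%:Z + (a * n)%N%:Z))%Z.
Proof.
rewrite /position ffunE eqxx permM tpermL -eqz_mod_dvd -PoszD !modz_nat eqz_nat.
rewrite addnAC -mulnDl -[X in _ == _ %[mod X]]/(p * n)%N.
have -> : (x.2 j + a)%R = ((x.2 j + a) %% p)%N :> nat by [].
by rewrite muln_modl modnDml.
Qed.
End Action.

(** * Every reflection comes from a rectangle *)

Section Existence.
Import GRing.Theory Num.Theory Order.TTheory.
Local Open Scope ring_scope.
Variables n' p' q : nat.
Local Notation n := n'.+1.
Local Notation p := p'.+1.
Local Notation generator := (generator n' p').
Local Notation rectangle := (rectangle n' p').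
Local Notation point x l := (lattice_point (gen_point x l)).
Local Notation rect_at := (@rect_at n' p' q).
Local Notation "u =T v" := (same_point n p q u v) (at level 70).
Implicit Types (r : rectangle) (x y z : generator) (i j k l : 'I_n) (a b : 'I_p).
                                                                          
                                                                     
(** The heights that realise [reflect_gen i j a]: going up by [h] from row [i] crosses the
    identification of top and bottom [(i + h) %/ n] times, and each crossing shifts by qn, that is
    by q in the p-coordinate. *)
Definition height_of i j a (h : nat) : Prop :=
  [/\ (0 < h < p * n)%N, ((i + h) %% n = j)%N & inZp (q * ((i + h) %/ n)) = a].

Lemma height_of_compl i j a h : height_of i j a h -> height_of j i (- a) (p * n - h).
Proof.
case=> /andP[h0 hp] ij ha; split; first by rewrite subn_gt0 hp ltn_subrL h0.
  by rewrite -ij modnDml -addnA subnKC ?(ltnW hp) // addnC modnMDl modn_small.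
have tp : ((i + h) %/ n <= p)%N.
  have := ltn_ord i; have := divn_eq (i + h) n; rewrite ij; have := ltn_ord j.
  move: ((i + h) %/ n)%N => t; nia.
have -> : ((j + (p * n - h)) %/ n = p - (i + h) %/ n)%N.
  have E : (j + (p * n - h) = (p - (i + h) %/ n) * n + i)%N.
    by have := divn_eq (i + h) n; rewrite ij mulnBl; nia.
  by rewrite E divnMDl // (divn_small (ltn_ord i)) addn0.
rewrite -ha; apply/eqP; rewrite -subr_eq0 opprK; apply/eqP/val_inj.
by rewrite /= modnDm -mulnDr subnK // modnMl.
Qed.

Lemma height_of_add i j k a b h1 h2 : height_of i j a h1 -> height_of j k b h2 ->
  (h1 + h2 < p * n)%N -> height_of i k (a + b) (h1 + h2).
Proof.
case=> /andP[h1_0 h1p] ij ha [/andP[h2_0 h2p] jk hb] lt; split.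
- by rewrite lt addn_gt0 h1_0.
- by rewrite addnA -modnDml ij.
have -> : (i + (h1 + h2) = (i + h1) %/ n * n + (j + h2))%N.
  by have := divn_eq (i + h1) n; rewrite ij; lia.
by rewrite divnMDl // mulnDr -ha -hb; apply/val_inj; rewrite /= modnDm.
Qed.

Lemma in_latticeI (u : int * int) (t : int) :
  u.2 = t * n%:Z -> ((p * n)%N %| u.1 - q%:Z * u.2)%Z -> in_lattice n p q u.
Proof. by move=> E D; rewrite /in_lattice D andbT E dvdz_mull. Qed.

(** The height places the upper corners; the width is the distance from [x] to its reflection along
    row [i], nonzero because the two points lie on different columns. *)
Lemma rect_exists x i j a h : i != j -> height_of i j a h ->
  exists r, rect_at x (reflect_gen i j a x) r i j /\ rect_height r = h.
Proof.
move=> ij [hp ijh ha]; set y := reflect_gen i j a x; set N := (p * n)%N.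
set t := ((i + h) %/ n)%N in ha.
have hE : (i : nat)%:Z + h%:Z = t%:Z * n%:Z + (j : nat)%:Z.
  by have := divn_eq (i + h) n; rewrite ijh -/t; lia.
have aE : (N %| (a * n)%N%:Z - q%:Z * (t%:Z * n%:Z))%Z.
  rewrite -ha /= -eqz_mod_dvd -!PoszM !modz_nat eqz_nat /N muln_modl modn_mod.
  by rewrite mulnA.
have yi := position_reflect i j a x; rewrite -/y -/N in yi.
have yj := position_reflect j i (- a) x; rewrite -reflect_genC // -/y -/N in yj.
have aN : (N %| ((- a : 'I_p) * n)%N%:Z + (a * n)%N%:Z)%Z.
  rewrite -PoszD dvdzE /= /N -mulnDl dvdn_pmul2r // /dvdn modnDml subnK ?modnn //.
  exact: ltnW.
have Nlt l (g : generator) : (position g l < N)%N := position_lt g l.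
have N0 : (0 < N)%N by rewrite muln_gt0.
(* Subtracting from [N] first keeps the natural subtraction from being truncated. *)
set w := ((position y i + (N - position x i)) %% N)%N.
have wE : (N %| w%:Z - ((position y i)%:Z - (position x i)%:Z))%Z.
  rewrite (_ : _ - _ = w%:Z - (position y i + (N - position x i))%N%:Z + N%:Z).
    by rewrite rpredD ?dvdzz // -eqz_mod_dvd !modz_nat modn_mod.
  by rewrite PoszD -subzn ?(ltnW (Nlt _ _)) //; ring.
have wlt : (w < N)%N by rewrite ltn_pmod.
have w0 : (0 < w)%N.
  rewrite lt0n; apply/eqP=> w0; move: wE; rewrite w0 sub0r opprB => D.
  have E := dvdz_small (Nlt _ _) (Nlt _ _) D.
  have := position_mod x i; rewrite E position_mod permM tpermL => /val_inj/perm_inj/eqP.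
  by rewrite eq_sym (negPf ij).
have [||||||| r [A wr hr]] := @rect_at_build n' p' q x y i j w h; last by exists r.
- by [].
- by rewrite w0.
- by [].
- rewrite pointE; apply: (in_latticeI (t := t%:Z)) => /=; first by rewrite hE addrK.
  rewrite hE addrK.
  set A := (X in (_ %| X)%Z); have -> : A = (w%:Z - ((position y i)%:Z - (position x i)%:Z)) +
    ((position y i)%:Z - ((position x j)%:Z + (a * n)%N%:Z)) + ((a * n)%N%:Z - q%:Z * (t%:Z * n%:Z)).
    by rewrite /A; ring.
  exact: rpredD (rpredD wE yi) aE.
- rewrite pointE; apply: (in_latticeI (t := 0)) => /=; first by rewrite subrr mul0r.
  rewrite subrr mulr0 subr0.
  set A := (X in (_ %| X)%Z); have -> // : A = w%:Z - ((position y i)%:Z - (position x i)%:Z).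
  by rewrite /A; ring.
- rewrite pointE; apply: (in_latticeI (t := t%:Z)) => /=; first by rewrite hE addrK.
  rewrite hE addrK.
  set A := (X in (_ %| X)%Z); have -> : A = ((a * n)%N%:Z - q%:Z * (t%:Z * n%:Z)) -
    ((position y j)%:Z - ((position x i)%:Z + ((- a : 'I_p) * n)%N%:Z)) -
    (((- a : 'I_p) * n)%N%:Z + (a * n)%N%:Z).
    by rewrite /A; ring.
  exact: rpredB (rpredB aE yj) aN.
move=> l li lj; rewrite /position ffunE (negPf li) (negPf lj) permM tpermD // eq_sym //.
Qed.

Hypothesis Hpq : coprime p q.

(** As q is a unit modulo p, some number t of crossings produces [a]. The height is tn + j - i, with
    t = p instead of 0 when j < i. *)
Lemma height_exists i j a : i != j -> exists h, height_of i j a h.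
Proof.
move=> ij.
have [t tp ta] : exists2 t, (t < p)%N & (q * t = a %[mod p])%N.
  have /dvdnP[u uE] : (q %| chinese p q a 0)%N by rewrite /dvdn (chinese_modr Hpq) mod0n.
  exists (u %% p)%N; first exact: ltn_pmod.
  by rewrite modnMmr mulnC -uE (chinese_modl Hpq).
have ha s : (q * s = a %[mod p])%N -> inZp (q * s) = a.
  by move=> E; apply/val_inj; rewrite /= E modn_small.
have [lt_i lt_j] := (ltn_ord i, ltn_ord j).
have build (s h : nat) : (i + h = s * n + j)%N -> (0 < h < p * n)%N -> (q * s = a %[mod p])%N ->
    height_of i j a h.
  move=> E hp sa; split=> //; rewrite E; first by rewrite modnMDl modn_small.
  by rewrite divnMDl // divn_small ?addn0 ?ha.
case: (ltngtP i j) => [lt|gt|/val_inj E]; last by rewrite E eqxx in ij.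
  by exists (t * n + (j - i))%N; apply: (build t) => //; nia.
case: (posnP t) => t0.
  exists (p * n + j - i)%N; apply: (build p) => //; try nia.
  by rewrite modnMl -ta t0 muln0 mod0n.
by exists (t * n + j - i)%N; apply: (build t) => //; nia.
Qed.

End Existence.

(** * Relations from L-shaped polygons and disjoint pairs *)

Ltac case_ifs := repeat match goal with
  | |- context [if ?b then _ else _] =>
    lazymatch b with
    | context [if _ then _ else _] => fail
    | _ => case: (boolP b) => ? /=
    end
  end.

Ltac tile_arith := first [lia | congr (_, (_, _)); lia | exfalso; lia].

Section Relations.
Import GRing.Theory Num.Theory Order.TTheory.
Local Open Scope ring_scope.
Variables n' p' q : nat.
Local Notation n := n'.+1.
Local Notation p := p'.+1.
Local Notation generator := (generator n' p').
Local Notation rectangle := (rectangle n' p').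
Local Notation point x l := (lattice_point (gen_point x l)).
Local Notation rect_at := (@rect_at n' p' q).
Local Notation "u =T v" := (same_point n p q u v) (at level 70).
Implicit Types (r : rectangle) (x y z : generator) (i j k l : 'I_n) (a b : 'I_p).

Lemma corners_neqF x i j (u v : int * int) :
  u =T point x i -> v =T point x j -> i != j -> (u =T v) = false.
Proof. by move=> ui vj ij; apply/negbTE; apply: corners_neq ui vj ij. Qed.

Lemma corners_eq x i (u v : int * int) : u =T point x i -> v =T point x i -> (u =T v) = true.
Proof. by move=> ui vi; apply: same_trans ui (same_sym vi). Qed.

                                                                             
                                                                                
                
(** An L-shape: [r2] stands on the left part of the wider [r1]. Extending the right edge of [r2]
    downwards cuts it into the tall rectangle [r3] and the rest [r4] of [r1]. *)
Lemma same_polygon_narrow x y z y' r1 r2 r3 r4 i j k :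
  i != j -> j != k -> i != k ->
  rect_at x y r1 i j -> rect_at y z r2 j k -> rect_at x y' r3 i k -> rect_at y' z r4 i j ->
  (rect_width r2 < rect_width r1)%N -> rect_width r3 = rect_width r2 ->
  rect_height r3 = (rect_height r1 + rect_height r2)%N ->
  rect_width r4 = (rect_width r1 - rect_width r2)%N -> rect_height r4 = rect_height r1 ->
  same_polygon q r1 r2 r3 r4.
Proof.
move=> ij jk ik A1 A2 A3 A4 lt w3 h3 w4 h4.
have [ji kj ki] : [/\ j != i, k != j & k != i] by rewrite !(eq_sym k) (eq_sym j).
set w := rect_width r2 in lt w3 w4 *.
pose F (c : raw_tile) : raw_tile := let: (s, (a, b)) := c in
  if s then (false, (a, b + rect_height r1)%N)
  else if (a < w)%N then (false, (a, b)) else (true, (a - w, b)%N).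
pose F' (c : raw_tile) : raw_tile := let: (s, (a, b)) := c in
  if s then (false, (a + w, b)%N)
  else if (b < rect_height r1)%N then (false, (a, b)) else (true, (a, b - rect_height r1)%N).
apply: (same_polygon_build (F := F) (F' := F')).
- move=> [[] [a b]]; rewrite /raw_valid /F /F' /= => /andP[va vb];
    case_ifs; split; tile_arith.
- move=> [[] [a b]]; rewrite /raw_valid /F /F' /= => /andP[va vb];
    case_ifs; split; tile_arith.
- move=> [[] [a b]]; rewrite /raw_valid /F /= => /andP[va vb].
    rewrite (rect_pointE A3) (rect_pointE A2).
    apply: same_of1 (at_ulE A1) _; rewrite pointE; congr pair; rewrite /=; lia.
  case: ltnP => aw /=; rewrite (rect_pointE A1).
    by rewrite (rect_pointE A3); apply: same_refl.
  rewrite (rect_pointE A4); apply: same_of1 (same_sym (at_lrE A3)) _.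
  rewrite pointE w3 -subzn //; congr pair; rewrite /=; lia.
- rewrite (corners_neqF (at_lr A1) (at_ll A2) ij) (corners_neqF (at_ur A2) (at_ul A1) kj).
  rewrite (corners_eq (at_lr A3) (at_ll A4)) (corners_neqF (at_ur A4) (at_ul A3) jk).
  move=> [[] [a b]] [[] [a' b']]; rewrite /raw_valid /F /= => /andP[va vb] /andP[va' vb'];
    case_ifs; lia.
rewrite (corners_eq (at_ul A1) (at_ll A2)) (corners_neqF (at_ur A2) (at_lr A1) ki).
rewrite (corners_neqF (at_ul A3) (at_ll A4) ki) (corners_neqF (at_ur A4) (at_lr A3) ji).
move=> [[] [a b]] [[] [a' b']]; rewrite /raw_valid /F /= => /andP[va vb] /andP[va' vb'];
  case_ifs; lia.
Qed.

(** The other L-shape: [r2] overhangs [r1] on the right. Extending the right edge of [r1] upwards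
    cuts off the overhang [r3] and leaves the tall rectangle [r4]. *)
Lemma same_polygon_wide x y z y' r1 r2 r3 r4 i j k :
  i != j -> j != k -> i != k ->
  rect_at x y r1 i j -> rect_at y z r2 j k -> rect_at x y' r3 j k -> rect_at y' z r4 i k ->
  (rect_width r1 < rect_width r2)%N ->
  rect_width r3 = (rect_width r2 - rect_width r1)%N -> rect_height r3 = rect_height r2 ->
  rect_width r4 = rect_width r1 -> rect_height r4 = (rect_height r1 + rect_height r2)%N ->
  same_polygon q r1 r2 r3 r4.
Proof.
move=> ij jk ik A1 A2 A3 A4 lt w3 h3 w4 h4.
have [ji kj ki] : [/\ j != i, k != j & k != i] by rewrite !(eq_sym k) (eq_sym j).
set w := rect_width r1 in lt w3 w4 *.
pose F (c : raw_tile) : raw_tile := let: (s, (a, b)) := c in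
  if s then if (a < w)%N then (true, (a, b + rect_height r1)%N) else (false, (a - w, b)%N)
  else (true, (a, b)).
pose F' (c : raw_tile) : raw_tile := let: (s, (a, b)) := c in
  if s then if (b < rect_height r1)%N then (false, (a, b)) else (true, (a, b - rect_height r1)%N)
  else (true, (a + w, b)%N).
apply: (same_polygon_build (F := F) (F' := F')).
- move=> [[] [a b]]; rewrite /raw_valid /F /F' /= => /andP[va vb];
    case_ifs; split; tile_arith.
- move=> [[] [a b]]; rewrite /raw_valid /F /F' /= => /andP[va vb];
    case_ifs; split; tile_arith.
- move=> [[] [a b]]; rewrite /raw_valid /F /= => /andP[va vb]; last first.
    rewrite (rect_pointE A1) (rect_pointE A4).
    have x_i : position y' i = position x i by rewrite (at_other A3).
    by rewrite x_i; apply: same_refl.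
  have x_i : position y' i = position x i by rewrite (at_other A3).
  case: ltnP => aw /=; rewrite (rect_pointE A2).
    rewrite (rect_pointE A4) x_i; apply: same_of1 (at_ulE A1) _; rewrite pointE; congr pair; rewrite /=; lia.
  rewrite (rect_pointE A3); apply: same_of2 (same_sym (at_urE A1)) (at_ulE A1) _.
  rewrite !pointE -subzn //; congr pair; rewrite /=; lia.
- rewrite (corners_neqF (at_lr A1) (at_ll A2) ij) (corners_neqF (at_ur A2) (at_ul A1) kj).
  rewrite (corners_neqF (at_lr A3) (at_ll A4) ji) (corners_eq (at_ur A4) (at_ul A3)).
  move=> [[] [a b]] [[] [a' b']]; rewrite /raw_valid /F /= => /andP[va vb] /andP[va' vb'];
    case_ifs; lia.
rewrite (corners_eq (at_ul A1) (at_ll A2)) (corners_neqF (at_ur A2) (at_lr A1) ki).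
rewrite (corners_neqF (at_ul A3) (at_ll A4) ki) (corners_neqF (at_ur A4) (at_lr A3) kj).
move=> [[] [a b]] [[] [a' b']]; rewrite /raw_valid /F /= => /andP[va vb] /andP[va' vb'];
  case_ifs; lia.
Qed.

Lemma same_polygon_disjoint x y z y' r1 r2 i j k l :
  uniq [:: i; j; k; l] ->
  rect_at x y r1 i j -> rect_at y z r2 k l -> rect_at x y' r2 k l -> rect_at y' z r1 i j ->
  same_polygon q r1 r2 r2 r1.
Proof.
rewrite /= !inE !negb_or !andbT => /and3P[/and3P[ij ik il] /andP[jk jl] kl] A1 A2 A3 A4.
have [ki li kj lj] : [/\ k != i, l != i, k != j & l != j] by rewrite !(eq_sym k) !(eq_sym l).
pose F (c : raw_tile) : raw_tile := (~~ c.1, c.2).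
apply: (same_polygon_build (F := F) (F' := F)).
- by move=> [[] [a b]].
- by move=> [[] [a b]].
- by move=> [[] [a b]] _; apply: same_refl.
- rewrite (corners_neqF (at_lr A1) (at_ll A2)) // (corners_neqF (at_ur A2) (at_ul A1)) //.
  rewrite (corners_neqF (at_lr A3) (at_ll A4)) // (corners_neqF (at_ur A4) (at_ul A3)) //.
  by move=> [[] [a b]] [[] [a' b']].
rewrite (corners_neqF (at_ul A1) (at_ll A2)) // (corners_neqF (at_ur A2) (at_lr A1)) //.
rewrite (corners_neqF (at_ul A3) (at_ll A4)) // (corners_neqF (at_ur A4) (at_lr A3)) //.
by move=> [[] [a b]] [[] [a' b']].
Qed.

Lemma position_reflect_other i j a x l : l != i -> l != j ->
  position (reflect_gen i j a x) l = position x l.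
Proof.
by move=> li lj; rewrite /position ffunE (negPf li) (negPf lj) permM tpermD // eq_sym.
Qed.

Lemma rect_at_transfer x y x2 y2 r i j : rect_at x y r i j ->
  position x i = position x2 i -> position x j = position x2 j ->
  position y i = position y2 i -> position y j = position y2 j ->
  (forall l, l != i -> l != j -> position x2 l = position y2 l) -> rect_at x2 y2 r i j.
Proof.
move=> A Exi Exj Eyi Eyj oth; have [ij w0 h0 li bi ur lr ul _] := A.
by split; rewrite ?pointE -?Exi -?Exj -?Eyi -?Eyj.
Qed.

Hypothesis Hpq : coprime p q.
Variables S1 S2 : sign_function n' p' q.
Hypotheses (H1 : sign_assignment S1) (H2 : sign_assignment S2).
Local Notation edge := (edge_ratio S1 S2).

(** The two rectangles share no corner, so the same two rectangles can be used in either order. *)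
Lemma edge_far x i j k l a b : uniq [:: i; j; k; l] ->
  edge x (reflect_gen i j a x) (+) edge (reflect_gen i j a x) (reflect_gen k l b (reflect_gen i j a x)) =
  edge x (reflect_gen k l b x) (+) edge (reflect_gen k l b x) (reflect_gen k l b (reflect_gen i j a x)).
Proof.
move=> u4; have := u4.
rewrite /= !inE !negb_or !andbT => /and3P[/and3P[ij ik il] /andP[jk jl] kl].
have [ki li kj lj] : [/\ k != i, l != i, k != j & l != j] by rewrite !(eq_sym k) !(eq_sym l).
set y := reflect_gen i j a x; set y' := reflect_gen k l b x.
set z := reflect_gen k l b y; have zE : z = reflect_gen i j a y' by apply: reflect_gen_far.
have [h hP] := height_exists Hpq a ij; have [h' h'P] := height_exists Hpq b kl.
have [r1 [A1 _]] := rect_exists x ij hP; have [r2 [A3 _]] := rect_exists x kl h'P.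
rewrite -/y -/y' in A1 A3.
have oz m : m != k -> m != l -> position z m = position y m.
  exact: position_reflect_other.
have oz' m : m != i -> m != j -> position z m = position y' m.
  by rewrite zE; apply: position_reflect_other.
have A2 : rect_at y z r2 k l.
  by apply: (rect_at_transfer A3); rewrite ?(at_other A1) ?oz' // => m mk ml; rewrite oz.
have A4 : rect_at y' z r1 i j.
  by apply: (rect_at_transfer A1); rewrite ?(at_other A3) ?oz // => m mi mj; rewrite oz'.
apply: (edge_ratio_polygon Hpq H1 H2) (rect_at_is A1) (rect_at_is A2) (rect_at_is A3) (rect_at_is A4) _ _.
  exact: same_polygon_disjoint u4 A1 A2 A3 A4.
apply: contra ik => /eqP[E _]; rewrite -(at_bottom A1) E (at_bottom A3); exact: eqxx.
Qed.

Lemma nat_of_same (w w' : nat) : (w < p * n)%N -> (w' < p * n)%N ->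
  (w%:Z, 0) =T (w'%:Z, 0) -> w = w'.
Proof.
by move=> wp w'p /same_row_point => /(_ erefl); apply: dvdz_small.
Qed.

Definition edge2 x i j a k l b : bool :=
  edge x (reflect_gen i j a x)
  (+) edge (reflect_gen i j a x) (reflect_gen k l b (reflect_gen i j a x)).

Lemma reflect_gen_conj2 i j k a b x : uniq [:: i; j; k] ->
  reflect_gen j k b (reflect_gen i j a (reflect_gen j k b x)) = reflect_gen i k (a + b) x.
Proof.
move=> u3; have /uniq3P[ij ik jk] := u3.
rewrite !(reflect_genC _ _ jk) (reflect_genC _ _ ij) (reflect_genC _ _ ik).
by rewrite reflect_gen_conj ?opprD 1?addrC //; apply/uniq3P; rewrite !(eq_sym k) (eq_sym j i).
Qed.

(** Stacking the two rectangles gives an L-shape, and recutting it gives a relation. Which of the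
    two relations results depends on which rectangle is wider. *)
Lemma edge_half x i j k a b h1 h2 : uniq [:: i; j; k] ->
  height_of q i j a h1 -> height_of q j k b h2 -> (h1 + h2 < p * n)%N ->
  edge2 x i j a j k b = edge2 x i k (a + b) i j a \/
  edge2 x i j a j k b = edge2 x j k b i k (a + b).
Proof.
move=> u3 h1P h2P lt; have /uniq3P[ij ik jk] := u3.
have h3P := height_of_add h1P h2P lt.
rewrite /edge2; set y := reflect_gen i j a x; set z := reflect_gen j k b y.
have [r1 [A1 hr1]] := rect_exists x ij h1P; have [r2 [A2 hr2]] := rect_exists y jk h2P.
rewrite -/y -/z in A1 A2.
have yk : position y k = position x k by rewrite (at_other A1) // eq_sym.
(* Equal widths would put the points of [z] and [x] on row [j] at the same place, forcing j = k. *)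
have wne : rect_width r1 <> rect_width r2.
  move=> E; have zx : point z j =T point x j.
    apply: same_of3 (same_sym (at_lrE A2)) (same_sym (at_ulE A1)) (at_urE A1) _.
    by rewrite !pointE E; congr pair; rewrite /=; ring.
  have [zj _] := position_inj (same_point_position zx).
  have [E2 _] := rect_at_column A2; move: zj; rewrite E2.
  have [-> _] := position_inj yk.
  by move/perm_inj => kj; rewrite kj eqxx in jk.
case: (ltngtP (rect_width r2) (rect_width r1)) => [wlt|wlt|E]; last by case: wne.
  left; set y' := reflect_gen i k (a + b) x.
  have zE : z = reflect_gen i j a y'.
    by rewrite /z /y /y' -(reflect_gen_conj a b x u3) reflect_genK.
  have [r3 [A3 hr3]] := rect_exists x ik h3P; have [r4 [A4 hr4]] := rect_exists y' ij h1P.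
  rewrite -/y' in A3; rewrite -zE in A4; rewrite -zE.
  have y'j : position y' j = position x j by rewrite (at_other A3) // eq_sym.
  have w3 : rect_width r3 = rect_width r2.
    apply: nat_of_same; rewrite ?ltn_ord //.
    apply: same_of3 (at_urE A3) (same_sym (at_urE A2)) (same_sym (at_ulE A1)) _.
    by rewrite !pointE yk hr3 hr2 hr1; congr pair; rewrite /= ?PoszD; ring.
  have w4 : rect_width r4 = (rect_width r1 - rect_width r2)%N.
    apply: nat_of_same; rewrite ?ltn_ord //; first exact: leq_ltn_trans (leq_subr _ _) (ltn_ord _).
    apply: same_of3 (at_urE A4) (same_sym (at_urE A1)) (at_lrE A3) _.
    by rewrite !pointE y'j hr4 hr1 w3 -subzn ?(ltnW wlt) //; congr pair; rewrite /=; ring.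
  apply: (edge_ratio_polygon Hpq H1 H2) (rect_at_is A1) (rect_at_is A2) (rect_at_is A3) (rect_at_is A4) _ _.
    by apply: same_polygon_narrow A1 A2 A3 A4 wlt w3 _ w4 _; rewrite ?hr1 ?hr2.
  apply/eqP=> -[E _]; have := at_height A2; rewrite hr2.
  by move: hr3; rewrite -E hr1; lia.
right; set y' := reflect_gen j k b x.
have zE : z = reflect_gen i k (a + b) y'.
  by rewrite /z /y /y' -(reflect_gen_conj2 a b _ u3) reflect_genK.
have [r3 [A3 hr3]] := rect_exists x jk h2P; have [r4 [A4 hr4]] := rect_exists y' ik h3P.
rewrite -/y' in A3; rewrite -zE in A4; rewrite -zE.
have y'i : position y' i = position x i by rewrite (at_other A3).
have w3 : rect_width r3 = (rect_width r2 - rect_width r1)%N.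
  apply: nat_of_same; rewrite ?ltn_ord //; first exact: leq_ltn_trans (leq_subr _ _) (ltn_ord _).
  have xj : point x j =T ((position y j)%:Z + rect_width r1, (j : nat)%:Z).
    apply: same_of2 (same_sym (at_urE A1)) (at_ulE A1) _.
    by rewrite !pointE; congr pair; rewrite /=; ring.
  apply: same_of3 (at_urE A3) (same_sym (at_urE A2)) (same_sym xj) _.
  by rewrite !pointE hr3 hr2 yk -subzn ?(ltnW wlt) //; congr pair; rewrite /=; ring.
have w4 : rect_width r4 = rect_width r1.
  apply: nat_of_same; rewrite ?ltn_ord //.
  apply: same_of3 (at_urE A4) (same_sym (at_ulE A3)) (same_sym (at_urE A1)) _.
  by rewrite !pointE y'i hr4 hr3 hr1; congr pair; rewrite /= ?PoszD; ring.
apply: (edge_ratio_polygon Hpq H1 H2) (rect_at_is A1) (rect_at_is A2) (rect_at_is A3) (rect_at_is A4) _ _.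
  by apply: same_polygon_wide A1 A2 A3 A4 wlt w3 _ w4 _; rewrite ?hr1 ?hr2.
by apply: contra ij => /eqP[E _]; rewrite -(at_bottom A1) E (at_bottom A3).
Qed.

(** If the heights add up to more than pn, the complementary heights add up to less, and the path is
    run backwards from its end. A sum equal to pn would give i = k. *)
Lemma edge_half_any x i j k a b : uniq [:: i; j; k] ->
  edge2 x i j a j k b = edge2 x i k (a + b) i j a \/
  edge2 x i j a j k b = edge2 x j k b i k (a + b).
Proof.
move=> u3; have /uniq3P[ij ik jk] := u3.
have [h1 h1P] := height_exists Hpq a ij; have [h2 h2P] := height_exists Hpq b jk.
case: (ltngtP (h1 + h2) (p * n)) => [lt|gt|E]; first exact: edge_half u3 h1P h2P lt.
  set y := reflect_gen i j a x; set z := reflect_gen j k b y.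
  have z3 : z = reflect_gen i j a (reflect_gen i k (a + b) x).
    by rewrite /z /y -(reflect_gen_conj a b x u3) reflect_genK.
  have z2 : z = reflect_gen i k (a + b) (reflect_gen j k b x).
    by rewrite /z /y -(reflect_gen_conj2 a b _ u3) reflect_genK.
  have u3' : uniq [:: k; j; i] by apply/uniq3P; rewrite !(eq_sym k) (eq_sym j i).
  have lt : ((p * n - h2) + (p * n - h1) < p * n)%N.
    by case: h1P h2P => /andP[_ l1] _ _ [/andP[_ l2] _ _]; lia.
  have := edge_half z u3' (height_of_compl h2P) (height_of_compl h1P) lt.
  have ab : - b - a = - (a + b) by rewrite opprD addrC.
  rewrite /edge2 ab -!(reflect_genC _ _ jk) -!(reflect_genC _ _ ij) -!(reflect_genC _ _ ik).
  have zy : reflect_gen j k b z = y by apply: reflect_genK.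
  have yx : reflect_gen i j a y = x by apply: reflect_genK.
  have zx2 : reflect_gen i k (a + b) z = reflect_gen j k b x by rewrite z2 reflect_genK.
  have x2x : reflect_gen j k b (reflect_gen j k b x) = x by apply: reflect_genK.
  have zx3 : reflect_gen i j a z = reflect_gen i k (a + b) x by rewrite z3 reflect_genK.
  have x3x : reflect_gen i k (a + b) (reflect_gen i k (a + b) x) = x by apply: reflect_genK.
  rewrite zy yx zx2 x2x zx3 x3x -/y -/z -z2 -z3.
  have sym u v : edge u v = edge v u := edge_ratio_sym Hpq H1 H2 u v.
  move: (reflect_gen j k b x) (reflect_gen i k (a + b) x) => x2 x3.
  rewrite (sym z y) (sym y x) (sym z x2) (sym x2 x) (sym z x3) (sym x3 x).
  move: (edge x y) (edge y z) (edge x x2) (edge x2 z) (edge x x3) (edge x3 z).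
  by do 6![case] => //; auto.
case: h1P h2P => _ r1 _ [_ r2 _]; move: r2.
rewrite -r1 modnDml -addnA E addnC modnMDl modn_small // => /val_inj E'.
by rewrite E' eqxx in ik.
Qed.

(** Rotating i, j, k cyclically in [edge_half_any] shows that each of three path ratios agrees with
    one of the other two. For booleans this makes all three equal. *)
Lemma edge_triangle x i j k a b : uniq [:: i; j; k] ->
  edge2 x i j a j k b = edge2 x i k (a + b) i j a /\
  edge2 x i j a j k b = edge2 x j k b i k (a + b).
Proof.
move=> u3; have /uniq3P[ij ik jk] := u3.
have [ji ki kj] : [/\ j != i, k != i & k != j] by rewrite !(eq_sym k) (eq_sym j i).
have u1 : uniq [:: j; k; i] by apply/uniq3P.
have u2 : uniq [:: k; i; j] by apply/uniq3P.
have C1 : - (a + b) + a = - b by rewrite opprD addrAC addNr add0r.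
have C2 : b - (a + b) = - a by rewrite opprD addrCA subrr addr0.
have flip1 i1 j1 k1 l1 a1 b1 : i1 != j1 -> edge2 x i1 j1 (- a1) k1 l1 b1 = edge2 x j1 i1 a1 k1 l1 b1.
  by move=> ij1; rewrite /edge2 (reflect_genC _ _ ij1) opprK.
have flip2 i1 j1 k1 l1 a1 b1 : k1 != l1 -> edge2 x i1 j1 a1 k1 l1 (- b1) = edge2 x i1 j1 a1 l1 k1 b1.
  by move=> kl1; rewrite /edge2 (reflect_genC _ _ kl1) opprK.
(* The rotation permutes the labels a, b, -(a + b), whose sum is zero. *)
have E1 := edge_half_any x a b u3.
have E2 := edge_half_any x b (- (a + b)) u1.
rewrite C2 (flip2 j k k i _ _ ki) (flip1 j i _ _ _ _ ji) (flip1 k i _ _ _ _ ki) (flip2 _ _ j i _ _ ji) in E2.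
have E3 := edge_half_any x (- (a + b)) a u2.
rewrite C1 (flip1 k i _ _ _ _ ki) (flip1 k j _ _ _ _ kj) (flip2 _ _ k i _ _ ki) (flip2 _ _ k j _ _ kj) in E3.
move: E1 E2 E3.
move: (edge2 x i j a j k b) (edge2 x j k b i k (a + b)) (edge2 x i k (a + b) i j a).
by move=> [] [] [] [E1|E1] [E2|E2] [E3|E3].
Qed.
End Relations.

                                                         

(** * A normal form for words in reflections *)

Section ReflectionPresentation.
Import GRing.Theory.
Local Open Scope group_scope.
Variables n' p' : nat.
Local Notation n := n'.+1.
Local Notation p := p'.+1.
Variables (gT : finGroupType) (T : 'I_n -> 'I_n -> 'I_p -> gT).
Implicit Types (i j k l : 'I_n) (a b : 'I_p).
Hypothesis n_ge3 : 2 < n.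
Hypothesis T_sq : forall i j a, i != j -> T i j a * T i j a = 1.
Hypothesis T_sym : forall i j a, i != j -> T i j a = T j i (- a)%R.
Hypothesis T_far : forall i j k l a b, uniq [:: i; j; k; l] ->
  T i j a * T k l b = T k l b * T i j a.
Hypothesis T_conj : forall i j k a b, uniq [:: i; j; k] ->
  T i j a * (T j k b * T i j a) = T i k (a + b)%R.

Local Notation s i j := (T i j 0%R).

(** For the action on generators this is a translation: it subtracts [a] in row [i] and adds it in
    row [j]. *)
Definition shift i j a : gT := T i j a * s i j.
Definition shift1 i j : gT := shift i j (inZp 1).

Lemma third_index i j : exists l, l != i /\ l != j.
Proof.
have : #|[set i; j]| < #|'I_n| by rewrite card_ord cards2; case: (i != j) => //; apply: ltnW.
rewrite -cardsT => lt; have /set0Pn[l] : [set: 'I_n] :\: [set i; j] != set0.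
  rewrite setD_eq0; apply/negP=> /subset_leq_card; rewrite leqNgt lt //.
by rewrite !inE negb_or andbT => /andP[]; exists l.
Qed.

Lemma T_conj_r i j k a b : uniq [:: i; j; k] ->
  T j k b * (T i j a * T j k b) = T i k (a + b)%R.
Proof.
move=> u3; have /uniq3P[ij ik jk] := u3.
rewrite (T_sym b jk) (T_sym a ij) (T_sym _ ik) T_conj ?opprD 1?GRing.addrC //.
by apply/uniq3P; rewrite !(eq_sym k) (eq_sym j i).
Qed.

Lemma s_sym i j : i != j -> s i j = s j i.
Proof. by move=> ij; rewrite (T_sym _ ij) oppr0. Qed.

Lemma shift0 i j : i != j -> shift i j 0%R = 1.
Proof. exact: T_sq. Qed.

(** [T i j a] is rewritten through a third row [l], after which the conjugation by [s i j] only
    needs [T_conj]; this is where n >= 3 enters. *)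
Lemma s_conj_opposite i j a : i != j -> s i j * (T i j a * s i j) = T j i a.
Proof.
move=> ij; have [l [li lj]] := third_index i j.
have [il jl ji] : [/\ i != l, j != l & j != i] by rewrite (eq_sym i) (eq_sym j l) (eq_sym j i).
have u1 : uniq [:: i; l; j] by apply/uniq3P.
have u2 : uniq [:: j; i; l] by apply/uniq3P.
have u3 : uniq [:: l; j; i] by apply/uniq3P.
have u4 : uniq [:: j; l; i] by apply/uniq3P.
have E0 : T i l a * (s l j * T i l a) = T i j a by rewrite T_conj // addr0.
have E1 : s i j * (T i l a * s i j) = T j l a.
  by rewrite (s_sym ij) T_conj // add0r.
have E2 : s i j * (s l j * s i j) = s l i.
  by rewrite (s_sym ij) T_conj_r // addr0.
have K x y : s i j * ((x * y) * s i j) = (s i j * (x * s i j)) * (s i j * (y * s i j)).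
  by rewrite -!mulgA (mulgA (s i j) (s i j)) T_sq // mul1g.
by rewrite -E0 K E1 K E2 E1 T_conj // addr0.
Qed.

Lemma s_conj i j k l a : i != j -> k != l ->
  s k l * (T i j a * s k l) = T (tperm k l i) (tperm k l j) a.
Proof.
move=> ij kl.
(* If [k] avoids {i, j} but [l] does not, exchange [k] and [l]. *)
wlog : k l kl / [|| k == i, k == j | (l != i) && (l != j)] => [hw|].
  have /orP[C|] := orbN [|| k == i, k == j | (l != i) && (l != j)]; first exact: hw.
  rewrite !negb_or negb_and !negbK => /and3P[ki kj lij].
  rewrite (s_sym kl) tpermC; apply: hw; first by rewrite eq_sym.
  by case/orP: lij => ->; rewrite ?orbT.
have [ji lk] : j != i /\ l != k by rewrite (eq_sym j) (eq_sym l).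
case/or3P=> [/eqP ki|/eqP kj|/andP[li lj]].
- subst k; rewrite tpermL; have [->|jl] := eqVneq j l; first by rewrite tpermR s_conj_opposite.
  rewrite tpermD //; last by rewrite eq_sym.
  by rewrite (s_sym kl) T_conj ?add0r //; apply/uniq3P; rewrite (eq_sym l j).
- subst k; rewrite tpermL; have [->|il] := eqVneq i l; first by rewrite tpermR (s_sym kl) s_conj_opposite.
  rewrite tpermD //; last by rewrite eq_sym.
  by rewrite T_conj_r ?addr0 //; apply/uniq3P.
have [ki|ki] := eqVneq k i.
  subst k; rewrite tpermL (tpermD ij lj).
  by rewrite (s_sym kl) T_conj ?add0r //; apply/uniq3P.
have [kj|kj] := eqVneq k j.
  subst k; rewrite tpermL (tpermD ji li).
  by rewrite T_conj_r ?addr0 //; apply/uniq3P; rewrite (eq_sym i l).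
rewrite !tpermD // T_far; first by rewrite mulgA T_sq // mul1g.
by rewrite /= !inE !negb_or ij (eq_sym i k) (eq_sym i l) (eq_sym j k) (eq_sym j l) ki li kj lj kl.
Qed.

Lemma shift_conj i j k l a : i != j -> k != l ->
  s k l * (shift i j a * s k l) = shift (tperm k l i) (tperm k l j) a.
Proof.
move=> ij kl; rewrite /shift -!s_conj //.
by rewrite -!mulgA (mulgA (s k l) (s k l)) T_sq // mul1g.
Qed.

Lemma shift_inv i j a : i != j -> shift j i a = (shift i j a)^-1.
Proof.
move=> ij; apply: (mulgI (shift i j a)); rewrite mulgV.
have := shift_conj a ij ij; rewrite tpermL tpermR => <-.
rewrite /shift -!mulgA !(mulgA (s i j) (s i j)) !T_sq // !mul1g.
by rewrite mulgA T_sq ?mul1g ?T_sq.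
Qed.

(** The identity e_i - e_j = (e_i - e_l) + (e_l - e_j) among coroots, in both orders; commutation of
    translations is obtained from it. *)
Lemma shift_split i j l a : uniq [:: i; j; l] ->
  shift i l a * shift l j a = shift i j a /\ shift l j a * shift i l a = shift i j a.
Proof.
move=> /uniq3P[ij il jl]; have lj : l != j by rewrite eq_sym.
have ji : j != i by rewrite eq_sym.
have u : uniq [:: i; l; j] by apply/uniq3P.
have sE : s i l * (s l j * s i l) = s i j by rewrite T_conj // addr0.
have sE' : s l j * (s i l * s l j) = s i j by rewrite T_conj_r // addr0.
have E1 : T i l a * (s l j * T i l a) = T i j a by rewrite T_conj // addr0.
have E2 : T l j a * (s i l * T l j a) = T i j a by rewrite T_conj_r // add0r.
have F1 : s i l * (T l j a * s i l) = T i j a by rewrite T_conj // add0r.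
have F2 : s l j * (T i l a * s l j) = T i j a by rewrite T_conj_r // addr0.
split; rewrite /shift.
  have -> : T i l a * s i l * (T l j a * s l j) = T i l a * T i j a * (s i l * s l j).
    by rewrite -F1 -!mulgA (mulgA (s i l) (s i l)) T_sq // mul1g.
  rewrite -{1}E1 (mulgA (T i l a) (T i l a)) T_sq // mul1g -sE' -[in RHS]F2 -!mulgA.
  by rewrite (mulgA (s l j) (s l j) (s i l * _)) T_sq // mul1g.
have -> : T l j a * s l j * (T i l a * s i l) = T l j a * T i j a * (s l j * s i l).
  by rewrite -F2 -!mulgA (mulgA (s l j) (s l j)) T_sq // mul1g.
rewrite -{1}E2 (mulgA (T l j a) (T l j a)) T_sq // mul1g -sE -[in RHS]F1 -!mulgA.
by rewrite (mulgA (s i l) (s i l) (s l j * _)) T_sq // mul1g.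
Qed.

(** Together with [shift_split], this yields additivity in the label: expand [T i j (a + b)] through
    row [l] and move the transpositions to the right. *)
Lemma shift_add i j l a b : uniq [:: i; j; l] ->
  shift i j (a + b)%R = shift i l a * (shift i j b * shift l j a).
Proof.
move=> /uniq3P[ij il jl]; have lj : l != j by rewrite eq_sym.
have u : uniq [:: i; l; j] by apply/uniq3P.
have sE : s i l * (s l j * s i l) = s i j by rewrite T_conj // addr0.
have sE' : s l j * (s i l * s l j) = s i j by rewrite T_conj_r // addr0.
have F1 c : s i l * T i j c = T l j c * s i l.
  have <- : s i l * (T l j c * s i l) = T i j c by rewrite T_conj // add0r.
  by rewrite mulgA T_sq // mul1g.
have F1' : s i l * T l j a = T i j a * s i l.
  have <- : s i l * (T l j a * s i l) = T i j a by rewrite T_conj // add0r.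
  by rewrite -!mulgA T_sq // mulg1.
have F2 : s l j * T i j a = T i l a * s l j.
  have <- : s l j * (T i l a * s l j) = T i j a by rewrite T_conj_r // addr0.
  by rewrite mulgA T_sq // mul1g.
have E : s i l * s i j = s l j * s i l by rewrite -sE mulgA T_sq // mul1g.
rewrite /shift -(T_conj a b u) -!mulgA; congr (_ * _).
rewrite [s i l * _]mulgA F1 -!mulgA; congr (_ * _).
rewrite [s i l * _]mulgA E -!mulgA [s i l * (T l j a * _)]mulgA F1' -!mulgA.
by rewrite [s l j * _]mulgA F2 -mulgA sE'.
Qed.

Lemma shift_pow i j m : i != j -> shift i j (inZp m) = shift1 i j ^+ m.
Proof.
move=> ij; elim: m => [|m IH].
  by rewrite (_ : inZp 0 = 0%R) ?shift0 //; apply/val_inj; rewrite /= mod0n.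
have -> : inZp m.+1 = (inZp 1 + inZp m)%R :> 'I_p.
  by apply/val_inj; rewrite /= modnDml modnDmr add1n.
have [l [li lj]] := third_index i j; have [il jl] : i != l /\ j != l by rewrite eq_sym (eq_sym j).
have u : uniq [:: i; j; l] by apply/uniq3P.
have [E1 E2] := shift_split (inZp 1) u.
have com : commute (shift l j (inZp 1)) (shift1 i j).
  by rewrite /commute /shift1 -{1}E1 mulgA E2.
rewrite (shift_add _ _ u) IH -(commuteX m com) mulgA E1.
by rewrite expgS.
Qed.

(** The n - 1 basic translations. The value 1 at [ord0] lets products run over all rows. *)
Definition coroot j : gT := if j == ord0 then 1 else shift1 ord0 j.

Lemma coroot_comm j k : commute (coroot j) (coroot k).
Proof.
rewrite /coroot; case: eqVneq => [_|j0]; first by apply: commute_sym; apply: commute1.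
case: eqVneq => [_|k0]; first exact: commute1.
have [->//|jk] := eqVneq j k.
have u : uniq [:: k; j; ord0] by apply/uniq3P; rewrite (eq_sym k).
have [E1 E2] := shift_split (inZp 1) u.
rewrite -[shift1 ord0 k]invgK; apply: commuteV.
by rewrite /commute /shift1 -shift_inv 1?eq_sym // E1 E2.
Qed.

Lemma coroot_order j : coroot j ^+ p = 1.
Proof.
rewrite /coroot; case: eqVneq => [_|j0]; first exact: expg1n.
rewrite -shift_pow 1?eq_sym // (_ : inZp p = 0%R) ?shift0 // 1?eq_sym //.
by apply/val_inj; rewrite /= modnn.
Qed.

Lemma shift_coroot i j a : i != j -> exists x y, shift i j a = coroot i ^+ x * coroot j ^+ y.
Proof.
(* The exponent [p'] stands for -1, since coroots have order dividing p. *)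
move=> ij; suff E : shift1 i j = coroot i ^+ p' * coroot j.
  exists (p' * a)%N, a; rewrite expgM -expgMn; last by apply: commute_sym; apply: commuteX; apply: coroot_comm.
  rewrite -E -shift_pow //; congr shift; apply/val_inj.
  by rewrite /= modn_small.
have inv k : coroot k ^+ p' = (coroot k)^-1.
  by apply: (mulgI (coroot k)); rewrite mulgV -expgS coroot_order.
rewrite inv /coroot; case: (eqVneq i ord0) => [i0|i0].
  case: eqVneq => [j0|_]; first by rewrite i0 j0 eqxx in ij.
  by rewrite i0 invg1 mul1g.
have Ei : shift1 i ord0 = (shift1 ord0 i)^-1 by rewrite -shift_inv // eq_sym.
case: (eqVneq j ord0) => [->|j0]; first by rewrite mulg1.
have u : uniq [:: i; j; ord0] by apply/uniq3P.
by rewrite -Ei; have [-> _] := shift_split (inZp 1) u.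
Qed.

Definition translation (v : 'I_n -> nat) : gT := \prod_(k <- enum 'I_n) coroot k ^+ v k.

Lemma translation_mul v j x :
  translation v * coroot j ^+ x = translation (fun k => v k + (k == j) * x)%N.
Proof.
rewrite /translation; have : j \in enum 'I_n by rewrite mem_enum.
have comX (r : seq 'I_n) : commute (coroot j ^+ x) (\prod_(k <- r) coroot k ^+ v k).
  elim: r => [|k r IH]; first by rewrite big_nil; apply: commute1.
  rewrite big_cons; apply: commuteM => //; apply: commuteX; apply: commute_sym.
  exact: commuteX (coroot_comm _ _).
elim: (enum 'I_n) (enum_uniq 'I_n) => [//|k r IH] /= /andP[kr ur].
rewrite inE !big_cons => /predU1P[jk|jr].
  rewrite -jk in kr *; rewrite eqxx mul1n expgD -!mulgA -(comX r); congr (_ * (_ * _)).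
  rewrite big_seq [RHS]big_seq; apply: eq_bigr => l lr.
  case: eqVneq => [lj|_]; last by rewrite addn0.
  by rewrite -lj lr in kr.
rewrite -mulgA IH //; case: eqVneq => [kj|_]; first by rewrite kj jr in kr.
by rewrite addn0.
Qed.

Definition reflection_word := seq ('I_n * 'I_n * 'I_p).
Definition proper_word (w : reflection_word) := all (fun t => t.1.1 != t.1.2) w.
Definition eval_reflections (w : reflection_word) : gT :=
  foldr (fun t g => T t.1.1 t.1.2 t.2 * g) 1 w.

Lemma eval_reflections_rcons w t :
  eval_reflections (rcons w t) = eval_reflections w * T t.1.1 t.1.2 t.2.
Proof. by elim: w => [|k w IH] /=; rewrite ?mulg1 ?mul1g // IH mulgA. Qed.

(** As in a semidirect product: a new letter is a shift times a plain transposition, and the shift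
    is conjugated to the left through the plain transpositions already collected. *)
Lemma reflection_normal_form w : proper_word w ->
  exists v u, all (fun l : 'I_n * 'I_n => l.1 != l.2) u /\
    eval_reflections w = translation v * eval_in (fun i j => s i j) u.
Proof.
elim/last_ind: w => [_|w [[i j] a] IH].
  exists (fun=> 0), [::]; split=> //; rewrite mulg1 /translation big1_seq //.
rewrite /proper_word all_rcons /= => /andP[ij /IH[v [u [ud E]]]].
have [i' [j' [ij' Eij]]] : exists i' j', i' != j' /\
    eval_in (fun i j => s i j) u * shift i j a = shift i' j' a * eval_in (fun i j => s i j) u.
  elim: u ud {E} => [_|[k l] u IHu /= /andP[kl /IHu[i' [j' [ij' E]]]]].
    by exists i, j; rewrite mul1g mulg1.
  exists (tperm k l i'), (tperm k l j'); rewrite (inj_eq perm_inj); split=> //.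
  by rewrite -mulgA E -shift_conj // -!mulgA (mulgA (s k l) (s k l)) T_sq // mul1g.
have [x [y Exy]] := shift_coroot a ij'.
exists (fun k => v k + (k == i') * x + (k == j') * y)%N, (rcons u (i, j)).
split; first by rewrite all_rcons /= ij.
rewrite eval_reflections_rcons eval_in_rcons /= E -!translation_mul.
have -> : T i j a = shift i j a * s i j by rewrite /shift -mulgA T_sq ?mulg1.
by rewrite -(mulgA (translation v)) (mulgA (eval_in _ u)) Eij Exy -!mulgA.
Qed.

Lemma translation_trivial v : (forall k, k != ord0 -> (p %| v k)) -> translation v = 1.
Proof.
move=> pv; rewrite /translation big1_seq // => k _.
have [k0|/pv/dvdnP[m ->]] := eqVneq k ord0; last by rewrite mulnC expgM coroot_order expg1n.
by rewrite /coroot k0 eqxx expg1n.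
Qed.
End ReflectionPresentation.

(** * The double cover and its triviality for n >= 3 *)

Section DoubleCover.
Import GRing.Theory.
Variables n' p' : nat.
Local Notation n := n'.+1.
Local Notation p := p'.+1.
Local Notation generator := (generator n' p').
Implicit Types (x y z : generator) (i j k l : 'I_n) (a b : 'I_p).
Variable edge : generator -> generator -> bool.
Hypothesis n_ge3 : 2 < n.
Hypothesis edge_sym : forall x y, edge x y = edge y x.
Hypothesis edge_far : forall x i j k l a b, uniq [:: i; j; k; l] ->
  edge x (reflect_gen i j a x) (+) edge (reflect_gen i j a x) (reflect_gen k l b (reflect_gen i j a x)) =
  edge x (reflect_gen k l b x) (+) edge (reflect_gen k l b x) (reflect_gen k l b (reflect_gen i j a x)).
Hypothesis edge_conj : forall x i j k a b, uniq [:: i; j; k] ->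
  edge x (reflect_gen i j a x) (+) edge (reflect_gen i j a x) (reflect_gen j k b (reflect_gen i j a x)) =
  edge x (reflect_gen i k (a + b)%R x) (+)
  edge (reflect_gen i k (a + b)%R x) (reflect_gen i j a (reflect_gen i k (a + b)%R x)).

Local Notation cover := (generator * bool)%type.

(** Traversing an edge changes the sheet by its ratio. Taking the identity for i = j makes this a
    permutation for all indices. *)
Definition lift_reflection i j a (e : cover) : cover :=
  if i == j then e else (reflect_gen i j a e.1, e.2 (+) edge e.1 (reflect_gen i j a e.1)).

Lemma lift_reflectionK i j a : involutive (lift_reflection i j a).
Proof.
move=> [x b]; rewrite /lift_reflection; case: (eqVneq i j) => [//|ij] /=.
by rewrite reflect_genK // (edge_sym _ x) -addbA addbb addbF.
Qed.

Definition cover_perm i j a : {perm cover} := perm (inv_inj (lift_reflectionK i j a)).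
Local Notation T := cover_perm.

Lemma cover_permE i j a x c : i != j ->
  T i j a (x, c) = (reflect_gen i j a x, c (+) edge x (reflect_gen i j a x)).
Proof. by move=> /negPf ij; rewrite permE /lift_reflection ij. Qed.

Lemma cover_sq i j a : i != j -> (T i j a * T i j a = 1)%g.
Proof. by move=> _; apply/permP=> e; rewrite permM perm1 !permE lift_reflectionK. Qed.

Lemma cover_sym i j a : i != j -> T i j a = T j i (- a)%R.
Proof.
move=> ij; have ji : j != i by rewrite eq_sym.
by apply/permP=> -[x b]; rewrite !cover_permE // (reflect_genC _ _ ij).
Qed.

Lemma cover_far i j k l a b : uniq [:: i; j; k; l] ->
  (T i j a * T k l b = T k l b * T i j a)%g.
Proof.
move=> u4; have [ij kl] : i != j /\ k != l.
  by move: u4; rewrite /= !inE !negb_or => /and4P[/and3P[-> _ _] _ -> _].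
apply/permP=> -[x c]; rewrite !permM !cover_permE //.
rewrite -(reflect_gen_far a b x u4); congr pair.
by rewrite -!addbA (edge_far _ _ _ u4).
Qed.

(** By [edge_conj] a square of edges closes up in the cover; moving one edge to the other side gives
    the conjugation relation. *)
Lemma cover_conj i j k a b : uniq [:: i; j; k] ->
  (T i j a * (T j k b * T i j a) = T i k (a + b)%R)%g.
Proof.
move=> u3; have /uniq3P[ij ik jk] := u3; have E := edge_conj _ a b u3.
apply/permP=> -[x c]; rewrite !permM !cover_permE //.
have E3 := reflect_gen_conj a b x u3.
have Ez := reflect_genK a (reflect_gen j k b (reflect_gen i j a x)) ij.
rewrite E3 in Ez *; have := E x; rewrite Ez => E1; congr pair; move: E1.
move: (reflect_gen j k b _) (reflect_gen i k _ _) E3 Ez => z w _ _.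
move: (reflect_gen i j a x) => y E1.
by rewrite -!addbA (addbA (edge x y)) E1 -addbA (edge_sym z) addbb addbF.
Qed.

Lemma coroot_act m k e l : l != ord0 ->
  ((coroot T k ^+ m)%g e).1.1 = e.1.1 /\
  ((coroot T k ^+ m)%g e).1.2 l = (e.1.2 l + inZp ((l == k) * m))%R.
Proof.
move=> l0; elim: m e => [|m IH] e.
  rewrite expg0 perm1 muln0; split=> //.
  by rewrite (_ : inZp 0 = 0%R) ?addr0 //; apply/val_inj; rewrite /= mod0n.
rewrite expgS permM; have [-> ->] := IH (coroot T k e); rewrite /coroot.
have [k0|k0] := eqVneq k ord0.
  rewrite perm1; split=> //; congr (_ + inZp _)%R.
  by rewrite -k0 in l0; rewrite (negPf l0).
have k0' : ord0 != k by rewrite eq_sym.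
case: e => x c; rewrite /shift1 /shift permM !cover_permE //=; split.
  by rewrite mulgA tperm2 mul1g.
rewrite !ffunE !eqxx ?(negPf l0); case: eqVneq => [->|lk]; last by rewrite !mul0n ?(negPf l0).
rewrite ?(negPf k0) subr0 !mul1n -addrA; congr (_ + _)%R.
by apply/val_inj; rewrite /= modnDml modnDmr add1n.
Qed.

Lemma translation_act v e l : l != ord0 ->
  (translation T v e).1.1 = e.1.1 /\
  (translation T v e).1.2 l = (e.1.2 l + inZp (v l))%R.
Proof.
move=> l0; rewrite /translation.
have -> : v l = \sum_(k <- enum 'I_n) (l == k) * v k.
  rewrite big_enum /= (bigD1 l) //= eqxx mul1n big1 ?addn0 // => k kl.
  by rewrite eq_sym (negPf kl).
elim: (enum 'I_n) e => [|k r IH] e.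
  rewrite !big_nil perm1; split=> //.
  by rewrite (_ : inZp 0 = 0%R) ?addr0 //; apply/val_inj; rewrite /= mod0n.
rewrite !big_cons permM; have [-> ->] := IH ((coroot T k ^+ v k)%g e).
have [-> ->] := coroot_act (v k) k e l0; split=> //; rewrite -addrA; congr (_ + _)%R.
by apply/val_inj; rewrite /= modnDm.
Qed.

Lemma eval_in_act u e : all (fun t : 'I_n * 'I_n => t.1 != t.2) u ->
  (eval_in (fun i j => T i j 0%R) u e).1.1 = ((eval_perm u)^-1 * e.1.1)%g.
Proof.
elim: u e => [|[i j] u IH] [x c]; first by rewrite /= perm1 invg1 mul1g.
case/andP=> ij ud; rewrite [eval_in _ _]/= permM IH // cover_permE //=.
by rewrite invMg tpermV mulgA.
Qed.

(** No monodromy: in normal form, a fixed generator forces the permutation to be trivial and the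
    translation to vanish modulo p, and the relations then kill both parts on the cover. *)
Lemma word_fix w e : proper_word w -> (eval_reflections T w e).1 = e.1 ->
  eval_reflections T w = 1%g.
Proof.
move=> wp; have [v [u [ud ->]]] := reflection_normal_form n_ge3 cover_sq cover_sym cover_far cover_conj wp.
have tr1 g : (translation T v g).1.1 = g.1.1.
  have [l [l0 _]] := third_index n_ge3 ord0 ord0.
  by have [] := translation_act v g l0.
rewrite permM => fix_e.
have pu : eval_perm u = 1%g.
  have := congr1 fst fix_e; rewrite eval_in_act // tr1 => E.
  by apply/invg_inj; apply: (mulIg e.1.1); rewrite E invg1 mul1g.
have su : eval_in (fun i j => T i j 0%R) u = 1%g.
  apply: eval_in_trivial ud pu.
  - by move=> i j; apply: cover_sq.
  - by move=> i j ij; rewrite cover_sym // oppr0.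
  - by move=> i j k l; apply: cover_far.
  - by move=> i j k u3; rewrite cover_conj // addr0.
rewrite su perm1 in fix_e; rewrite su mulg1; apply: (translation_trivial n_ge3 cover_sq cover_sym cover_conj) => k k0.
have [_] := translation_act v e k0; rewrite fix_e -{1}[e.1.2 k]addr0 => /addrI.
by move/(congr1 val) => /= /esym/eqP.
Qed.

Definition cover_rel : rel cover := fun e e' =>
  [exists i, exists j, exists a, (i != j) && (T i j a e == e')].

Definition base_rel : rel generator := fun x y =>
  [exists i, exists j, exists a, (i != j) && (reflect_gen i j a x == y)].

Lemma cover_relP e e' :
  reflect (exists i j a, i != j /\ T i j a e = e') (cover_rel e e').
Proof.
apply: (iffP existsP) => [[i /existsP[j /existsP[a /andP[ij /eqP E]]]]|[i [j [a [ij E]]]]].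
  by exists i, j, a.
by exists i; apply/existsP; exists j; apply/existsP; exists a; rewrite ij E eqxx.
Qed.

Lemma base_relP x y :
  reflect (exists i j a, i != j /\ reflect_gen i j a x = y) (base_rel x y).
Proof.
apply: (iffP existsP) => [[i /existsP[j /existsP[a /andP[ij /eqP E]]]]|[i [j [a [ij E]]]]].
  by exists i, j, a.
by exists i; apply/existsP; exists j; apply/existsP; exists a; rewrite ij E eqxx.
Qed.

Lemma connect_cover_sym : connect_sym cover_rel.
Proof.
apply: sym_connect_sym => e e'; apply/cover_relP/cover_relP => -[i [j [a [ij <-]]]];
  by exists i, j, a; rewrite ij !permE lift_reflectionK.
Qed.

Lemma connect_base_sym : connect_sym base_rel.
Proof.
apply: sym_connect_sym => x y; apply/base_relP/base_relP => -[i [j [a [ij <-]]]];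
  by exists i, j, a; rewrite reflect_genK.
Qed.

Lemma connect_word e e' : connect cover_rel e e' ->
  exists w, proper_word w /\ eval_reflections T w e = e'.
Proof.
case/connectP=> r; elim: r e => [|e1 r IH] e /=; first by move=> _ ->; exists [::]; rewrite perm1.
case/andP=> /cover_relP[i [j [a [ij <-]]]] er /(IH _ er)[w [wp <-]].
by exists ((i, j, a) :: w); rewrite /= ij permM.
Qed.

Lemma connect_same x c c' : connect cover_rel (x, c) (x, c') -> c = c'.
Proof.
case/connect_word=> w [wp E]; have := word_fix wp (e := (x, c)).
by rewrite E => /(_ erefl) w1; move: E; rewrite w1 perm1 => -[].
Qed.

Lemma connect_lift x y c : connect base_rel x y ->
  exists c', connect cover_rel (x, c) (y, c').
Proof.
case/connectP=> r; elim: r x c => [|x1 r IH] x c /=; first by move=> _ ->; exists c.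
case/andP=> /base_relP[i [j [a [ij <-]]]] er /(IH _ (c (+) edge x (reflect_gen i j a x)) er)[c' E].
exists c'; apply: connect_trans E; apply: connect1; apply/cover_relP.
by exists i, j, a; rewrite cover_permE.
Qed.

(** Since the two points over a generator are never connected, each component of the base is covered
    by two separate sheets. The potential records on which point over [x] the sheet of the chosen
    root lies. *)
Lemma potential_exists : exists f : generator -> bool,
  forall x i j a, i != j -> edge x (reflect_gen i j a x) = f x (+) f (reflect_gen i j a x).
Proof.
pose r x := fingraph.root base_rel x.
pose f x := connect cover_rel (r x, false) (x, true).
have fP x : connect cover_rel (r x, false) (x, f x).
  have rx : connect base_rel (r x) x by rewrite connect_base_sym; apply: connect_root.
  have [[] E] := connect_lift false rx; first by rewrite /f E.
  suff -> : f x = false by [].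
  apply/negP=> E'; suff : true = false by [].
  by apply: (@connect_same x); apply: connect_trans E; rewrite connect_cover_sym.
exists f => x i j a ij; set y := reflect_gen i j a x.
have ry : r y = r x.
  apply/esym/(fingraph.rootP connect_base_sym); apply: connect1.
  by apply/base_relP; exists i, j, a.
have := fP y; rewrite ry => Ey.
have E : connect cover_rel (x, f x) (y, f x (+) edge x y).
  by apply: connect1; apply/cover_relP; exists i, j, a; rewrite cover_permE.
have Exy : f y = f x (+) edge x y.
  apply: (@connect_same y); apply: connect_trans (connect_trans (fP x) E).
  by rewrite connect_cover_sym.
by rewrite Exy addbA addbb.
Qed.
End DoubleCover.

                                      

(** * Two rows: spiral polygons and slides *)

Section Spiral.
Import GRing.Theory Num.Theory Order.TTheory.
Local Open Scope ring_scope.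
Variables n' p' q : nat.
Local Notation n := n'.+1.
Local Notation p := p'.+1.
Local Notation generator := (generator n' p').
Local Notation rectangle := (rectangle n' p').
Local Notation point x l := (lattice_point (gen_point x l)).
Local Notation rect_at := (@rect_at n' p' q).
Local Notation "u =T v" := (same_point n p q u v) (at level 70).
Implicit Types (r : rectangle) (x y z : generator) (i j k l : 'I_n) (a b : 'I_p).

                                                                                
                                                                           
(** The strip [r2] of width 1 is glued by its lower end to the right edge of [r1] and by its upper
    end to the left edge. Cutting off both ends of the strip widens [r1] to [r3] by a column on
    either side and leaves the middle [r4] of the strip. *)
Lemma same_polygon_spiral x y z y' r1 r2 r3 r4 i j (h k : nat) :
  rect_at x y r1 i j -> rect_at y z r2 i j -> rect_at x y' r4 j i -> rect_at y' z r3 i j ->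
  (h < k)%N -> rect_height r1 = h -> rect_width r2 = 1%N -> rect_height r2 = (h + k)%N ->
  rect_width r4 = 1%N -> rect_height r4 = (k - h)%N ->
  rect_width r3 = (rect_width r1).+2 -> rect_height r3 = h ->
  same_polygon q r1 r2 r4 r3.
Proof.
move=> A1 A2 A4 A3 hk h1 w2 h2 w4 h4 w3 h3; have ij := at_neq A1; have ji := at_neq A4.
have w1_gt0 := at_width A1; have h1_gt0 := at_height A1.
set w := rect_width r1 in w3.
pose F (c : raw_tile) : raw_tile := let: (s, (a, b)) := c in
  if s then
    if (b < h)%N then (true, (w.+1, b)) else
    if (b < k)%N then (false, (0%N, (b - h)%N)) else (true, (0%N, (b - k)%N))
  else (true, (a.+1, b)).
pose F' (c : raw_tile) : raw_tile := let: (s, (a, b)) := c in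
  if s then
    if (a == 0)%N then (true, (0%N, (b + k)%N)) else
    if (a == w.+1)%N then (true, (0%N, b)) else (false, (a.-1, b))
  else (true, (0%N, (b + h)%N)).
have xi : point x i =T ((position y' i)%:Z + 1, (i : nat)%:Z).
  apply: same_of2 (same_sym (at_urE A4)) (at_ulE A4) _.
  by rewrite !pointE w4; congr pair; rewrite /=; ring.
apply: (same_polygon_build (F := F) (F' := F')).
- move=> [[] [a b]]; rewrite /raw_valid /F /F' /= => /andP[va vb]; case_ifs; split; tile_arith.
- move=> [[] [a b]]; rewrite /raw_valid /F /F' /= => /andP[va vb]; case_ifs; split; tile_arith.
- move=> [[] [a b]]; rewrite /raw_valid /F /= => /andP[va vb]; last first.
    rewrite (rect_pointE A3) (rect_pointE A1); apply: same_of1 (same_sym xi) _.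
    by rewrite pointE; congr pair; rewrite /=; lia.
  have a0 : a = 0%N by lia.
  rewrite (rect_pointE A2) a0; case: ltnP => bh /=.
    rewrite (rect_pointE A3); apply: same_of2 (same_sym xi) (at_lrE A1) _.
    by rewrite !pointE; congr pair; rewrite /=; lia.
  case: ltnP => bk /=.
    rewrite (rect_pointE A4); apply: same_of2 (same_sym (at_urE A1)) (at_lrE A1) _.
    by rewrite !pointE h1; congr pair; rewrite /=; lia.
  rewrite (rect_pointE A3); apply: same_of2 (at_ulE A3) (same_sym (at_ulE A2)) _.
  by rewrite h3 h2; congr pair; rewrite /=; lia.
- rewrite (corners_eq (at_lr A1) (at_ll A2)) (corners_eq (at_ur A2) (at_ul A1)).
  rewrite (corners_neqF (at_lr A4) (at_ll A3) ji) (corners_neqF (at_ur A3) (at_ul A4) ji).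
  move=> [[] [a b]] [[] [a' b']]; rewrite /raw_valid /F /= => /andP[va vb] /andP[va' vb'];
    case_ifs; lia.
rewrite (corners_neqF (at_ul A1) (at_ll A2) ji) (corners_neqF (at_ur A2) (at_lr A1) ji).
rewrite (corners_eq (at_ul A4) (at_ll A3)) (corners_eq (at_ur A3) (at_lr A4)).
move=> [[] [a b]] [[] [a' b']]; rewrite /raw_valid /F /= => /andP[va vb] /andP[va' vb'];
  case_ifs; lia.
Qed.

End Spiral.

Section TwoRows.
Import GRing.Theory Num.Theory Order.TTheory.
Local Open Scope ring_scope.
Variables p' q : nat.
Local Notation p := p'.+1.
Local Notation N := (p * 2)%N.
Local Notation generator := (generator 1 p').
Local Notation rectangle := (rectangle 1 p').
Local Notation point x l := (lattice_point (gen_point x l)).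
Local Notation rect_at := (@rect_at 1 p' q).
Local Notation "u =T v" := (same_point 2 p q u v) (at level 70).
Implicit Types (r : rectangle) (x y z : generator) (i j l : 'I_2).

Lemma ord2P (P : 'I_2 -> Prop) : P ord0 -> P ord_max -> forall l, P l.
Proof.
move=> P0 P1 [[|[|//]] h]; [have -> : Ordinal h = ord0 by exact/val_inj|
  have -> : Ordinal h = ord_max by exact/val_inj] => //.
Qed.

Lemma ord2_neq i j l : i != j -> l != i -> l = j.
Proof. by move=> ij li; apply/eqP; move: i j l ij li; do 3!apply: ord2P. Qed.

Lemma odd_position x l : odd (position x l) = odd (x.1 l).
Proof. by rewrite /position oddD oddM andbF. Qed.

Lemma odd_position_neq x : odd (position x ord0) != odd (position x ord_max).
Proof.
rewrite !odd_position.
have : x.1 ord0 != x.1 ord_max by rewrite (inj_eq perm_inj).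
by move: (x.1 ord0) (x.1 ord_max); apply: ord2P; apply: ord2P.
Qed.

(** The generator with prescribed positions modulo [N]. For two rows the column is the parity of the
    position, so the two parities have to differ. *)
Definition pair_gen (c : 'I_2 -> nat) : generator :=
  ((if odd (c ord0) then tperm ord0 ord_max else 1)%g, [ffun l => inZp (c l %/ 2)]).

Lemma position_pair_gen c l : odd (c ord0) != odd (c ord_max) ->
  position (pair_gen c) l = (c l %% N)%N.
Proof.
move=> ne; rewrite /position ffunE /=.
have -> : (if odd (c ord0) then tperm ord0 ord_max else 1)%g l = odd (c l) :> nat.
  move: l ne; apply: ord2P; case: (odd (c ord0)) (odd (c ord_max)) => [] [] // _;
    by rewrite ?tpermL ?tpermR ?perm1.
rewrite [in RHS](_ : c l = (c l %/ 2 %/ p) * N + ((c l %/ 2 %% p) * 2 + odd (c l)))%N; last first.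
  by rewrite mulnA addnA -mulnDl -divn_eq -modn2 -divn_eq.
by rewrite modnMDl [RHS]modn_small //; have := ltn_pmod (c l %/ 2) (ltn0Sn p'); case: odd; nia.
Qed.

                                                                                  
(** The point on row [i] moves right by [t], the other one left by [t]; [N * t - t] represents -t
    modulo [N]. *)
Definition slide i t x : generator :=
  pair_gen (fun l => position x l + (if l == i then t else N * t - t))%N.

Lemma position_slide i t x l :
  position (slide i t x) l = ((position x l + (if l == i then t else N * t - t)) %% N)%N.
Proof.
rewrite position_pair_gen //; have := odd_position_neq x.
have oddN : odd (N * t - t) = odd t by rewrite oddB ?oddM /= ?andbF //; apply: leq_pmull.
rewrite ![odd (position x _ + _)]oddD !(fun_if odd) oddN !if_same.
by case: (odd t); rewrite ?addbF ?addbT // => /negPf; case: odd; case: odd.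
Qed.

Lemma slideD i t u x : slide i t (slide i u x) = slide i (u + t) x.
Proof.
apply: generator_eq => l; rewrite !position_slide modnDml.
by case: eqP => _; congr (_ %% _)%N; nia.
Qed.

Lemma slide0 i x : slide i 0 x = x.
Proof.
by apply: generator_eq => l; rewrite position_slide muln0 if_same addn0 modn_small ?position_lt.
Qed.

Lemma slide_period i x : slide i N x = x.
Proof.
apply: generator_eq => l; rewrite position_slide.
case: eqP => _; first by rewrite modnDr modn_small ?position_lt.
have -> : (N * N - N = (N - 1) * N)%N by nia.
by rewrite addnC modnMDl modn_small ?position_lt.
Qed.

Lemma slideK i j x t : i != j -> slide j t (slide i t x) = x.
Proof.
move=> ij; apply: generator_eq => l; rewrite !position_slide modnDml.
suff -> : ((position x l + (if l == i then t else N * t - t)) +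
    (if l == j then t else N * t - t) = t * N + position x l)%N.
  by rewrite modnMDl modn_small ?position_lt.
have [->|li] := eqVneq l i; first by rewrite (negPf ij); nia.
rewrite (ord2_neq ij li) eqxx.
nia.
Qed.

Lemma point_slide i t x l :
  point (slide i t x) l =T ((position x l)%:Z + (if l == i then t%:Z else - t%:Z), (l : nat)%:Z).
Proof.
rewrite pointE position_slide /same_point /in_lattice /= subrr dvdz0 mulr0 subr0.
rewrite -eqz_mod_dvd; case: (l =P i) => _; first by rewrite -PoszD !modz_nat modn_mod eqxx.
have le : (t <= N * t)%N by nia.
rewrite -modz_nat modz_mod PoszD -subzn // PoszM eqz_mod_dvd /=.
apply/dvdzP; exists t%:Z; ring.
Qed.

Lemma rect_at_slide x y r i j : rect_at x y r i j -> y = slide i (rect_width r) x.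
Proof.
move=> A; apply: generator_eq => l; apply: (@same_point_position 1 p' q).
have ji : (j == i) = false by rewrite eq_sym (negPf (at_neq A)).
have [->|li] := eqVneq l i.
  have := point_slide i (rect_width r) x i; rewrite eqxx => E.
  exact: same_trans (same_sym (at_lrE A)) (same_sym E).
rewrite (ord2_neq (at_neq A) li).
have := point_slide i (rect_width r) x j; rewrite ji; move: (point (slide _ _ _) _) => v E.
apply: same_of3 (same_sym (at_ulE A)) (at_urE A) (same_sym E) _.
by rewrite !pointE; congr pair; rewrite /=; ring.
Qed.
End TwoRows.

Section TwoRowPotential.
Import GRing.Theory Num.Theory Order.TTheory.
Local Open Scope ring_scope.
Variables p' q : nat.
Local Notation p := p'.+1.
Local Notation N := (p * 2)%N.
Local Notation generator := (generator 1 p').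
Local Notation rectangle := (rectangle 1 p').
Local Notation point x l := (lattice_point (gen_point x l)).
Local Notation rect_at := (@rect_at 1 p' q).
Local Notation "u =T v" := (same_point 2 p q u v) (at level 70).
Implicit Types (r : rectangle) (x y z : generator) (i j l : 'I_2).
Hypothesis Hpq : coprime p q.
Variables S1 S2 : sign_function 1 p' q.
Hypotheses (H1 : sign_assignment S1) (H2 : sign_assignment S2).
Local Notation edge := (edge_ratio S1 S2).

Lemma odd_ord2 i j : i != j -> odd i = ~~ odd j.
Proof. by move: i j; do 2!apply: ord2P. Qed.

Lemma big_addb_ends (F : nat -> bool) w : (1 < w)%N ->
  \big[addb/false]_(t < w) F t =
  F 0%N (+) (\big[addb/false]_(t < w.-2) F t.+1 (+) F w.-1).
Proof. by case: w => [|[|w]] // _; rewrite big_ord_recl big_ord_recr. Qed.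

(** Such a [v] solves q v = m modulo p, where q is a unit. *)
Lemma lattice_column (m : nat) : (0 < m < p)%N ->
  exists2 v : nat, (0 < v < p)%N & ((m * 2)%N%:Z, (v * 2)%N%:Z) =T 0.
Proof.
case/andP=> m0 mp; case: (posnP q) => [q0|q0].
  by move: Hpq; rewrite q0 /coprime gcdn0 => /eqP; lia.
case: (egcdnP p q0) => u k E _; move: E; rewrite gcdnC (eqP Hpq) => E.
have vq : ((m * u %% p) * q = m %[mod p])%N.
  by rewrite modnMml -mulnA E mulnDr muln1 mulnA modnMDl.
exists (m * u %% p)%N.
  rewrite ltn_pmod // andbT lt0n; apply/eqP => v0; move: vq.
  by rewrite v0 mul0n mod0n modn_small //; lia.
apply/andP; split; first by rewrite /= subr0 PoszM dvdz_mull.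
rewrite /= !subr0 -eqz_mod_dvd -PoszM !modz_nat eqz_nat.
by rewrite mulnA -!muln_modl eqn_mul2r /= mulnC vq.
Qed.

(** Induction on the width [w], which is odd. The spiral trades the rectangle for one of width w - 2
    and two of width 1; embeddedness supplies the inequalities h < k and h + k < N that let the
    spiral exist. *)
Lemma edge_embedded (w : nat) x y r i j :
  rect_at x y r i j -> rect_embedded q r -> rect_width r = w ->
  edge x y = \big[addb/false]_(t < w) edge (slide i t x) (slide i t.+1 x).
Proof.
elim/ltn_ind: w x y r i j => w IH y' z r i j A /forallP emb rw.
have ij := at_neq A; have ji : j != i by rewrite eq_sym.
have zE := rect_at_slide A; rewrite rw in zE.
have embP (a b a' b' : nat) : (a < w)%N -> (b < rect_height r)%N ->
    (a' < w)%N -> (b' < rect_height r)%N ->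
    (a%:Z, b%:Z) =T (a'%:Z, b'%:Z) -> a = a' /\ b = b'.
  rewrite -rw => aw bh aw' bh' ab.
  have E : rect_point r a b =T rect_point r a' b'.
    by rewrite !(rect_pointE A); apply: same_of1 ab _; congr pair; rewrite /=; ring.
  have /forallP/(_ (Ordinal aw', Ordinal bh')) := emb (Ordinal aw, Ordinal bh).
  by rewrite /= E /= => /eqP[-> ->].
(* Height and width are odd because the rectangle joins different rows and different columns. *)
have h_odd : odd (rect_height r).
  have := congr1 odd (at_row A); rewrite odd_mod // oddD (odd_ord2 ij).
  by case: odd; case: odd.
have w_odd : odd w.
  have := congr1 odd (position_slide i w y' i); rewrite -zE eqxx odd_mod ?oddM ?andbF // oddD.
  have [zi _] := rect_at_column A.
  rewrite !odd_position zi (odd_ord2 (rect_at_neq_column A)).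
  by case: odd; case: odd.
have [w1|w_gt1] := leqP w 1.
  have w1' : w = 1%N by lia.
  by rewrite zE w1' big_ord1 slide0.
(* The lattice vector (w - 1, k) closes up the spiral. *)
pose m := w./2; have wE : w = (m * 2).+1 by rewrite -[w]odd_double_half w_odd -muln2.
have wN : (w < N)%N by rewrite -rw; apply: ltn_ord.
have [|v /andP[v0 vp] mv] := @lattice_column m; first by lia.
set h := rect_height r in embP h_odd *.
pose k := (v * 2)%N; have k_even : ~~ odd k by rewrite /k oddM andbF.
have column : ((m * 2)%N%:Z, k%:Z) =T 0 by [].
(* Otherwise the tiles (w - 1, k) and (0, 0) of [r] have the same image in T. *)
have hk : (h < k)%N.
  rewrite ltnNge; apply/negP => kh; have mw : (m * 2 < w)%N by lia.
  have kh' : (k < h)%N by lia.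
  by have [_ k0] := embP _ k 0%N 0%N mw kh' (ltnW w_gt1) (at_height A) column; lia.
(* Otherwise the tiles (w - 1, 0) and (0, N - k) have the same image. *)
have hkN : (h + k < N)%N.
  rewrite ltnNge; apply/negP => Nhk; have mw : (m * 2 < w)%N by lia.
  have kh' : (N - k < h)%N by lia.
  have kN : (k <= N)%N by lia.
  have [|m0 _] := embP (m * 2)%N 0%N 0%N (N - k)%N mw (at_height A) (ltnW w_gt1) kh'; last by lia.
  apply: same_of2 column (same_sym (vertical_period 2 p q)) _.
  by rewrite -subzn //; congr pair; rewrite /=; ring.
have N1 : (0 < 1 < N)%N by lia.
have khN : (0 < k - h < N)%N by lia.
have wN' : (0 < w.-2 < N)%N by lia.
have hN : (0 < h < N)%N by lia.
have hkN' : (0 < h + k < N)%N by lia.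
have w_lt : (w.-2 < w)%N by lia.
have w_ne1 : w != 1%N by lia.
have w_pred2 : w = w.-2.+2 by lia.
have w_pred1 : w.-1.+1 = w by lia.
have Mi t : point (slide i t y') i =T ((position y' i)%:Z + t%:Z, (i : nat)%:Z).
  by have := point_slide q i t y' i; rewrite eqxx.
have Mj t : point (slide i t y') j =T ((position y' j)%:Z - t%:Z, (j : nat)%:Z).
  by have := point_slide q i t y' j; rewrite (negPf ji).
(* From y', the generators x, y and z are reached by sliding 1, w - 1 and w. *)
have [x [xE xi xj]] : exists x, [/\ x = slide i 1 y',
    point x i =T ((position y' i)%:Z + 1, (i : nat)%:Z)
    & point x j =T ((position y' j)%:Z - 1, (j : nat)%:Z)] by exists (slide i 1 y').
have [y [yE yi yj]] : exists y, [/\ y = slide i w.-1 y',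
    point y i =T ((position y' i)%:Z + w.-1%:Z, (i : nat)%:Z)
    & point y j =T ((position y' j)%:Z - w.-1%:Z, (j : nat)%:Z)] by exists (slide i w.-1 y').
have zi : point z i =T ((position y' i)%:Z + w%:Z, (i : nat)%:Z) by rewrite zE.
have zj : point z j =T ((position y' j)%:Z - w%:Z, (j : nat)%:Z) by rewrite zE.
clear Mi Mj.
have mZ : (m * 2)%N%:Z = w%:Z - 1.
  by apply/eqP; rewrite eq_sym subr_eq -PoszD addn1; apply/eqP; congr Posz.
have w1Z : w.-1%:Z = w%:Z - 1 by rewrite -subn1 -subzn // ltnW.
have w2Z : w.-2%:Z = w%:Z - 2 by rewrite -subn2 -subzn.
have [r4 [A4 w4 h4]] : exists r4, [/\ rect_at x y' r4 j i, rect_width r4 = 1%N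
    & rect_height r4 = (k - h)%N].
  apply: rect_at_build => //.
  - by rewrite -subzn 1?ltnW //; apply: same_of4 (same_sym (at_urE A)) column xj (same_sym xi) _;
      rewrite !pointE rw; congr pair; rewrite /= ?w2Z ?w1Z ?mZ ?PoszD; ring.
  - by apply: same_of1 xj _; rewrite !pointE; congr pair; rewrite /=; ring.
  - by rewrite -subzn 1?ltnW //; apply: same_of3 (same_sym (at_urE A)) column xj _;
      rewrite !pointE rw; congr pair; rewrite /= ?w2Z ?w1Z ?mZ ?PoszD; ring.
  by move=> l lj li; rewrite (ord2_neq ij li) eqxx in lj.
have [r1 [A1 w1 h1]] : exists r1, [/\ rect_at x y r1 i j, rect_width r1 = w.-2
    & rect_height r1 = h].
  apply: rect_at_build => //.
  - apply: same_of3 (at_urE A) xi (same_sym xj) _.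
    by rewrite !pointE rw; congr pair; rewrite /= ?w2Z ?w1Z ?mZ ?PoszD; ring.
  - apply: same_of2 xi (same_sym yi) _.
    by rewrite !pointE; congr pair; rewrite /= ?w2Z ?w1Z ?mZ ?PoszD; ring.
  - apply: same_of3 (at_urE A) xi (same_sym yj) _.
    by rewrite !pointE rw; congr pair; rewrite /= ?w2Z ?w1Z ?mZ ?PoszD; ring.
  by move=> l li lj; rewrite (ord2_neq ij li) eqxx in lj.
have [r2 [A2 w2 h2]] : exists r2, [/\ rect_at y z r2 i j, rect_width r2 = 1%N
    & rect_height r2 = (h + k)%N].
  apply: rect_at_build => //.
  - apply: same_of4 (at_urE A) column yi (same_sym yj) _.
    by rewrite !pointE rw; congr pair; rewrite /= ?w2Z ?w1Z ?mZ ?PoszD; ring.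
  - apply: same_of2 yi (same_sym zi) _.
    by rewrite !pointE; congr pair; rewrite /= ?w2Z ?w1Z ?mZ ?PoszD; ring.
  - apply: same_of4 (at_urE A) column yi (same_sym zj) _.
    by rewrite !pointE rw; congr pair; rewrite /= ?w2Z ?w1Z ?mZ ?PoszD; ring.
  by move=> l li lj; rewrite (ord2_neq ij li) eqxx in lj.
have P : same_polygon q r1 r2 r4 r.
  by apply: same_polygon_spiral A1 A2 A4 A hk h1 w2 h2 w4 h4 _ _ => //; rewrite w1 rw.
have ne : (r1, r2) != (r4, r).
  by apply/eqP=> -[_ /(congr1 (@rect_width 1 p'))]; rewrite w2 rw => /esym/eqP; apply/negP.
have := edge_ratio_polygon Hpq H1 H2 (rect_at_is A1) (rect_at_is A2) (rect_at_is A4) (rect_at_is A) P ne.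
have emb1 : rect_embedded q r1.
  apply/forallP=> c; apply/forallP=> d; apply/implyP; rewrite !(rect_pointE A1) => cd.
  have cw (e : 'I_(rect_width r1) * 'I_(rect_height r1)) : (e.1 < w)%N /\ (e.2 < h)%N.
    by rewrite -h1 (leq_trans (ltn_ord e.1)) // w1 ltnW.
  have [|E1 E2] := embP _ _ _ _ (cw c).1 (cw c).2 (cw d).1 (cw d).2.
    by apply: same_of1 cd _; congr pair; rewrite /=; ring.
  by apply/eqP; rewrite [c]surjective_pairing [d]surjective_pairing; congr pair; apply/val_inj.
rewrite (IH w.-2 _ _ _ _ _ _ A1 emb1 w1) //.
have -> : edge x y' = edge y' x by exact: edge_ratio_sym.
move=> E; have -> : edge y' z = edge y' x (+)
    (\big[addb/false]_(t < w.-2) edge (slide i t x) (slide i t.+1 x) (+) edge y z).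
  by rewrite E addKb.
have -> : \big[addb/false]_(t < w) edge (slide i t y') (slide i t.+1 y') =
    edge (slide i 0 y') (slide i 1 y') (+)
    (\big[addb/false]_(t < w.-2) edge (slide i t.+1 y') (slide i t.+2 y') (+)
     edge (slide i w.-1 y') (slide i w.-1.+1 y')).
  exact: (big_addb_ends (fun t => edge (slide i t y') (slide i t.+1 y')) w_gt1).
rewrite slide0 w_pred1 -zE -yE -xE.
have E2 : \big[addb/false]_(t < w.-2) edge (slide i t x) (slide i t.+1 x) =
    \big[addb/false]_(t < w.-2) edge (slide i t.+1 y') (slide i t.+2 y').
  by clear E; apply: eq_bigr => t _; rewrite xE !slideD !add1n.
exact (congr1 (fun b => edge y' x (+) (b (+) edge y z)) E2).
Qed.

End TwoRowPotential.

(** * Potentials on a cycle without holonomy *)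

Section CyclePotential.
Variables (T : Type) (N : nat) (s : nat -> T -> T) (pos : T -> nat) (k : T -> bool).
Hypotheses (s0 : forall x, s 0 x = x) (sD : forall t u x, s t (s u x) = s (u + t) x).
Hypotheses (sN : forall x, s N x = x) (pos_lt : forall x, pos x < N).
Hypothesis pos_s : forall x, pos (s 1 x) = (pos x).+1 %% N.
Hypothesis holonomy : forall x, exists t, \big[addb/false]_(u < N) k (s u (s t x)) = false.

Let H x := \big[addb/false]_(u < N) k (s u x).

(** The holonomy does not depend on the starting point, so its vanishing at one point of each cycle
    suffices. *)
Lemma holonomy_step x : H (s 1 x) = H x.
Proof.
(* The same sum of [N.+1] terms is peeled off at its first and at its last term. *)
have E : \big[addb/false]_(u < N.+1) k (s u x) = \big[addb/false]_(u < N.+1) k (s u x) by [].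
move: E; rewrite {1}big_ord_recl big_ord_recr /= sN s0 addbC => /addIb E.
by rewrite /H -E; apply: eq_bigr => u _; rewrite sD add1n.
Qed.

Lemma holonomy0 x : H x = false.
Proof.
have [t <-] := holonomy x; rewrite -/(H (s t x)); elim: t => [|t IH]; first by rewrite s0.
by rewrite IH -addn1 -sD holonomy_step.
Qed.

(** Sum [k] from the point of the cycle with position 0 up to [x]; vanishing holonomy makes this
    consistent at the closing step. *)
Lemma cycle_potential : exists f : T -> bool, forall x, k x = f x (+) f (s 1 x).
Proof.
pose base x := s (N - pos x) x.
have sbase x : s (pos x) (base x) = x by rewrite sD subnK ?sN // ltnW.
exists (fun x => \big[addb/false]_(t < pos x) k (s t (base x))) => x.
have [lt|ge] := ltnP (pos x).+1 N.
  have E : base (s 1 x) = base x.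
    by rewrite /base pos_s modn_small // sD add1n subnSK.
  by rewrite E pos_s modn_small // big_ord_recr /= sbase addbA addbb.
have pE : N = (pos x).+1 by apply/eqP; rewrite eqn_leq ge pos_lt.
have E : base x = s 1 x by rewrite /base [in X in X - _]pE subSnn.
rewrite pos_s -pE modnn big_ord0 addbF E.
have := holonomy0 (s 1 x); rewrite /H pE big_ord_recr /= sD add1n -pE sN.
by case: (k x) => /=; case: (\big[_/_]_(_ < _) _).
Qed.
End CyclePotential.

(** * The potential for two rows *)

Section TwoRowGauge.
Import GRing.Theory Num.Theory Order.TTheory.
Local Open Scope ring_scope.
Variables p' q : nat.
Local Notation p := p'.+1.
Local Notation N := (p * 2)%N.
Local Notation generator := (generator 1 p').
Local Notation rectangle := (rectangle 1 p').
Local Notation point x l := (lattice_point (gen_point x l)).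
Local Notation rect_at := (@rect_at 1 p' q).
Local Notation "u =T v" := (same_point 2 p q u v) (at level 70).
Implicit Types (r : rectangle) (x y z : generator) (i j l : 'I_2).
Hypothesis Hpq : coprime p q.
Variables S1 S2 : sign_function 1 p' q.
Hypotheses (H1 : sign_assignment S1) (H2 : sign_assignment S2).
Local Notation edge := (edge_ratio S1 S2).

(** From a suitable start a rectangle of height 1 and width N - 1 exists, and it is embedded. The
    first N - 1 steps then sum to the ratio of its two ends, which the last step of the cycle joins
    again, so the total is zero. *)
Lemma edge_cycle x : exists t,
  \big[addb/false]_(u < N) edge (slide ord0 u (slide ord0 t x))
    (slide ord0 1 (slide ord0 u (slide ord0 t x))) = false.
Proof.
(* Sliding by t changes the difference of the two positions by 2t; this t puts the point on row 1
   just left of the one on row 0 modulo [N]. The division is exact because the positions have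
   different parities. *)
pose t := ((position x ord_max + 1 + (N - position x ord0)) %/ 2)%N.
have tE : (t * 2 = position x ord_max + 1 + (N - position x ord0))%N.
  rewrite /t divnK // dvdn2; have := odd_position_neq x; have := position_lt x ord0.
  move: (position _ _) (position _ _) => a b aN ab.
  rewrite !oddD oddB ?oddM ?andbF; last exact: ltnW.
  by move: ab; case: (odd a); case: (odd b).
exists t; have [y [yE y0 y1]] : exists y, [/\ y = slide ord0 t x,
    point y ord0 =T ((position x ord0)%:Z + t%:Z, 0)
    & point y ord_max =T ((position x ord_max)%:Z - t%:Z, 1)].
  exists (slide ord0 t x); split=> //;
    [exact: (point_slide q ord0 t x ord0)|exact: (point_slide q ord0 t x ord_max)].
rewrite -yE {yE}; have [z [zE z0 z1]] : exists z, [/\ z = slide ord0 N.-1 y,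
    point z ord0 =T ((position y ord0)%:Z + N.-1%:Z, 0)
    & point z ord_max =T ((position y ord_max)%:Z - N.-1%:Z, 1)].
  exists (slide ord0 N.-1 y); split=> //;
    [exact: (point_slide q ord0 N.-1 y ord0)|exact: (point_slide q ord0 N.-1 y ord_max)].
have tZ : t%:Z + t%:Z = (position x ord_max)%:Z + 1 + (N%:Z - (position x ord0)%:Z).
  by have := position_lt x ord0; lia.
have NZ : N.-1%:Z = N%:Z - 1 by lia.
have period := horizontal_period 2 p q.
have up : ((position y ord0)%:Z + N.-1%:Z, 1) =T point y ord_max.
  apply: (@same_of4 _ _ _ _ _ _ _ _ _ _ _ _ _ y0 (same_sym y1) period period).
  rewrite !pointE NZ; congr pair; rewrite /=.
  move: tZ; move: (t%:Z) (position x _)%:Z (position x _)%:Z (N%:Z) => a c b d ac.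
  by have -> : d = a + a - (b + 1) + c by [rewrite ac; ring]; ring.
have [r [A rw rh]] : exists r, [/\ rect_at y z r ord0 ord_max, rect_width r = N.-1
    & rect_height r = 1%N].
  apply: rect_at_build => //; try lia.
  - exact: same_sym z0.
  - apply: same_of2 up (same_sym z1) _.
    by rewrite !pointE NZ; congr pair; rewrite /=; ring.
  by move=> l l0 l1; rewrite (@ord2_neq ord0 ord_max l) ?eqxx in l1.
have emb : rect_embedded q r.
  apply/forallP=> c; apply/forallP=> d; apply/implyP; rewrite !(rect_pointE A).
  have cN (e : 'I_(rect_width r) * 'I_(rect_height r)) : (e.1 < N)%N /\ e.2 = 0%N :> nat.
    have e2 := leq_trans (ltn_ord e.2) (eq_leq rh).
    by split; [have := leq_trans (ltn_ord e.1) (eq_leq rw); lia|lia].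
  move=> cd; have E1 : c.1 = d.1 :> nat.
    apply: (@dvdz_small N); [by have [] := cN c|by have [] := cN d|].
    have := same_row_point cd; rewrite /= (cN c).2 (cN d).2 => /(_ erefl).
    by rewrite (_ : _ - _ = (c.1 : nat)%:Z - (d.1 : nat)%:Z) //; ring.
  apply/eqP; rewrite [c]surjective_pairing [d]surjective_pairing.
  by congr pair; apply/val_inj; rewrite //= (cN c).2 (cN d).2.
have E := edge_embedded Hpq H1 H2 A emb rw.
have -> : \big[addb/false]_(u < N) edge (slide ord0 u y) (slide ord0 1 (slide ord0 u y)) =
    \big[addb/false]_(u < N.-1.+1) edge (slide ord0 u y) (slide ord0 u.+1 y).
  by apply: eq_bigr => u _; rewrite slideD addn1.
rewrite big_ord_recr -E.
have -> : slide ord0 (ord_max : 'I_N.-1.+1).+1 y = y by exact: slide_period.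
by rewrite -zE (edge_ratio_sym Hpq H1 H2 z); case: (edge y z).
Qed.

Lemma two_row_potential : exists f : generator -> bool,
  forall x y r, is_rect q x y r -> rect_embedded q r -> edge x y = f x (+) f y.
Proof.
have [||||||f fE] := @cycle_potential generator N (slide ord0)
    (fun x => position x ord0) (fun x => edge x (slide ord0 1 x)).
- exact: slide0.
- exact: slideD.
- exact: slide_period.
- by move=> x; apply: position_lt.
- by move=> x; rewrite position_slide eqxx addn1.
- exact: edge_cycle.
exists f => x y r /is_rectP[i [j A]] emb.
(* Sliding along [ord_max] is the inverse of sliding along [ord0], and the ratio is symmetric. *)
have step u : edge u (slide i 1 u) = f u (+) f (slide i 1 u).
  move: i {A j emb} => i; move: i u; apply: ord2P => // u.
  have := fE (slide ord_max 1 u); rewrite (@slideK _ ord_max ord0) // => E.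
  by rewrite (edge_ratio_sym Hpq H1 H2) E addbC.
rewrite (edge_embedded Hpq H1 H2 A emb erefl) (rect_at_slide A).
elim: (rect_width r) => [|w IH]; first by rewrite big_ord0 slide0 addbb.
have E : slide i w.+1 x = slide i 1 (slide i w x) by rewrite slideD addn1.
rewrite big_ord_recr IH /= E step.
by case: (f _); case: (f _); case: (f _).
Qed.
End TwoRowGauge.

(** * The potential in general, and the theorem *)

Section Gauge.
Import GRing.Theory.
Local Open Scope ring_scope.
Variables n' p' q : nat.
Local Notation n := n'.+1.
Local Notation p := p'.+1.
Local Notation generator := (generator n' p').
Implicit Types (r : rectangle n' p') (x y : generator).
Hypothesis Hpq : coprime p q.

(** The height of the rectangle realises some reflection, and by [rect_at_det] the rows and the
    height determine the target. *)
Lemma rect_at_reflect x y r i j : rect_at q x y r i j -> exists a, y = reflect_gen i j a x.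
Proof.
move=> A; exists (inZp (q * ((i + rect_height r) %/ n))).
have hP : height_of q i j (inZp (q * ((i + rect_height r) %/ n)) : 'I_p) (rect_height r).
  by split; [rewrite (at_height A) ltn_ord|exact: at_row A|].
have [r' [A' h']] := rect_exists x (at_neq A) hP.
by have [] := rect_at_det Hpq A A'; rewrite ?h' ?eqxx ?orbT.
Qed.

Variables S1 S2 : sign_function n' p' q.
Hypotheses (H1 : sign_assignment S1) (H2 : sign_assignment S2).

(** The double cover gives the potential for n >= 3 and the slides give it for n = 2; for n = 1
    there are no two distinct rows, hence no rectangles. *)
Lemma gauge_exists : exists f : generator -> bool,
  forall x y r, is_rect q x y r -> rect_embedded q r -> edge_ratio S1 S2 x y = f x (+) f y.
Proof.
case: (ltnP 2 n) => [n3|].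
  have [f fE] : exists f : generator -> bool, forall x i j a, i != j ->
      edge_ratio S1 S2 x (reflect_gen i j a x) = f x (+) f (reflect_gen i j a x).
    have far := edge_far Hpq H1 H2.
    have tri x i j k a b u3 := (@edge_triangle _ _ _ Hpq _ _ H1 H2 x i j k a b u3).1.
    exact: (potential_exists n3 (edge_ratio_sym Hpq H1 H2) far tri).
  exists f => x y r /is_rectP[i [j A]] _.
  by have [a ->] := rect_at_reflect A; apply: fE; apply: at_neq A.
move: H1 H2; case: n' S1 S2 => [|[|//]] T1 T2 A1 A2 _; last exact: two_row_potential.
exists (fun=> false) => x y r /is_rectP[i [j /at_neq]].
by rewrite !ord1.
Qed.

Lemma sign_assignment_homology (G : grid n' p' q) (K : comNzRingType)
  (ev : {rmorphism {mpoly int[n]} -> K}) : grid_homology_iso G ev S1 S2.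
Proof.
have [f fE] := gauge_exists; apply: (@gauge_homology_iso _ _ _ _ _ _ f) => x y r /andP[_ emb].
by rewrite (edge_ratio_sign Hpq H1 H2 r) (fE _ _ _ (valP r) emb).
Qed.
End Gauge.

Theorem theorem1p1 (n' p' q : nat) (Hpq : lens_parameters p'.+1 q)
    (G : grid n' p' q) (HK : represents_knot G) :
  ((exists S : sign_function n' p' q, sign_assignment S)
   /\ (exists rho : 'S_n'.+1 -> spin n'.+1, spin_section rho)
   /\ (forall rho : 'S_n'.+1 -> spin n'.+1, spin_section rho ->
         sign_assignment (sign_rho (p' := p') (q := q) rho)))
  /\
  (forall S1 S2 : sign_function n' p' q,
     sign_assignment S1 -> sign_assignment S2 ->
     GCminus_homology_iso G S1 S2 /\ GChat_homology_iso G S1 S2).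
Proof.
have /andP[coprime_pq _] := Hpq.
split; last by move=> S1 S2 H1 H2; split; apply: sign_assignment_homology.
have [rho rhoP] := spin_section_exists n'.+1.
split; first by exists (sign_rho rho); apply: sign_rho_assignment.
by split=> [|rho' rho'P]; [exists rho|apply: sign_rho_assignment].
Qed.
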